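(* Let $n\ge 1$. Then for all $u\in S(\mathbb{R}^{n-1}\times\mathbb{R}_{>0})$, $$\int_{\mathbb{R}^{n-1}\times\mathbb{R}_{>0}}|\nabla u(x)|^2\,dx\;\int_{\mathbb{R}^{n-1}\times\mathbb{R}_{>0}}|x|^2|u(x)|^2\,dx\;\ge\;\frac{(n+2)^2}{4}\left(\int_{\mathbb{R}^{n-1}\times\mathbb{R}_{>0}}|u(x)|^2\,dx\right)^2.$$ The constant $\frac{(n+2)^2}{4}$ is sharp (it cannot be replaced by a larger one), and equality holds if and only if $u$ is of the form $u(x)=\alpha x_n e^{-\beta|x|^2}$ for some constants $\alpha$ and $\beta$ with $\beta>0$.
   Context: $\mathbb{R}_{>0}=(0,\infty)$. $C_c^\infty(\mathbb{R}^{n-1}\times\mathbb{R}_{>0})$ is the space of smooth functions with compact support in the open half-space. $S(\mathbb{R}^{n-1}\times\mathbb{R}_{>0})$ is the completion of $C_c^\infty(\mathbb{R}^{n-1}\times\mathbb{R}_{>0})$ under the norm $\left(\int|\nabla u(x)|^2dx\right)^{1/2}+\left(\int|x|^2|u(x)|^2dx\right)^{1/2}$, integrals being over $\mathbb{R}^{n-1}\times\mathbb{R}_{>0}$. Functions are real-valued and constants are real. *)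

(* Defs.v *)
From HB Require Import structures.
From mathcomp Require Import all_boot all_order all_algebra.
From mathcomp Require Import all_classical all_reals all_analysis.

Set Implicit Arguments.
Unset Strict Implicit.
Unset Printing Implicit Defensive.

Import Order.TTheory GRing.Theory Num.Theory.
Import numFieldNormedType.Exports.

Local Open Scope classical_set_scope.
Local Open Scope ring_scope.

(* The sigma-algebra on R^n generated by the coordinates, i.e. the Borel sets
   (the library has this structure on n.-tuple R, but not on 'rV[R]_n). *)
Definition measure_rV_display : measure_display -> measure_display.
Proof. exact. Qed.

Section measurable_rV.
Context (R : realType) (n : nat).

Let coords : 'I_n -> 'rV[R]_n -> measurableTypeR R := fun i x => x 0 i.

Let rV_set0 : g_sigma_preimage coords set0.
Proof. exact: sigma_algebra0. Qed.

Let rV_setC A : g_sigma_preimage coords A -> g_sigma_preimage coords (~` A).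
Proof. exact: sigma_algebraC. Qed.

Let rV_bigcup (F : _^nat) : (forall i, g_sigma_preimage coords (F i)) ->
  g_sigma_preimage coords (\bigcup_i (F i)).
Proof. exact: sigma_algebra_bigcup. Qed.

HB.instance Definition _ := @isMeasurable.Build
  (measure_rV_display default_measure_display)
  'rV[R]_n (g_sigma_preimage coords) rV_set0 rV_setC rV_bigcup.

End measurable_rV.

Section lebesgue_rV.
Context (R : realType).

Lemma measurable_coord n (i : 'I_n) :
  measurable_fun [set: 'rV[R]_n] (fun x => x 0 i : measurableTypeR R).
Proof.
move=> _ Y mY; rewrite setTI; apply: sub_sigma_algebra => /=.
rewrite -bigcup_seq/=; exists i => /=; first by rewrite mem_index_enum.
by exists Y => //; rewrite setTI.
Qed.

Lemma measurable_fun_coordP d (T : measurableType d) n (f : T -> 'rV[R]_n) :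
  (forall i, measurable_fun [set: T] (fun t => f t 0 i : measurableTypeR R)) ->
  measurable_fun [set: T] f.
Proof.
move=> mf; apply: (@measurability _ _ _ _ _ _
  (\big[setU/set0]_(i < n) preimage_set_system [set: 'rV[R]_n]
     (fun x => x 0 i) (@measurable _ (measurableTypeR R)))) => //.
move=> _ [B + <-]; rewrite -bigcup_seq => -[i _ [A mA <-]].
by rewrite [X in measurable (_ `&` X)](_ : _ =
  (fun t => f t 0 i) @^-1` A); [exact: mf|rewrite setTI].
Qed.

Definition snoc_rV n (p : 'rV[R]_n * measurableTypeR R) : 'rV[R]_n.+1 :=
  \row_i (if unlift ord_max i is Some j then p.1 0 j else p.2).

Lemma measurable_snoc_rV n :
  measurable_fun [set: 'rV[R]_n * measurableTypeR R] (@snoc_rV n).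
Proof.
apply: measurable_fun_coordP => i.
rewrite (_ : (fun _ => _) = fun p : 'rV[R]_n * measurableTypeR R =>
  if unlift ord_max i is Some j then p.1 0 j else p.2); last first.
  by apply/funext => p; rewrite mxE.
case: (unlift ord_max i) => [j|]; last exact: measurable_snd.
exact: (measurableT_comp (measurable_coord j)).
Qed.

Section snoc_measure.
Context n (mu : {measure set 'rV[R]_n -> \bar R}).

Definition snoc_measure : set 'rV[R]_n.+1 -> \bar R :=
  pushforward (mu \x @lebesgue_measure R)%E (@snoc_rV n).

Let mu_snoc : {measure set 'rV[R]_n.+1 -> \bar R} :=
  measure_function_pushforward__canonical__measure_function_Measure
    (mu \x @lebesgue_measure R)%E (@measurable_snoc_rV n).

HB.instance Definition _ := isMeasure.Build _ _ _ snoc_measure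
  (measure0 mu_snoc) (measure_ge0 mu_snoc)
  (@measure_semi_sigma_additive _ _ _ mu_snoc).

End snoc_measure.

(* Lebesgue measure on R^n, as the n-fold product of the Lebesgue measure
   on R. *)
Fixpoint lebesgue_rV n : {measure set 'rV[R]_n -> \bar R} :=
  if n is m.+1 then snoc_measure (lebesgue_rV m) else \d_ (0 : 'rV[R]_0).

Lemma lebesgue_rV_box n (B : 'I_n -> set (measurableTypeR R)) :
  (forall i, measurable (B i)) ->
  lebesgue_rV n [set x | forall i, B i (x 0 i)] =
  (\prod_(i < n) lebesgue_measure (B i))%E.
Proof.
elim: n B => [|n IHn] B mB.
  rewrite big_ord0 /= diracE mem_set// => -[]//.
rewrite big_ord_recr/= -(IHn (fun i => B (widen_ord (leqnSn n) i)))//.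
have mbox : measurable [set x : 'rV[R]_n |
    forall i, B (widen_ord (leqnSn n) i) (x 0 i)].
  rewrite (_ : [set _ | _] = \bigcap_(i in [set: 'I_n])
     ((fun x : 'rV[R]_n => x 0 i) @^-1` B (widen_ord (leqnSn n) i))).
    apply: fin_bigcap_measurable => // i _.
    by rewrite -[X in measurable X]setTI; exact: measurable_coord.
  by apply/seteqP; split => [x Bx i _|x Bx i]; exact: Bx.
rewrite -[RHS]product_measure1E//.
congr (product_measure1 _ _ _).
apply/seteqP; split => -[x t] /=.
- move=> Bxt; split => [i|].
  + have := Bxt (widen_ord (leqnSn n) i).
    by rewrite mxE (_ : widen_ord _ i = lift ord_max i) ?liftK//; by apply: val_inj; rewrite /= /bump leqNgt ltn_ord.
  + by have := Bxt ord_max; rewrite mxE unlift_none.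
- move=> [Bx Bt] i; rewrite mxE; case: unliftP => [j ->|-> //].
  rewrite (_ : lift ord_max j = widen_ord (leqnSn n) j); first exact: Bx.
  by apply: val_inj; rewrite /= /bump leqNgt ltn_ord.
Qed.

End lebesgue_rV.

Section half_space.
Context (R : realType).

Definition last_coord m (x : 'rV[R]_m.+1) : R := x 0 ord_max.

(* R^m x R_{>0} inside R^(m+1) *)
Definition half_space m : set 'rV[R]_m.+1 := [set x | 0 < last_coord x].
Arguments half_space : clear implicits.

(* |x|^2 for the Euclidean norm: the library's `|x| on matrices is the
   sup norm. *)
Definition sqnorm n (x : 'rV[R]_n) : R := \sum_(i < n) x 0 i ^+ 2.

Definition partial n (i : 'I_n.+1) (f : 'rV[R]_n.+1 -> R) : 'rV[R]_n.+1 -> R :=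
  'D_(delta_mx 0 i) f.

Definition grad n (f : 'rV[R]_n.+1 -> R) (x : 'rV[R]_n.+1) : 'rV[R]_n.+1 :=
  \row_i partial i f x.

Definition smooth n (f : 'rV[R]_n.+1 -> R) : Prop :=
  forall s : seq 'I_n.+1,
    continuous (foldr (@partial n) f s) /\
    forall i x, derivable (foldr (@partial n) f s) x (delta_mx 0 i).

(* Functions on the half-space with compact support in it are identified with
   their extensions by 0 to the whole space. *)
Definition Cc_smooth m (f : 'rV[R]_m.+1 -> R) : Prop :=
  [/\ smooth f, compact (closure [set x | f x != 0]) &
      closure [set x | f x != 0] `<=` half_space m].

Local Open Scope ereal_scope.

Definition int_half_space m (f : 'rV[R]_m.+1 -> R) : \bar R :=
  \int[lebesgue_rV R m.+1]_(x in half_space m) (f x)%:E.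

Definition gradient_energy m (v : 'rV[R]_m.+1 -> 'rV[R]_m.+1) : \bar R :=
  int_half_space (fun x => sqnorm (v x)).

Definition second_moment m (u : 'rV[R]_m.+1 -> R) : \bar R :=
  int_half_space (fun x => sqnorm x * `|u x| ^+ 2)%R.

Definition mass m (u : 'rV[R]_m.+1 -> R) : \bar R :=
  int_half_space (fun x => `|u x| ^+ 2)%R.

Definition S_norm m (u : 'rV[R]_m.+1 -> R) (v : 'rV[R]_m.+1 -> 'rV[R]_m.+1) :
    \bar R :=
  sqrte (gradient_energy v) + sqrte (second_moment u).

(* [in_S u Du]: u belongs to the completion S of the compactly supported smooth
   functions for the norm S_norm phi (grad phi), and Du is its gradient. The
   completion is realized by functions: the limit of a Cauchy sequence phi_k is
   the pair formed by the limit u of phi_k in L^2(|x|^2 dx) and the limit Du of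
   grad phi_k in L^2(dx), Du being the extension by continuity of the gradient
   from the dense subspace. Functions are considered up to null sets, and only
   their values on the half-space matter. *)
Definition in_S m (u : 'rV[R]_m.+1 -> R) (Du : 'rV[R]_m.+1 -> 'rV[R]_m.+1) :
    Prop :=
  [/\ measurable_fun (half_space m) u, measurable_fun (half_space m) Du &
    exists phi : nat -> 'rV[R]_m.+1 -> R,
      (forall k, Cc_smooth (phi k)) /\
      S_norm (phi k \- u)%R (grad (phi k) \- Du)%R @[k --> \oo] --> 0].

Definition gaussian_profile m (alpha beta : R) (x : 'rV[R]_m.+1) : R :=
  (alpha * last_coord x * expR (- (beta * sqnorm x)))%R.

Definition has_gaussian_form m (u : 'rV[R]_m.+1 -> R) : Prop :=
  exists alpha beta : R, (0 < beta)%R /\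
    {ae lebesgue_rV R m.+1, forall x, half_space m x ->
      u x = gaussian_profile alpha beta x}.

End half_space.

(* Main.v *)
From HB Require Import structures.
Require Import Defs.
From mathcomp Require Import all_boot all_order all_algebra.
From mathcomp Require Import all_classical all_reals all_analysis.
From mathcomp Require Import measurable_realfun ring lra.

(* Fix b > 0 and let w(x) = x_n exp(-b |x|^2), which is positive on the
   half-space, vanishes on its boundary and satisfies
   Delta w = (4 b^2 |x|^2 - 2 b (n + 2)) w. For phi in Cc, writing
   phi = psi w and integrating by parts gives the ground state identity
     int |grad phi|^2 + 4 b^2 int |x|^2 phi^2 - 2 b (n + 2) int phi^2
       = int w^2 |grad psi|^2 >= 0.
   By density the left-hand side is nonnegative on S; as a quadratic
   polynomial in b it has nonpositive discriminant, which is the inequality.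
   When equality holds for u, choose b so that the left-hand side vanishes at
   u: if phi_k -> u in S then int w^2 |grad (phi_k / w)|^2 -> 0, and an L1
   Poincare inequality on boxes exhausting the half-space, on each of which w is
   bounded below, shows that u / w is constant. *)

Set Implicit Arguments.
Unset Strict Implicit.
Unset Printing Implicit Defensive.

Import Order.TTheory GRing.Theory Num.Theory.
Import numFieldNormedType.Exports.
Local Open Scope classical_set_scope.
Local Open Scope ring_scope.

(** * Lebesgue measure on R^n *)

(** The constant: [w] is the Dirichlet ground state of the harmonic oscillator on the half-space. In
    its Laplacian the Gaussian contributes [- 2 b n], and the cross term between [x_n] and the
    Gaussian another [- 4 b]; hence [n + 2]. The identity uses only [w > 0] on the half-space, so it
    holds for every real [b], as the discriminant argument requires. Three difficulties shape the
    rest. The weight [|x|^2] in the norm of S degenerates at the origin, so convergence in S does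
    not visibly give convergence in L2; the identity at [b = 1/2] bounds the mass by energy plus
    moment and repairs this. The gradient [Du] is a datum attached to [u], so its energy must be
    shown to depend only on the class of [u] up to null sets; this is the closability of the
    gradient, proved by Green's formula. Finally, equality for Gaussians is obtained without
    computing any Gaussian integral: the eigenvalue equation, tested against approximations of the
    Gaussian, makes the left-hand side of the identity vanish, and together with the inequality this
    forces equality. *)

Section borel_rV.
Context (R : realType).

Lemma measurable_countType_preimage d (T : measurableType d) (U : countType)
    (f : T -> U) (A : set U) :
  (forall z, measurable (f @^-1` [set z])) -> measurable (f @^-1` A).
Proof.
move=> mf.
rewrite (_ : f @^-1` A = \bigcup_(z in [set: U])
    (if z \in A then f @^-1` [set z] else set0)).
  apply: countable_bigcupT_measurable => [|z]; first exact: countableP.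
  by case: ifPn.
apply/seteqP; split => [t At|t [z _]].
  by exists (f t) => //; rewrite mem_set.
by case: ifPn => // /[!inE] Az /= ->.
Qed.

(* A continuous function is the pointwise limit of its compositions with the
   roundings of all coordinates to multiples of 1 / (k + 1). *)
Lemma continuous_measurable_fun_rV n (f : 'rV[R]_n -> R) :
  continuous f -> measurable_fun [set: 'rV[R]_n] f.
Proof.
move=> cf.
pose fl k (x : 'rV[R]_n) : 'rV[int]_n :=
  \row_i Num.floor (x 0 i * k.+1%:R).
pose pt k (z : 'rV[int]_n) : 'rV[R]_n := \row_i ((z 0 i)%:~R / k.+1%:R).
apply: (measurable_fun_cvg (h := fun k => f \o pt k \o fl k)) => [k|x _].
  move=> _ Y _; rewrite setTI -[X in measurable X]/(fl k @^-1` ((f \o pt k) @^-1` Y)).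
  apply: measurable_countType_preimage => z.
  rewrite (_ : _ @^-1` _ = \bigcap_(i in [set: 'I_n])
    ((fun x : 'rV[R]_n => x 0 i) @^-1`
      ((fun t : R => t * k.+1%:R) @^-1` ((@Num.floor R) @^-1` [set z 0 i])))).
    apply: fin_bigcap_measurable => // i _.
    rewrite -[X in measurable X]setTI; apply: measurable_coord => //.
    rewrite -[X in measurable X]setTI.
    have mm : measurable_fun [set: R] (fun t : R => t * k.+1%:R).
      exact: mulrr_measurable.
    apply: mm => //.
    rewrite (_ : _ @^-1` _ = `[(z 0 i)%:~R, (z 0 i + 1)%:~R[%classic)//.
    apply/seteqP; split => t /=; rewrite in_itv/=.
      by move=> <-; rewrite floor_le floorD1_gt.
    by move=> zt; apply/eqP; rewrite floor_eq.
  apply/seteqP; split => [y <- i _/=|y yz]; first by rewrite mxE.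
  by apply/rowP => i; rewrite mxE; exact: yz.
suff cx : (fun k => pt k (fl k x)) @ \oo --> x by exact: cvg_comp cx (cf x).
apply/cvg_ballP => e e0.
near=> k; split => // i j; rewrite ord1 {i}.
rewrite /ball/= !mxE.
have k0 : 0 < k.+1%:R :> R by [].
rewrite -[x in `|x - _|](mulfK (lt0r_neq0 k0)) -mulrBl normrM.
rewrite (gtr0_norm (x := _^-1)) ?invr_gt0// ltr_pdivrMr//.
rewrite ger0_norm ?subr_ge0 ?floor_le//.
have := floorD1_gt (x 0 j * k.+1%:R); rewrite intrD => h.
apply: (@lt_trans _ _ 1); first by rewrite ltrBlDl.
rewrite -ltr_pdivrMr// mul1r.
near: k; exact: (near_infty_natSinv_lt (PosNum e0)).
Unshelve. all: by end_near. Qed.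

Lemma measurable_open_rV n (A : set 'rV[R]_n) :
  (exists2 f : 'rV[R]_n -> R, continuous f & A = [set x | 0 < f x]) ->
  measurable A.
Proof.
move=> [f cf ->]; rewrite -[X in measurable X]setTI.
rewrite (_ : [set _ | _] = f @^-1` `]0, +oo[%classic).
  exact: continuous_measurable_fun_rV.
by apply/seteqP; split => x /=; rewrite in_itv/= andbT.
Qed.

End borel_rV.

Section lebesgue_rV_tonelli.
Context (R : realType).
Local Open Scope ereal_scope.

Lemma measurable_box n (B : 'I_n -> set R) :
  (forall i, measurable (B i)) ->
  measurable [set x : 'rV[R]_n | forall i, B i (x 0%R i)].
Proof.
move=> mB; rewrite (_ : [set _ | _] = \bigcap_(i in [set: 'I_n])
    ((fun x : 'rV[R]_n => x 0%R i) @^-1` B i)).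
  apply: fin_bigcap_measurable => // i _.
  by rewrite -[X in measurable X]setTI; apply: measurable_coord => //; exact: mB.
by apply/seteqP; split => [x Bx i _|x Bx i]; exact: Bx.
Qed.

Lemma sigma_finite_lebesgue_rV n : sigma_finite [set: 'rV[R]_n] (lebesgue_rV R n).
Proof.
pose I (k : nat) : set R := (`[- k%:R, k%:R]%classic)%R.
exists (fun k => [set x : 'rV[R]_n | forall i, I k (x 0%R i)]).
  apply/seteqP; split => // x _.
  exists (Num.truncn `|x|%R).+1 => // i /=; rewrite /I/= in_itv/= -ler_norml.
  apply: (@le_trans _ _ `|x|%R); last by rewrite ltW// truncnS_gt.
  rewrite [leRHS]/Num.norm/= mx_normrE.
  by apply/bigmax_geP; right => /=; exists (ord0, i).
have mI k : measurable (I k) by exact: measurable_itv.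
move=> k; split; first exact: (@measurable_box n (fun=> I k) (fun=> mI k)).
rewrite (@lebesgue_rV_box R n (fun=> I k)); last by move=> _; exact: mI.
suff h : (\prod_(i < n) lebesgue_measure (I k))%E \is a fin_num.
  by rewrite -ge0_fin_numE //; apply: prode_ge0 => i _; exact: measure_ge0.
apply: prode_fin_num => i _; rewrite lebesgue_measure_itv/=.
by case: ifP.
Qed.

(* [lebesgue_rV n], under a name that can carry a sigma-finite instance. *)
Definition lebn n : set 'rV[R]_n -> \bar R := lebesgue_rV R n.
HB.instance Definition _ n := Measure.on (@lebn n).
HB.instance Definition _ n := Measure_isSigmaFinite.Build _ _ _ (@lebn n)
  (@sigma_finite_lebesgue_rV n).

Lemma integral_snoc n (f : 'rV[R]_n.+1 -> \bar R) :
  measurable_fun [set: 'rV[R]_n.+1] f -> (forall x, 0 <= f x) ->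
  \int[lebesgue_rV R n.+1]_x f x =
  \int[lebesgue_rV R n]_x \int[@lebesgue_measure R]_t f (snoc_rV (x, t)).
Proof.
move=> mf f0.
have := @ge0_integral_pushforward _ _ _ _ R _ (@measurable_snoc_rV R n)
  (@lebn n \x @lebesgue_measure R) setT f measurableT mf (fun y _ => f0 y).
rewrite preimage_setT fubini_tonelli1; [exact| |move=> x; exact: f0].
exact: (measurableT_comp mf (@measurable_snoc_rV R n)).
Qed.

(** Both orders are used in the inductions on the dimension: the last coordinate goes inside to
    reach lines in the last direction, outside to reach slices of lower dimension. *)
Lemma integral_snocC n (f : 'rV[R]_n.+1 -> \bar R) :
  measurable_fun [set: 'rV[R]_n.+1] f -> (forall x, 0 <= f x) ->
  \int[lebesgue_rV R n.+1]_x f x =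
  \int[@lebesgue_measure R]_t \int[lebesgue_rV R n]_x f (snoc_rV (x, t)).
Proof.
move=> mf f0.
have := @ge0_integral_pushforward _ _ _ _ R _ (@measurable_snoc_rV R n)
  (@lebn n \x @lebesgue_measure R) setT f measurableT mf (fun y _ => f0 y).
rewrite preimage_setT fubini_tonelli2; [exact| |move=> x; exact: f0].
exact: (measurableT_comp mf (@measurable_snoc_rV R n)).
Qed.

End lebesgue_rV_tonelli.
Arguments lebn : clear implicits.

Section lines.
Context (R : realType).

Lemma snoc_line_lift n (x : 'rV[R]_n) (t s : R) (j : 'I_n) :
  snoc_rV (x + s *: delta_mx 0 j, t) =
  snoc_rV (x, t) + s *: delta_mx 0 (lift ord_max j) :> 'rV[R]_n.+1.
Proof.
apply/rowP => k; rewrite !mxE/=; case: unliftP => [l ->|->].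
  by rewrite !mxE/= (inj_eq lift_inj).
by rewrite (negbTE (neq_lift _ _)) mulr0 addr0.
Qed.

Lemma snoc_line_max n (x : 'rV[R]_n) (t s : R) :
  snoc_rV (x, t + s) = snoc_rV (x, t) + s *: delta_mx 0 ord_max :> 'rV[R]_n.+1.
Proof.
apply/rowP => k; rewrite !mxE/=; case: unliftP => [l ->|->].
  by rewrite eq_sym (negbTE (neq_lift _ _)) mulr0 addr0.
by rewrite !eqxx mulr1.
Qed.

Lemma measurable_snoc_l n (t : R) :
  measurable_fun [set: 'rV[R]_n] (fun x => snoc_rV (x, t)).
Proof.
apply: (measurableT_comp (@measurable_snoc_rV R n) (g := fun x => (x, t))).
exact: measurable_fun_pair.
Qed.

Lemma measurable_snoc_r n (x : 'rV[R]_n) :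
  measurable_fun [set: measurableTypeR R] (fun t => snoc_rV (x, t)).
Proof.
apply: (measurableT_comp (@measurable_snoc_rV R n) (g := fun t => (x, t))).
exact: measurable_fun_pair.
Qed.

Local Open Scope ereal_scope.

Lemma measurable_integral_snoc_r n (f : 'rV[R]_n.+1 -> \bar R) :
  measurable_fun [set: 'rV[R]_n.+1] f -> (forall x, 0 <= f x) ->
  measurable_fun [set: 'rV[R]_n]
    (fun x => \int[@lebesgue_measure R]_t f (snoc_rV (x, t))).
Proof.
move=> mf f0.
apply: (@measurable_fun_fubini_tonelli_F _ _ _ _ R
  (@lebesgue_measure R) (f \o @snoc_rV R n)) => [|x]; last exact: f0.
exact: (measurableT_comp mf (@measurable_snoc_rV R n)).
Qed.

Lemma measurable_integral_snoc_l n (f : 'rV[R]_n.+1 -> \bar R) :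
  measurable_fun [set: 'rV[R]_n.+1] f -> (forall x, 0 <= f x) ->
  measurable_fun [set: measurableTypeR R]
    (fun t => \int[lebesgue_rV R n]_x f (snoc_rV (x, t))).
Proof.
move=> mf f0.
have mfs := measurableT_comp mf (@measurable_snoc_rV R n).
exact: (@measurable_fun_fubini_tonelli_G _ _ _ _ R
  (lebn R n) (f \o @snoc_rV R n) mfs (fun=> f0 _)).
Qed.

(** Tonelli in an arbitrary direction, by induction on [n]: if [i] is not the last direction, the
    lines lie in slices where the last coordinate is fixed; otherwise the inner integral is already
    taken along them. *)
Lemma le_integral_lines n (i : 'I_n) (g h : 'rV[R]_n -> \bar R) :
  measurable_fun [set: 'rV[R]_n] g -> (forall x, 0 <= g x) ->
  measurable_fun [set: 'rV[R]_n] h -> (forall x, 0 <= h x) ->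
  (forall x, \int[@lebesgue_measure R]_t g (x + t *: delta_mx 0 i)%R <=
             \int[@lebesgue_measure R]_t h (x + t *: delta_mx 0 i)%R) ->
  \int[lebesgue_rV R n]_x g x <= \int[lebesgue_rV R n]_x h x.
Proof.
elim: n i g h => [|n IHn] i g h mg g0 mh h0 gh; first by have := ltn_ord i.
have [j ij|imax] := unliftP ord_max i.
  rewrite !integral_snocC//; apply: ge0_le_integral => //.
  - by move=> t _; exact: integral_ge0.
  - exact: (measurable_integral_snoc_l mg g0).
  - exact: (measurable_integral_snoc_l mh h0).
  move=> t _; apply: (IHn j) => //.
  - exact: (measurableT_comp mg (measurable_snoc_l t)).
  - exact: (measurableT_comp mh (measurable_snoc_l t)).
  move=> x; under eq_integral do rewrite snoc_line_lift -ij.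
  by under [leRHS]eq_integral do rewrite snoc_line_lift -ij.
rewrite !integral_snoc//; apply: ge0_le_integral => //.
- by move=> t _; exact: integral_ge0.
- exact: (measurable_integral_snoc_r mg g0).
- exact: (measurable_integral_snoc_r mh h0).
(* Writing [t] as [0 + t] exhibits the inner integral as one along the line through [(x, 0)]. *)
move=> x _; under eq_integral do rewrite -[t in snoc_rV (_, t)]add0r snoc_line_max -imax.
by under [leRHS]eq_integral do rewrite -[t in snoc_rV (_, t)]add0r snoc_line_max -imax.
Qed.

Lemma eq_integral_lines n (i : 'I_n) (g h : 'rV[R]_n -> \bar R) :
  measurable_fun [set: 'rV[R]_n] g -> (forall x, 0 <= g x) ->
  measurable_fun [set: 'rV[R]_n] h -> (forall x, 0 <= h x) ->
  (forall x, \int[@lebesgue_measure R]_t g (x + t *: delta_mx 0 i)%R =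
             \int[@lebesgue_measure R]_t h (x + t *: delta_mx 0 i)%R) ->
  \int[lebesgue_rV R n]_x g x = \int[lebesgue_rV R n]_x h x.
Proof.
move=> mg g0 mh h0 gh; apply/eqP; rewrite eq_le.
by rewrite !(@le_integral_lines _ i)// => x; rewrite gh.
Qed.

End lines.

(** * An L1 Poincare inequality on boxes *)

Section poincare.
Context (R : realType).

Definition box n (B : 'I_n -> set R) : set 'rV[R]_n :=
  [set x | forall i, B i (x 0 i)].

Lemma box_snoc n (B : 'I_n.+1 -> set R) x t :
  box B (snoc_rV (x, t)) <-> box (B \o lift ord_max) x /\ B ord_max t.
Proof.
split => [Bx|[Bx Bt] i]; last first.
  by rewrite mxE; case: unliftP => [j ->|-> //]; exact: Bx.
split=> [i|]; last by have := Bx ord_max; rewrite mxE unlift_none.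
by have := Bx (lift ord_max i); rewrite mxE liftK.
Qed.

Lemma indic_box_snoc n (B : 'I_n.+1 -> set R) x t :
  \1_(box B) (snoc_rV (x, t)) =
  \1_(box (B \o lift ord_max)) x * \1_(B ord_max) t :> R.
Proof.
rewrite !indicE -natrM mulnb; congr ((_ : bool)%:R).
apply/idP/andP; rewrite !inE; first by move/box_snoc.
by move=> h; apply/box_snoc.
Qed.

Local Open Scope ereal_scope.

Lemma integral_indic_box n (B : 'I_n -> set R) : (forall i, measurable (B i)) ->
  \int[lebesgue_rV R n]_x (\1_(box B) x)%:E = \prod_(i < n) lebesgue_measure (B i).
Proof.
move=> mB; rewrite integral_indic ?setIT//; last exact: measurable_box.
exact: lebesgue_rV_box.
Qed.

Lemma measurable_indic_box n (B : 'I_n -> set R) : (forall i, measurable (B i)) ->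
  measurable_fun [set: 'rV[R]_n] (\1_(box B) : _ -> R).
Proof. by move=> mB; apply: measurable_indic; exact: measurable_box. Qed.

(** Plays the role of the L1 distance to the mean value. It makes sense for every measurable [f],
    and obeys the triangle inequality directly. *)
Definition oscillation n (B : 'I_n -> set R) (f : 'rV[R]_n -> R) : \bar R :=
  \int[lebesgue_rV R n]_x \int[lebesgue_rV R n]_y
    (\1_(box B) x * (\1_(box B) y * `|f x - f y|))%:E.

Lemma measurable_osc_pair n m (B : 'I_n -> set R) (B' : 'I_m -> set R)
    (f : 'rV[R]_n -> R) (h : 'rV[R]_m -> R) :
  (forall i, measurable (B i)) -> (forall i, measurable (B' i)) ->
  measurable_fun setT f -> measurable_fun setT h ->
  measurable_fun [set: 'rV[R]_n * 'rV[R]_m]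
    (fun p => (\1_(box B) p.1 * (\1_(box B') p.2 * `|f p.1 - h p.2|))%:E).
Proof.
move=> mB mB' mf mh; apply/measurable_EFinP.
apply: measurable_funM.
  exact: (measurableT_comp (measurable_indic_box mB) measurable_fst).
apply: measurable_funM.
  exact: (measurableT_comp (measurable_indic_box mB') measurable_snd).
apply: measurableT_comp => //; apply: measurable_funB.
  exact: (measurableT_comp mf measurable_fst).
exact: (measurableT_comp mh measurable_snd).
Qed.

Lemma measurable_osc_inner n (B : 'I_n -> set R) (f : 'rV[R]_n -> R) :
  (forall i, measurable (B i)) -> measurable_fun setT f ->
  measurable_fun [set: 'rV[R]_n] (fun x => \int[lebesgue_rV R n]_y
    (\1_(box B) x * (\1_(box B) y * `|f x - f y|))%:E).
Proof.
move=> mB mf.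
have := @measurable_fun_fubini_tonelli_F _ _ _ _ R (lebn R n) _
  (measurable_osc_pair mB mB mf mf) (fun=> _); apply => p.
by rewrite lee_fin !mulr_ge0.
Qed.

Lemma osc_inner_ge0 n (B : 'I_n -> set R) (f : 'rV[R]_n -> R) x :
  0 <= \int[lebesgue_rV R n]_y (\1_(box B) x * (\1_(box B) y * `|f x - f y|))%:E.
Proof. by apply: integral_ge0 => y _; rewrite lee_fin !mulr_ge0. Qed.

(** Upper gradients tested on segments parallel to the axes. The integral runs over the whole line
    because [g i] will carry the indicator of the box; this keeps the condition stable under
    slicing. *)
Definition upper_gradient n (B : 'I_n -> set R) (f : 'rV[R]_n -> R)
    (g : 'I_n -> 'rV[R]_n -> \bar R) :=
  forall i x (s t : R), box B (x + s *: delta_mx 0 i)%R ->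
    box B (x + t *: delta_mx 0 i)%R ->
    (`|f (x + s *: delta_mx 0 i) - f (x + t *: delta_mx 0 i)|%R)%:E <=
    \int[@lebesgue_measure R]_r g i (x + r *: delta_mx 0 i)%R.

(** The integrand of the oscillation between [(x, s)] and [(y, t)], with the four booleans recording
    membership of the coordinates in the box: [g] pays for going from [s] to [t] above [x], and [d']
    for going from [x] to [y] at height [t]. *)
Lemma indic_split_bound (bs bt bx by_ : bool) (d d' : R) (g : \bar R) :
  0 <= g -> (0 <= d')%R ->
  (bs -> bt -> bx -> by_ -> d%:E <= g + d'%:E) ->
  (bx%:R * bs%:R * (by_%:R * bt%:R * d))%:E <=
  (bs%:R * bt%:R * by_%:R)%:E * g + bs%:R%:E * (bx%:R * bt%:R * (by_%:R * d'))%:E.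
Proof.
move=> g0 d0; case: bs; case: bt; case: bx; case: by_ => //= dg;
  rewrite ?(mul1r, mulr1, mul0r, mulr0, mul1e, mul0e, mule0, adde0, add0e)//.
exact: dg.
Qed.

(* An L1 Poincare inequality, by induction on the dimension: two points
   (x, s) and (y, t) are joined through (x, t). *)
Lemma poincare_box n (B : 'I_n -> set R) :
  (forall i, measurable (B i)) -> (forall i, lebesgue_measure (B i) < +oo) ->
  exists2 C : R, (0 <= C)%R & forall f (g : 'I_n -> 'rV[R]_n -> \bar R),
    measurable_fun setT f -> (forall i, measurable_fun setT (g i)) ->
    (forall i x, 0 <= g i x) -> upper_gradient B f g ->
    oscillation B f <= C%:E * \sum_(i < n) \int[lebesgue_rV R n]_x g i x.
Proof.
elim: n B => [|n IHn] B mB Boo.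
  exists 0%R => // f g mf mg g0 fg; rewrite mul0e /oscillation.
  rewrite integral0_eq// => x _; rewrite integral0_eq// => y _.
  by rewrite [x]thinmx0 [y]thinmx0 subrr normr0 !mulr0.
have mB' i : measurable ((B \o lift ord_max) i) by exact: mB.
have [C C0 IH] := IHn (B \o lift ord_max) mB' (fun i => Boo _).
have fV : (\prod_(i < n) lebesgue_measure ((B \o lift ord_max) i)) \is a fin_num.
  by apply: prode_fin_num => i _; rewrite ge0_fin_numE//; exact: Boo.
have fVm : lebesgue_measure (B ord_max) \is a fin_num by rewrite ge0_fin_numE.
set B' := B \o lift ord_max in IH mB' fV *.
set V' := \prod_(i < n) _ in fV *.
set l := lebesgue_measure _ in fVm *.
have V'0 : 0 <= V' by apply: prode_ge0 => i _; exact: measure_ge0.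
have l0 : 0 <= l by exact: measure_ge0.
(* The move from [(x, s)] to [(x, t)] costs [G x], which does not depend on [s], [t], [y]:
   integrating over these gives [l * V' * l]. The move from [(x, t)] to [(y, t)] is the oscillation
   of a slice, bounded with [C], and is integrated over [s], which gives [l]. *)
exists (fine (l * V' * l) + fine l * C)%R.
  by rewrite addr_ge0// ?mulr_ge0// ?fine_ge0// !mule_ge0.
move=> f g mf mg g0 fg.
pose G (x : 'rV[R]_n) :=
  \int[@lebesgue_measure R]_r g ord_max (snoc_rV (x, r)).
have mG : measurable_fun setT G by exact: measurable_integral_snoc_r.
have G0 x : 0 <= G x by exact: integral_ge0.
pose q (z : 'rV[R]_n.+1) (y : 'rV[R]_n) : R :=
  (\1_(box B) z * (\1_(box B') y * `|f z - f (snoc_rV (y, z 0%R ord_max))|))%R.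
have q0 z y : (0 <= q z y)%R by rewrite !mulr_ge0.
have mq : measurable_fun [set: 'rV[R]_n.+1 * 'rV[R]_n] (fun p => (q p.1 p.2)%:E).
  apply/measurable_EFinP; apply: measurable_funM.
    exact: (measurableT_comp (measurable_indic_box mB) measurable_fst).
  apply: measurable_funM.
    exact: (measurableT_comp (measurable_indic_box mB') measurable_snd).
  apply: measurableT_comp => //; apply: measurable_funB.
    exact: (measurableT_comp mf measurable_fst).
  apply: (measurableT_comp mf); apply: (measurableT_comp (@measurable_snoc_rV R n)
    (g := fun p : 'rV[R]_n.+1 * 'rV[R]_n => (p.2, p.1 0%R ord_max))).
  apply: measurable_fun_pair; first exact: measurable_snd.
  exact: (measurableT_comp (measurable_coord ord_max) measurable_fst).
pose Q z := \int[lebesgue_rV R n]_y (q z y)%:E.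
have mQ : measurable_fun setT Q.
  exact: (@measurable_fun_fubini_tonelli_F _ _ _ _ R (lebn R n) _ mq (fun=> q0 _ _)).
have Q0 z : 0 <= Q z by apply: integral_ge0 => y _; rewrite lee_fin.
have snoc_max (x : 'rV[R]_n) t : snoc_rV (x, t) 0%R ord_max = t :> R.
  by rewrite mxE unlift_none.
(* Bounds, for a starting point above [x], the total cost of reaching all points of the box. *)
pose H x := V' * l * G x + \int[@lebesgue_measure R]_t Q (snoc_rV (x, t)).
have mIQ := measurable_integral_snoc_r mQ Q0.
have H0 x : 0 <= H x by rewrite adde_ge0 ?mule_ge0//; exact: integral_ge0.
have mH : measurable_fun setT H.
  by apply: emeasurable_funD => //; exact: measurable_funeM.
have mind : measurable_fun [set: R] (EFin \o (\1_(B ord_max) : R -> R)).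
  by apply/measurable_EFinP; exact: measurable_indic.
have Hl x : \int[@lebesgue_measure R]_s ((\1_(B ord_max) s)%:E * H x) = l * H x.
  rewrite ge0_integralZr//.
  congr (_ * _); rewrite integral_indic; [by rewrite setIT|exact: measurableT|exact: mB].
have inner x s : \int[lebesgue_rV R n.+1]_y
    (\1_(box B) (snoc_rV (x, s)) * (\1_(box B) y * `|f (snoc_rV (x, s)) - f y|))%:E
    <= (\1_(B ord_max) s)%:E * H x.
  have my : measurable_fun [set: 'rV[R]_n.+1] (fun y => (\1_(box B) (snoc_rV (x, s)) *
      (\1_(box B) y * `|f (snoc_rV (x, s)) - f y|))%:E).
    apply/measurable_EFinP; apply: measurable_funM => //.
    apply: measurable_funM; first exact: measurable_indic_box.
    by apply: measurableT_comp => //; apply: measurable_funB.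
  have y0 y : 0 <= (\1_(box B) (snoc_rV (x, s)) *
      (\1_(box B) y * `|f (snoc_rV (x, s)) - f y|))%:E.
    by rewrite lee_fin !mulr_ge0.
  have mqs t : measurable_fun [set: 'rV[R]_n] (fun y => (q (snoc_rV (x, t)) y)%:E).
    apply: (measurableT_comp mq (g := fun y => (snoc_rV (x, t), y))).
    exact: measurable_fun_pair.
  have mind' t : measurable_fun [set: 'rV[R]_n]
      (fun y => (\1_(B ord_max) s * \1_(B ord_max) t * \1_(box B') y : R)%:E).
    apply/measurable_EFinP; apply: measurable_funM; first exact: measurable_cst.
    exact: (measurable_indic_box mB').
  have mQt : measurable_fun [set: R] (fun t => Q (snoc_rV (x, t))).
    exact: (measurableT_comp mQ (measurable_snoc_r x)).
  rewrite integral_snocC//.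
  apply: (@le_trans _ _ (\int[@lebesgue_measure R]_t
      ((\1_(B ord_max) t)%:E * ((\1_(B ord_max) s)%:E * (V' * G x)) +
       (\1_(B ord_max) s)%:E * Q (snoc_rV (x, t))))).
    apply: ge0_le_integral => //.
    - by move=> t _; exact: integral_ge0.
    - exact: (measurable_integral_snoc_l my y0).
    - by apply: emeasurable_funD; [exact: emeasurable_funM|exact: measurable_funeM].
    move=> t _.
    apply: (@le_trans _ _ (\int[lebesgue_rV R n]_y
        ((\1_(B ord_max) s * \1_(B ord_max) t * \1_(box B') y)%:E * G x +
         (\1_(B ord_max) s)%:E * (q (snoc_rV (x, t)) y)%:E))).
      apply: ge0_le_integral => //.
      - exact: (measurableT_comp my (measurable_snoc_l t)).
      - by apply: emeasurable_funD; [exact: emeasurable_funM|exact: measurable_funeM].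
      move=> y _; rewrite !indic_box_snoc /q snoc_max indic_box_snoc -/B'.
      rewrite !indicE; apply: indic_split_bound => // sB tB xB yB.
      apply: (@le_trans _ _ ((`|f (snoc_rV (x, s)) - f (snoc_rV (x, t))|%R)%:E +
          (`|f (snoc_rV (x, t)) - f (snoc_rV (y, t))|%R)%:E)).
        by rewrite -EFinD lee_fin ler_distD.
      apply: leeD => //.
      have lE r : snoc_rV (x, r) = (snoc_rV (x, 0) + r *: delta_mx 0 ord_max)%R :> 'rV[R]_n.+1.
        by rewrite -snoc_line_max add0r.
      rewrite /G; under eq_integral do rewrite lE.
      rewrite (lE s) (lE t); apply: fg; rewrite -lE; apply/box_snoc;
        by split; exact: set_mem.
    rewrite ge0_integralD//; last 4 first.
    - by move=> y _; rewrite mule_ge0// lee_fin !mulr_ge0.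
    - exact: emeasurable_funM.
    - by move=> y _; rewrite mule_ge0// lee_fin.
    - exact: measurable_funeM.
    rewrite ge0_integralZl//; first last.
      by move=> y _; rewrite lee_fin.
    apply: leeD => //; rewrite ge0_integralZr//.
    under eq_integral do rewrite EFinM.
    have mb : measurable_fun [set: 'rV[R]_n] (fun y => (\1_(box B') y : R)%:E).
      by apply/measurable_EFinP; exact: (measurable_indic_box mB').
    rewrite ge0_integralZl//.
    rewrite (integral_indic_box mB') EFinM !muleA.
    by rewrite (muleC (\1_(B ord_max) s)%:E).
  have c0 : 0 <= (\1_(B ord_max) s)%:E * (V' * G x).
    by apply: mule_ge0 => //; exact: mule_ge0.
  rewrite ge0_integralD//; last 4 first.
  - by move=> t _; rewrite mule_ge0.
  - exact: emeasurable_funM.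
  - by move=> t _; rewrite mule_ge0.
  - exact: measurable_funeM.
  rewrite ge0_integralZl// ge0_integralZr//.
  rewrite integral_indic; [|exact: measurableT|exact: mB].
  have h1 : 0 <= V' * l * G x by apply: mule_ge0 => //; exact: mule_ge0.
  have h2 : 0 <= \int[@lebesgue_measure R]_t Q (snoc_rV (x, t)).
    by apply: integral_ge0 => t _.
  rewrite setIT -/l /H. rewrite (ge0_muleDr _ h1 h2).
  apply: leeD; last by [].
  rewrite (muleCA _ _ (V' * G x)).
  rewrite -(muleA V').
  by rewrite (muleCA V').
rewrite /oscillation integral_snoc; last 2 first.
- exact: measurable_osc_inner.
- by move=> x; apply: integral_ge0 => y _; rewrite lee_fin !mulr_ge0.
apply: (@le_trans _ _ (\int[lebesgue_rV R n]_x
    \int[@lebesgue_measure R]_s ((\1_(B ord_max) s)%:E * H x))).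
  apply: ge0_le_integral => //.
  - move=> x _; apply: integral_ge0 => t _; apply: integral_ge0 => y _.
    by rewrite lee_fin !mulr_ge0.
  - exact: (measurable_integral_snoc_r (measurable_osc_inner mB mf)
      (osc_inner_ge0 B f)).
  - by under eq_fun do rewrite Hl; exact: measurable_funeM.
  move=> x _; apply: ge0_le_integral => //.
  - by move=> t _; apply: integral_ge0 => y _; rewrite lee_fin !mulr_ge0.
  - exact: (measurableT_comp (measurable_osc_inner mB mf) (measurable_snoc_r x)).
  - exact: (emeasurable_funM mind (measurable_cst _)).
under eq_integral do rewrite Hl.
rewrite ge0_integralZl//.
rewrite ge0_integralD//; last 3 first.
- by move=> x _; rewrite !mule_ge0.
- exact: measurable_funeM.
- by move=> x _; exact: integral_ge0.
rewrite ge0_integralZl// ?mule_ge0//.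
have IQ : \int[lebesgue_rV R n]_x \int[@lebesgue_measure R]_t Q (snoc_rV (x, t)) <=
    C%:E * \sum_(i < n.+1) \int[lebesgue_rV R n.+1]_x g i x.
  rewrite -integral_snoc// integral_snocC//.
  pose g' t (j : 'I_n) (x : 'rV[R]_n) := g (lift ord_max j) (snoc_rV (x, t)).
  have mg' t j : measurable_fun setT (g' t j).
    exact: (measurableT_comp (mg _) (measurable_snoc_l t)).
  have Qt t : \int[lebesgue_rV R n]_x Q (snoc_rV (x, t)) <=
      C%:E * \sum_(j < n) \int[lebesgue_rV R n]_x g' t j x.
    have [tB|tB] := pselect (B ord_max t); last first.
      rewrite integral0_eq ?mule_ge0 ?sume_ge0//.
        by move=> j _; apply: integral_ge0 => x _; exact: g0.
      move=> x _; apply: integral0_eq => y _.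
      by rewrite /q indic_box_snoc [\1_(B _) t]indicE memNset// mulr0 mul0r.
    rewrite [leLHS](_ : _ = oscillation B' (fun x => f (snoc_rV (x, t)))).
      apply: IH => //; first exact: (measurableT_comp mf (measurable_snoc_l t)).
      - by move=> j x; exact: g0.
      move=> j x r1 r2 h1 h2; rewrite /g'.
      under eq_integral do rewrite snoc_line_lift.
      rewrite !snoc_line_lift.
      by apply: fg; rewrite -snoc_line_lift; apply/box_snoc.
    apply: eq_integral => x _; apply: eq_integral => y _.
    by rewrite /q snoc_max indic_box_snoc [\1_(B _) t]indicE mem_set// mulr1.
  apply: (@le_trans _ _ (\int[@lebesgue_measure R]_t
     (C%:E * \sum_(j < n) \int[lebesgue_rV R n]_x g' t j x))).
    apply: ge0_le_integral => //.
    - by move=> t _; exact: integral_ge0.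
    - exact: (measurable_integral_snoc_l mQ Q0).
    apply: measurable_funeM; apply: emeasurable_sum => j.
    exact: (measurable_integral_snoc_l (mg _) (g0 _)).
  rewrite ge0_integralZl//; last 2 first.
  - apply: emeasurable_sum => j.
    exact: (measurable_integral_snoc_l (mg _) (g0 _)).
  - by move=> t _; apply: sume_ge0 => j _; apply: integral_ge0 => x _; exact: g0.
  rewrite ge0_integral_sum//; last 2 first.
  - by move=> j; exact: (measurable_integral_snoc_l (mg _) (g0 _)).
  - by move=> j t _; apply: integral_ge0 => x _; exact: g0.
  apply: lee_wpmul2l; first by rewrite lee_fin.
  rewrite (bigD1_ord ord_max)//= -[leLHS]add0e; apply: leeD.
    exact: integral_ge0.
  by rewrite le_eqVlt; apply/orP; left; apply/eqP; apply: eq_bigr => j _;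
    rewrite -integral_snocC.
have Imax : \int[lebesgue_rV R n]_x G x <= \sum_(i < n.+1) \int[lebesgue_rV R n.+1]_x g i x.
  rewrite -integral_snoc// (bigD1 ord_max)//= leeDl//.
  by apply: sume_ge0 => i _; exact: integral_ge0.
set S := \sum_(i < n.+1) _ in IQ Imax *.
have S0 : 0 <= S by apply: sume_ge0 => i _; exact: integral_ge0.
apply: (@le_trans _ _ (l * (V' * l * S + C%:E * S))).
  by apply: lee_wpmul2l => //; apply: leeD => //; apply: lee_wpmul2l; rewrite ?mule_ge0.
rewrite -ge0_muleDl ?mule_ge0 ?lee_fin// muleA.
apply: lee_wpmul2r => //.
rewrite EFinD EFinM !fineK ?fin_numM// ge0_muleDr ?mule_ge0 ?lee_fin//.
by rewrite !muleA.
Qed.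
End poincare.

(** * Divergence theorem and upper gradients for C1 functions *)

Section C1_functions.
Context (R : realType).

Definition C1 n (f : 'rV[R]_n.+1 -> R) : Prop :=
  continuous f /\
  forall i, (forall x, derivable f x (delta_mx 0 i)) /\ continuous (partial i f).

Definition bsupp n (f : 'rV[R]_n -> R) : Prop :=
  exists M : R, forall x, M < `|x| -> f x = 0.

Lemma le_coord_norm n (x : 'rV[R]_n) i : `|x 0 i| <= `|x|.
Proof.
rewrite [leRHS]/Num.norm/= mx_normrE.
by apply/bigmax_geP; right => /=; exists (ord0, i).
Qed.

Lemma continuous_bounded_ball n (f : 'rV[R]_n -> R) (M : R) : continuous f ->
  exists2 C : R, 0 <= C & forall x, `|x| <= M -> `|f x| <= C.
Proof.
move=> cf; pose K := [set x : 'rV[R]_n | `|x| <= M].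
have cK : compact K.
  apply: bounded_closed_compact.
    by exists M; split => [|N MN x /= xM]; rewrite ?num_real// (le_trans xM)// ltW.
  rewrite (_ : K = (@Num.norm R 'rV[R]_n) @^-1` [set y | y <= M])//.
  by apply: closed_comp => [y _|]; [exact: norm_continuous|exact: closed_le].
have /compact_bounded[C [_ hC]] : compact (f @` K).
  by apply: continuous_compact => //; exact: continuous_subspaceT.
exists (`|C| + 1) => [|x xM]; first by rewrite addr_ge0.
by apply: hC; [rewrite ltr_pwDr// ler_norm|exists x].
Qed.

Lemma integrable_bsupp n (f : 'rV[R]_n -> R) : continuous f -> bsupp f ->
  (lebesgue_rV R n).-integrable setT (EFin \o f).
Proof.
move=> cf [M fM]; have [C C0 hC] := continuous_bounded_ball M cf.
pose B (i : 'I_n) : set R := `[- M, M]%classic.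
have mB i : measurable (B i) by exact: measurable_itv.
apply: (@le_integrable _ _ _ _ _ _ _ (EFin \o (fun x => C * \1_(box B) x))) => //.
- by apply/measurable_EFinP; exact: continuous_measurable_fun_rV.
- move=> x _ /=; rewrite lee_fin [leRHS]ger0_norm ?mulr_ge0//.
  have [xM|Mx] := leP `|x| M; last by rewrite fM// normr0 mulr_ge0.
  rewrite indicE mem_set ?mulr1; first exact: hC.
  move=> i; rewrite /B/= in_itv/= -ler_norml.
  exact: le_trans (le_coord_norm x i) xM.
rewrite (_ : _ \o _ = (fun x => C%:E * (\1_(box B) x)%:E)%E)//.
apply: integrableZl => //; apply/integrableP; split.
  by apply/measurable_EFinP; exact: measurable_indic_box.
under eq_integral do rewrite /= ger0_norm//.
rewrite integral_indic_box// -ge0_fin_numE ?prode_ge0//.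
by apply: prode_fin_num => i _; rewrite lebesgue_measure_itv/=; case: ifP.
Qed.

Section line.
Context n (f : 'rV[R]_n -> R) (x v : 'rV[R]_n).

Let line_growth (t : R) : (fun h : R => h^-1 *: ((fun s : R => f (x + s *: v)) (h *: 1 + t)
    - f (x + t *: v))) =
  (fun h : R => h^-1 *: (f (h *: v + (x + t *: v)) - f (x + t *: v))).
Proof.
apply/funext => h; congr (_ *: (f _ - _)).
by rewrite [h *: 1]mulr1 scalerDl addrCA.
Qed.

Lemma derivable_line t : derivable f (x + t *: v) v ->
  derivable (fun s : R => f (x + s *: v)) t 1.
Proof. by rewrite /derivable /= line_growth. Qed.

Lemma derive1_line t : derive1 (fun s : R => f (x + s *: v)) t = 'D_v f (x + t *: v).
Proof. by rewrite derive1E /derive /= line_growth. Qed.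

End line.

Lemma continuous_line n (f : 'rV[R]_n -> R) x v : continuous f ->
  continuous (fun t : R => f (x + t *: v)).
Proof.
move=> cf t; apply: (cvg_comp (fun t => x + t *: v) f); last exact: cf.
by apply: cvgD; [exact: cvg_cst|apply: cvgZr_tmp; exact: cvg_id].
Qed.

Lemma FTC2_C1 (F : R -> R) (a b : R) : a < b -> (forall t, derivable F t 1) ->
  continuous (derive1 F) ->
  (\int[lebesgue_measure]_(t in `[a, b]) (derive1 F t)%:E = (F b - F a)%:E)%E.
Proof.
move=> ab dF cF; rewrite EFinB; apply: (@continuous_FTC2 R (derive1 F) F a b ab); last by [].
  exact: continuous_subspaceT.
have cF' t : {for t, continuous F}.
  by apply: differentiable_continuous; apply/derivable1_diffP.
split=> [t _||]; first exact: dF.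
- by apply: cvg_at_right_filter; exact: cF'.
- by apply: cvg_at_left_filter; exact: cF'.
Qed.

Lemma bsupp_partial n (f : 'rV[R]_n.+1 -> R) i : bsupp f -> bsupp (partial i f).
Proof.
move=> [M fM]; exists M => x Mx; rewrite /partial.
rewrite (@near_eq_derive _ _ _ f (cst 0)) ?derive_cst//.
have : open [set y : 'rV[R]_n.+1 | M < `|y|].
  rewrite (_ : [set _ | _] = (@Num.norm R 'rV[R]_n.+1) @^-1` [set y | M < y])//.
  by apply: open_comp => [y _|]; [exact: norm_continuous|exact: open_gt].
rewrite openE => /(_ x Mx); apply: filterS => y /= My; exact: fM.
Qed.

Local Open Scope ereal_scope.

(** This says that [F'] has integral zero, by the fundamental theorem on an interval outside which
    [F] vanishes. The positive and negative parts are kept apart because the comparison of integrals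
    along lines is for nonnegative functions. *)
Lemma integral_funrposneg_derive (F : R -> R) (M : R) :
  (forall t, derivable F t 1) -> continuous (derive1 F) ->
  (forall t : R, (M < `|t|)%R -> F t = 0%R) ->
  \int[lebesgue_measure]_t ((derive1 F)^\+ t)%:E = \int[lebesgue_measure]_t ((derive1 F)^\- t)%:E.
Proof.
move=> dF cF F0; pose a := (- (`|M| + 1))%R; pose b := (`|M| + 1)%R.
have ab : (a < b)%R by rewrite /a /b; have := normr_ge0 M; lra.
have Mb : (M < b)%R by rewrite /b; have := ler_norm M; lra.
have F'0 t : ~ `[a, b]%classic t -> derive1 F t = 0%R.
  rewrite /= in_itv/= -ler_norml => /negP; rewrite -ltNge => bt.
  rewrite derive1E (@near_eq_derive _ _ _ F (cst 0%R)) ?derive_cst//.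
  have : open [set y : R | (b < `|y|)%R].
    rewrite (_ : [set _ | _] = (@Num.norm R R) @^-1` [set y | b < y])%R//.
    by apply: open_comp => [y _|]; [exact: norm_continuous|exact: open_gt].
  by rewrite openE => /(_ t bt); apply: filterS => y /= My; apply: F0; exact: lt_trans My.
have restr (G : R -> \bar R) : (forall t, derive1 F t = 0%R -> G t = 0) ->
    \int[lebesgue_measure]_t G t = \int[lebesgue_measure]_(t in `[a, b]) G t.
  move=> G0; rewrite [RHS]integral_mkcond; apply: eq_integral => t _.
  by rewrite patchE; case: ifPn => // /negP; rewrite inE => tab; rewrite G0// F'0.
rewrite !restr; last 2 first.
- by move=> t F't; rewrite /funrneg F't oppr0 maxxx.
- by move=> t F't; rewrite /funrpos F't maxxx.
have := FTC2_C1 ab dF cF.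
have -> : F b = 0%R by apply: F0; rewrite gtr0_norm// /b; have := normr_ge0 M; lra.
have -> : F a = 0%R.
  by apply: F0; rewrite /a normrN gtr0_norm// /b; have := normr_ge0 M; lra.
have iF : lebesgue_measure.-integrable `[a, b] (EFin \o derive1 F).
  by apply: continuous_compact_integrable;
    [exact: segment_compact|exact: continuous_subspaceT].
rewrite subrr integralE funerpos funerneg.
have : \int[lebesgue_measure]_(t in `[a, b]) (EFin \o derive1 F)^\+ t \is a fin_num.
  exact: integrable_pos_fin_num.
have : \int[lebesgue_measure]_(t in `[a, b]) (EFin \o derive1 F)^\- t \is a fin_num.
  exact: integrable_neg_fin_num.
rewrite funerpos funerneg.
set A := \int[_]_(_ in _) _; set B := \int[_]_(_ in _) _ => fA fB.
by move/eqP; rewrite sube_eq// add0e => /eqP.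
Qed.

(** On each line of direction [i] the positive and negative parts of the derivative have equal
    integrals, so they have equal, and finite, integrals over the whole space. *)
Lemma integral_partial0 n (i : 'I_n.+1) (f : 'rV[R]_n.+1 -> R) :
  C1 f -> bsupp f ->
  \int[lebesgue_rV R n.+1]_x (partial i f x)%:E = 0.
Proof.
move=> [cf df] [M fM]; have [dfi cfi] := df i.
have ip := integrable_bsupp cfi (bsupp_partial i (ex_intro _ M fM)).
have mp : measurable_fun setT (partial i f) by exact: continuous_measurable_fun_rV.
rewrite integralE funerpos funerneg.
rewrite (@eq_integral_lines _ _ i _ (EFin \o ((partial i f)^\-)%R)).
- have := integral_funeneg_lt_pinfty measurableT ip; rewrite funerneg => h.
  rewrite subee// ge0_fin_numE//; apply: integral_ge0 => x _.
  by rewrite lee_fin funrneg_ge0.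
- by apply/measurable_EFinP; exact: measurable_funrpos.
- by move=> x; rewrite lee_fin funrpos_ge0.
- by apply/measurable_EFinP; exact: measurable_funrneg.
- by move=> x; rewrite lee_fin funrneg_ge0.
move=> x.
have dE : derive1 (fun t : R => f (x + t *: delta_mx 0 i)%R) =
    (fun t => partial i f (x + t *: delta_mx 0 i))%R.
  by apply/funext => t; rewrite derive1_line.
have := @integral_funrposneg_derive (fun t : R => f (x + t *: delta_mx 0 i))%R
  (`|M| + `|x|)%R.
rewrite dE; apply.
- by move=> t; apply: derivable_line; exact: dfi.
- exact: continuous_line.
- move=> t Mt; apply: fM.
  (* Read off coordinate [i]: the sup norm controls it, so [f] vanishes on the line as soon as
     [|t| > |M| + |x|]. *)
  have h1 : (`|t| <= `|x + t *: delta_mx 0 i| + `|x|)%R.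
    have := le_coord_norm (x + t *: delta_mx 0 i)%R i.
    rewrite !mxE !eqxx mulr1 => h2; have := le_coord_norm x i => h3.
    rewrite -[X in (`|X| <= _)%R](addrK (x 0%R i)).
    apply: (le_trans (ler_normB _ _)); rewrite addrC (addrC t).
    by rewrite addrC lerD// addrC.
  by have := ler_norm M; lra.
Qed.

(** The fundamental theorem on the segment between the two points. A product of intervals is convex,
    so the segment stays in the box and the indicator is 1 along it. *)
Lemma upper_gradient_C1 n (B : 'I_n.+1 -> set R) (f : 'rV[R]_n.+1 -> R) :
  (forall i, is_interval (B i)) -> (forall i, measurable (B i)) -> C1 f ->
  upper_gradient B f (fun i x => (\1_(box B) x * `|partial i f x|)%:E).
Proof.
move=> iB mB [cf df] i x s t.
wlog st : s t / (s <= t)%R.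
  move=> h bs bt; have [st|/ltW ts] := leP s t; first exact: h.
  by rewrite distrC; exact: h.
move=> bs bt; have [dfi cfi] := df i.
move: st; rewrite le_eqVlt => /predU1P[<-|st].
  by rewrite subrr normr0; apply: integral_ge0 => r _; rewrite lee_fin mulr_ge0.
pose F (t : R) := f (x + t *: delta_mx 0 i)%R.
have dE : derive1 F = (fun t => partial i f (x + t *: delta_mx 0 i))%R.
  by apply/funext => r; rewrite /F derive1_line.
have cF : continuous (derive1 F) by rewrite dE; exact: continuous_line.
have dF r : derivable F r 1 by apply: derivable_line; exact: dfi.
have FE := FTC2_C1 st dF cF.
have mF := continuous_measurable_fun cF.
rewrite distrC -[X in X <= _]/(`|(F t - F s)%:E|) -FE.
have mst : measurable (`[s, t]%classic : set R) by exact: measurable_itv.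
apply: le_trans.
  apply: le_abse_integral => //.
  by apply/measurable_EFinP; exact: measurable_funTS.
rewrite integral_mkcond; apply: ge0_le_integral => //.
- by move=> r _; apply: erestrict_ge0.
- apply/(measurable_restrictT _ mst); apply: measurableT_comp => //.
  by apply/measurable_EFinP; exact: measurable_funTS.
- apply/measurable_EFinP; apply: measurable_funM.
    apply: (measurableT_comp (measurable_indic_box mB)).
    apply: measurable_fun_coordP => k.
    apply: continuous_measurable_fun.
    apply: (@continuous_line _ (fun x => x 0%R k)) => y; exact: coord_continuous.
  by rewrite dE in mF; apply: measurableT_comp.
move=> r _; rewrite patchE; case: ifPn => [|_]; last by rewrite lee_fin mulr_ge0.
rewrite inE/= in_itv/= => /andP[sr rt].
rewrite indicE mem_set ?mul1r ?dE// => j; have := bs j; have := bt j.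
rewrite !mxE/=; case: (j == i); rewrite ?mulr0 ?mulr1// => bt' bs'.
by apply: (iB _ _ _ bs' bt'); rewrite !lerD2l sr.
Qed.

End C1_functions.

(** * L2 convergence *)

Lemma discriminant_le0 (R : realFieldType) (a b c : R) : 0 <= c ->
  (forall t, 0 <= a - 2 * t * b + t ^+ 2 * c) -> b ^+ 2 <= a * c.
Proof.
rewrite le_eqVlt => /predU1P[<- h|c0 h].
  rewrite mulr0; have [->|b0] := eqVneq b 0; first by rewrite expr0n.
  (* With [c = 0] the expression is affine in [t], and this [t] gives it the value [-1]. *)
  have := h ((a + 1) / (2 * b)); rewrite mulr0 addr0.
  rewrite (_ : 2 * _ * b = a + 1); last by field.
  by rewrite opprD addrA subrr add0r oppr_ge0 ler10.
(* The minimizer of the quadratic. *)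
have := h (b / c); rewrite (_ : _ + _ = (a * c - b ^+ 2) / c); last first.
  by field; rewrite gt_eqF.
by rewrite pmulr_lge0 ?invr_gt0// subr_ge0.
Qed.

Section L2.
Context d (T : measurableType d) (R : realType) (mu : {measure set T -> \bar R}).
Variables (D : set T) (mD : measurable D).
Implicit Types f g h : T -> R.

Definition L2 f : Prop :=
  measurable_fun D f /\ mu.-integrable D (fun x => (f x ^+ 2)%:E).

Definition ip f g : R := (\int[mu]_(x in D) (f x * g x))%R.

Lemma L2_ltyP f : measurable_fun D f ->
  (\int[mu]_(x in D) (f x ^+ 2)%:E < +oo)%E -> L2 f.
Proof.
move=> mf foo; split => //; apply/integrableP; split.
  by apply/measurable_EFinP; exact: measurable_funX.
by under eq_integral do rewrite gee0_abs ?lee_fin ?sqr_ge0//.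
Qed.

Lemma integrable_mul_L2 f g : L2 f -> L2 g ->
  mu.-integrable D (fun x => (f x * g x)%:E).
Proof.
move=> [mf ff] [mg gg]; apply: (le_integrable mD _ _ (integrableD mD ff gg)).
  by apply/measurable_EFinP; exact: measurable_funM.
move=> x _; rewrite /= lee_fin [leRHS]ger0_norm ?addr_ge0 ?sqr_ge0//.
rewrite normrM -(real_normK (num_real (f x))) -(real_normK (num_real (g x))).
have := sqr_ge0 (`|f x| - `|g x|); have := normr_ge0 (f x); have := normr_ge0 (g x).
nra.
Qed.

Lemma L2D f g : L2 f -> L2 g -> L2 (fun x => f x + g x).
Proof.
move=> Lf Lg; have fg := integrable_mul_L2 Lf Lg.
split; first by apply: measurable_funD; [case: Lf|case: Lg].
rewrite (_ : (fun _ => _) = (fun x => (f x ^+ 2)%:E + ((2%:E * (f x * g x)%:E) + (g x ^+ 2)%:E))%E).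
  apply: integrableD => //; first by case: Lf.
  by apply: integrableD => //; [exact: integrableZl|case: Lg].
by apply/funext => x; rewrite -EFinM -!EFinD; congr EFin; ring.
Qed.

Lemma L2Z k f : L2 f -> L2 (fun x => k * f x).
Proof.
move=> [mf ff]; split; first exact: measurable_funM.
rewrite (_ : (fun _ => _) = (fun x => (k ^+ 2)%:E * (f x ^+ 2)%:E)%E).
  exact: integrableZl.
by apply/funext => x; rewrite -EFinM exprMn.
Qed.

Lemma L2B f g : L2 f -> L2 g -> L2 (fun x => f x - g x).
Proof.
move=> Lf Lg; have := L2D Lf (L2Z (-1) Lg).
by under eq_fun do rewrite mulN1r.
Qed.

Lemma ipC f g : ip f g = ip g f.
Proof. by apply: eq_Rintegral => x _; rewrite mulrC. Qed.

Lemma ipDl f g h : L2 f -> L2 g -> L2 h ->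
  ip (fun x => f x + g x) h = ip f h + ip g h.
Proof.
move=> Lf Lg Lh; rewrite /ip -RintegralD//; try exact: integrable_mul_L2.
by apply: eq_Rintegral => x _; rewrite mulrDl.
Qed.

Lemma ipZl k f g : L2 f -> L2 g -> ip (fun x => k * f x) g = k * ip f g.
Proof.
move=> Lf Lg; rewrite /ip -RintegralZl//; last exact: integrable_mul_L2.
by apply: eq_Rintegral => x _; rewrite mulrA.
Qed.

Lemma ipBl f g h : L2 f -> L2 g -> L2 h ->
  ip (fun x => f x - g x) h = ip f h - ip g h.
Proof.
move=> Lf Lg Lh; rewrite -mulN1r -ipZl// -ipDl//; last exact: L2Z.
by congr (ip _ _); apply/funext => x; rewrite mulN1r.
Qed.

Lemma ip_ge0 f : 0 <= ip f f.
Proof. by apply: Rintegral_ge0 => x _; rewrite -expr2 sqr_ge0. Qed.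

Lemma ipE f : L2 f -> (\int[mu]_(x in D) (f x ^+ 2)%:E)%E = (ip f f)%:E.
Proof.
move=> Lf; rewrite /ip /Rintegral fineK; last first.
  by apply: integrable_fin_num => //; exact: integrable_mul_L2.
by apply: eq_integral => x _; rewrite expr2.
Qed.

Lemma ip_sqrB f g : L2 f -> L2 g ->
  ip (fun x => f x - g x) (fun x => f x - g x) = ip f f - 2 * ip f g + ip g g.
Proof.
move=> Lf Lg; rewrite ipBl//; last exact: L2B.
by rewrite (ipC f) (ipC g) !ipBl// (ipC g f); ring.
Qed.

Lemma ip_sqrD f g : L2 f -> L2 g ->
  ip (fun x => f x + g x) (fun x => f x + g x) = ip f f + 2 * ip f g + ip g g.
Proof.
move=> Lf Lg; rewrite ipDl//; last exact: L2D.
by rewrite (ipC f) (ipC g) !ipDl// (ipC g f); ring.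
Qed.

Lemma ip_CauchySchwarz f g : L2 f -> L2 g -> ip f g ^+ 2 <= ip f f * ip g g.
Proof.
move=> Lf Lg; apply: discriminant_le0; first exact: ip_ge0.
move=> t; have := ip_ge0 (fun x => f x - t * g x).
have Lt := L2Z t Lg.
rewrite ip_sqrB// (ipC f (fun x => t * g x)) !ipZl// (ipC g (fun x => t * g x)).
rewrite ipZl// (ipC g f).
by congr (0 <= _); ring.
Qed.

Lemma ip_cvgl (F : nat -> T -> R) f g : (forall k, L2 (F k)) -> L2 f -> L2 g ->
  ip (fun x => F k x - f x) (fun x => F k x - f x) @[k --> \oo] --> 0 ->
  ip (F k) g @[k --> \oo] --> ip f g.
Proof.
move=> LF Lf Lg Ff0.
pose r k := ip (fun x => F k x - f x) (fun x => F k x - f x).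
have b0 : Num.sqrt (r k) * Num.sqrt (ip g g) @[k --> \oo] --> 0.
  rewrite [X in _ --> X](_ : _ = Num.sqrt 0 * Num.sqrt (ip g g)); last first.
    by rewrite sqrtr0 mul0r.
  by apply: cvgMr_tmp; apply: cvg_comp Ff0 _; exact: sqrt_continuous.
apply/cvgrPdist_le => e e0; move/cvgr0Pnorm_le : b0 => /(_ _ e0).
apply: filterS => k; apply: le_trans.
rewrite (ger0_norm (mulr_ge0 (sqrtr_ge0 _) (sqrtr_ge0 _))) distrC -ipBl//.
rewrite -sqrtrM ?ip_ge0// -sqrtr_sqr ler_wsqrtr// ip_CauchySchwarz//.
exact: L2B.
Qed.

Lemma ip_cvg (F : nat -> T -> R) f : (forall k, L2 (F k)) -> L2 f ->
  ip (fun x => F k x - f x) (fun x => F k x - f x) @[k --> \oo] --> 0 ->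
  ip (F k) (F k) @[k --> \oo] --> ip f f.
Proof.
move=> LF Lf Ff0.
have -> : (fun k => ip (F k) (F k)) = (fun k =>
    ip (fun x => F k x - f x) (fun x => F k x - f x) + 2 * ip (F k) f - ip f f).
  apply/funext => k; have Lk := LF k; rewrite ipBl//; last exact: L2B.
  by rewrite (ipC (F k)) (ipC f) !ipBl// (ipC f (F k)); ring.
rewrite [X in _ --> X](_ : _ = 0 + 2 * ip f f - ip f f); last by ring.
apply: cvgB; last exact: cvg_cst.
by apply: cvgD => //; apply: cvgMl_tmp; exact: ip_cvgl.
Qed.

(** Convergence makes the integral finite for some [k]; then [F k - f] is in L2, hence so is [f].
    This is the passage from integrals in the extended reals to real inner products. *)
Lemma L2_limit (F : nat -> T -> R) f : (forall k, L2 (F k)) ->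
  measurable_fun D f ->
  (\int[mu]_(x in D) ((F k x - f x) ^+ 2)%:E)%E @[k --> \oo] --> 0%E ->
  L2 f /\ ip (fun x => F k x - f x) (fun x => F k x - f x) @[k --> \oo] --> 0.
Proof.
move=> LF mf Ff0.
have mFf k : measurable_fun D (fun x => F k x - f x).
  by apply: measurable_funB => //; case: (LF k).
have foo : \forall k \near \oo,
    (\int[mu]_(x in D) ((F k x - f x) ^+ 2)%:E < +oo)%E.
  move/fine_cvgP : Ff0 => [+ _]; apply: filterS => k.
  by rewrite fin_numElt => /andP[].
have Lf : L2 f.
  have [k kfoo] := filter_ex foo.
  have := L2B (LF k) (L2_ltyP (mFf k) kfoo).
  by under eq_fun do rewrite opprB addrC subrK.
split => //; move/fine_cvgP : Ff0 => [_]; apply: cvg_trans.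
apply: near_eq_cvg; near=> k; rewrite /= /ip /Rintegral.
by congr fine; apply: eq_integral => x _; rewrite expr2.
Unshelve. all: by end_near. Qed.

End L2.

(** * Smooth functions *)

Section flat.
Context (R : realType).

(* Source of the smooth cutoffs; the powers of 1 / t make the family closed under
   differentiation, up to linear combinations. *)
Definition flat (k : nat) (t : R) : R :=
  if 0 < t then t^-1 ^+ k * expR (- t^-1) else 0.

Lemma expR_ge_pow (y : R) k : 0 <= y -> y ^+ k <= k`!%:R * expR y.
Proof.
move=> y0; case: k => [|k].
  by rewrite expr0 mul1r -[leLHS](addr0 1) (le_trans _ (expR_ge1Dx _))// lerD2l.
rewrite mulrC -ler_pdivrMr ?ltr0n ?fact_gt0//.
by apply: le_trans (expR_ge1Dxn k y0); rewrite lerDr.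
Qed.

Lemma flat_ge0 k t : 0 <= flat k t.
Proof.
rewrite /flat; case: ifPn => // t0.
by rewrite mulr_ge0 ?expR_ge0// exprn_ge0// invr_ge0 ltW.
Qed.

(** From [y ^ n <= n! exp y] at [y = 1 / t]. The case [j = 2] makes the difference quotients at 0
    vanish in the limit; the case [j = 0] gives boundedness. *)
Lemma flat_bound k j t : flat k t <= (k + j)`!%:R * `|t| ^+ j.
Proof.
rewrite /flat; case: ifPn => t0; last by rewrite mulr_ge0// exprn_ge0.
rewrite (gtr0_norm t0) expRN ler_pdivrMr ?expR_gt0// mulrAC.
rewrite -ler_pdivrMr ?exprn_gt0//.
have := @expR_ge_pow t^-1 (k + j); rewrite invr_ge0 ltW// => /(_ isT).
by rewrite exprD -exprVn.
Qed.

Lemma is_derive_flat k (t : R) :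
  is_derive t 1 (flat k) (flat k.+2 t - k%:R * flat k.+1 t).
Proof.
have [t0|t0|<-] := ltgtP 0 t; last first.
- pose g h := h^-1 *: (flat k (h *: 1 + 0) - flat k 0).
  have f0 j : flat j 0 = 0 by rewrite /flat ltxx.
  have g0 : g h @[h --> 0^'] --> 0.
    apply/cvgr0Pnorm_le => e e0; near=> h.
    rewrite /g f0 subr0 addr0 [h *: 1]mulr1 [_ *: _]mulrC normrM normfV.
    have h0 : h != 0 by near: h; exact: nbhs_dnbhs_neq.
    rewrite ler_pdivrMr ?normr_gt0// (ger0_norm (flat_ge0 _ _)).
    apply: (le_trans (flat_bound k 2 h)).
    rewrite expr2 mulrA ler_wpM2r// -ler_pdivlMl ?ltr0n ?fact_gt0//.
    near: h; apply: dnbhs0_le; rewrite mulr_gt0// invr_gt0 ltr0n fact_gt0//.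
  rewrite !f0 mulr0 subr0; apply: DeriveDef; last exact: cvg_lim g0.
  by apply/cvg_ex; exists 0.
- have -> : flat k.+2 t - k%:R * flat k.+1 t = 0.
    by rewrite /flat !ltNge (ltW t0)/= mulr0 subr0.
  apply: (near_eq_is_derive (f := cst 0)).
  near=> s; rewrite /flat ltNge ltW//; near: s; exact: lt_nbhsl.
have dinv : is_derive t 1 (fun s : R => s^-1) (- (t^-1 ^+ 2)).
  apply: is_derive_eq; first by apply: is_deriveV; rewrite gt_eqF.
  by rewrite /= exprVn scaleNr [_ *: _]mulr1.
have dexp : is_derive t^-1 1 (fun y : R => expR (- y)) (- expR (- t^-1)).
  have dN : is_derive t^-1 1 (fun y : R => - y) (-1).
    exact: (is_deriveN (is_derive_id _ _)).
  have := is_derive1_comp (is_derive_expR (- t^-1)) dN.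
  by rewrite mulrN1.
have dpow : is_derive t^-1 1 (fun y : R => y ^+ k) (k%:R * t^-1 ^+ k.-1).
  have := is_deriveX k (is_derive_id t^-1 (1 : R)).
  by rewrite exprfctE [_ *: _]mulr1.
have dm := is_deriveM dpow dexp.
apply: (near_eq_is_derive (f := (fun y : R => y ^+ k * expR (- y)) \o (fun s : R => s^-1))).
  near=> s; rewrite /flat ifT//; near: s; exact: lt_nbhsr.
have dc := is_derive1_comp dm dinv.
rewrite (_ : _ - _ = (t^-1 ^+ k *: - expR (- t^-1) +
    expR (- t^-1) *: (k%:R * t^-1 ^+ k.-1)) * (- t^-1 ^+ 2)); first exact: dc.
rewrite /flat t0; case: k {dm dpow dc} => [|k] /=; rewrite /GRing.scale/= ?exprS; ring.
Unshelve. all: by end_near. Qed.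

Lemma continuous_flat k : continuous (flat k).
Proof.
move=> t; apply: differentiable_continuous; apply/derivable1_diffP.
by have [] := is_derive_flat k t.
Qed.

End flat.

Section smooth_class.
Context (R : realType).

(** Restricting [f] to the line through [x] with direction [v] reduces this to the chain rule in one
    variable, so a directional derivative of [f] suffices. *)
Lemma is_derive_chain n (G : R -> R) (f : 'rV[R]_n -> R) x v (df dG : R) :
  is_derive x v f df -> is_derive (f x) 1 G dG ->
  is_derive x v (fun y => G (f y)) (dG * df).
Proof.
move=> [df1 <-{df}] hG; pose L (s : R) := f (x + s *: v).
have x0 : x + 0 *: v = x by rewrite scale0r addr0.
have dL : derivable L 0 1 by apply: derivable_line; rewrite x0.
have dLE : derive1 L 0 = 'D_v f x by rewrite derive1_line x0.
have hL : is_derive (0 : R) 1 L ('D_v f x).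
  by rewrite -dLE derive1E; exact: derivableP.
have hG0 : is_derive (L 0) 1 G dG by rewrite /L x0.
have [d1 d2] := is_derive1_comp hG0 hL.
apply: DeriveDef.
  apply/derivable1P; move: d1; rewrite (_ : _ \o _ = (fun h => G (f (h *: v + x))))//.
  by apply/funext => h; rewrite /= /L addrC.
rewrite -d2 -derive1E; have := derive1_line (fun y => G (f y)) x v 0.
by rewrite x0 => <-.
Qed.

(* A class of functions that is closed under partial derivatives, all of whose
   members are continuous and have partial derivatives; hence they are smooth. *)
Inductive elem n : ('rV[R]_n -> R) -> Prop :=
| elem_cst c : elem (fun=> c)
| elem_coord i : elem (fun x => x 0 i)
| elemD f g : elem f -> elem g -> elem (fun x => f x + g x)
| elemM f g : elem f -> elem g -> elem (fun x => f x * g x)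
| elem_expR f : elem f -> elem (fun x => expR (f x))
| elem_flat k f : elem f -> elem (fun x => flat k (f x)).

Lemma elem_continuous n (f : 'rV[R]_n -> R) : elem f -> continuous f.
Proof.
elim=> {f} [c|i|f g _ cf _ cg|f g _ cf _ cg|f _ cf|k f _ cf] x.
- exact: cst_continuous.
- exact: coord_continuous.
- exact: (cvgD (cf x) (cg x)).
- exact: (cvgM (cf x) (cg x)).
- exact: (continuous_comp (cf x) (@continuous_expR R _)).
- exact: (continuous_comp (cf x) (@continuous_flat R k _)).
Qed.

Lemma is_derive_coord n (i : 'I_n) (x v : 'rV[R]_n) :
  is_derive x v (fun y : 'rV[R]_n => y 0 i) (v 0 i).
Proof.
have c : (fun h : R => h^-1 *: ((h *: v + x) 0 i - x 0 i)) @ 0^' --> v 0 i.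
  apply: cvg_near_cst; near=> h.
  rewrite !mxE addrK /GRing.scale/= mulrA mulVf ?mul1r//.
  by near: h; exact: nbhs_dnbhs_neq.
by apply: DeriveDef; [apply/cvg_ex; exists (v 0 i)|exact: cvg_lim c].
Unshelve. all: by end_near. Qed.

Lemma elem_derive n (f : 'rV[R]_n -> R) v : elem f ->
  exists2 g, elem g & forall x, is_derive x v f (g x).
Proof.
elim=> {f} [c|i|f g ef [f' ef' df] eg [g' eg' dg]|f g ef [f' ef' df] eg [g' eg' dg]
  |f ef [f' ef' df]|k f ef [f' ef' df]].
- by exists (fun=> 0) => [|x]; [exact: elem_cst|exact: is_derive_cst].
- by exists (fun=> v 0 i) => [|x]; [exact: elem_cst|exact: is_derive_coord].
- by exists (fun x => f' x + g' x) => [|x]; [exact: elemD|exact: is_deriveD].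
- exists (fun x => f x * g' x + g x * f' x) => [|x]; last exact: is_deriveM.
  by apply: elemD; exact: elemM.
- exists (fun x => expR (f x) * f' x) => [|x].
    by apply: elemM => //; exact: elem_expR.
  by apply: is_derive_chain => //; exact: is_derive_expR.
exists (fun x => (flat k.+2 (f x) + - k%:R * flat k.+1 (f x)) * f' x) => [|x].
  apply: elemM => //; apply: elemD; first exact: elem_flat.
  by apply: elemM; [exact: elem_cst|exact: elem_flat].
by rewrite mulNr; apply: is_derive_chain => //; exact: is_derive_flat.
Qed.

Lemma elem_partial n (f : 'rV[R]_n.+1 -> R) i : elem f ->
  (forall x, derivable f x (delta_mx 0 i)) /\ elem (partial i f).
Proof.
move=> /(elem_derive (delta_mx 0 i))[g eg dg]; split=> [x|].
  by have [] := dg x.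
rewrite (_ : partial i f = g)//.
by apply/funext => x; rewrite /partial; have [_ ->] := dg x.
Qed.

Lemma elem_smooth n (f : 'rV[R]_n.+1 -> R) : elem f -> smooth f.
Proof.
move=> ef s; suff es : elem (foldr (@partial R n) f s).
  by split=> [|i]; [exact: elem_continuous|case: (elem_partial i es)].
by elim: s => [//|i s IHs] /=; case: (elem_partial i IHs).
Qed.

Lemma smooth_partial n (f : 'rV[R]_n.+1 -> R) i : smooth f -> smooth (partial i f).
Proof. by move=> sf s; have := sf (rcons s i); rewrite foldr_rcons. Qed.

Lemma smooth_C1 n (f : 'rV[R]_n.+1 -> R) : smooth f -> C1 f.
Proof.
move=> sf; split=> [|i]; first by have [] := sf [::].
by split; [have [_] := sf [::]; apply|have [] := sf [:: i]].
Qed.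

Lemma smoothB n (f g : 'rV[R]_n.+1 -> R) : smooth f -> smooth g ->
  smooth (fun x => f x - g x).
Proof.
move=> sf sg s.
have -> : foldr (@partial R n) (fun x => f x - g x) s =
    (fun x => foldr (@partial R n) f s x - foldr (@partial R n) g s x).
  elim: s => [//|i s /= ->]; apply/funext => x; rewrite /partial deriveB//.
    by have [_] := sf s; apply.
  by have [_] := sg s; apply.
have [cf df] := sf s; have [cg dg] := sg s; split=> [x|i x].
  exact: (cvgB (cf x) (cg x)).
by apply: derivableB; [exact: df|exact: dg].
Qed.

End smooth_class.

(** * Supports, and quotients by a function without zeros on the support *)

Section support.
Context (R : realType) (n : nat).
Implicit Types f g w phi : 'rV[R]_n.+1 -> R.

Definition supp f : set 'rV[R]_n.+1 := closure [set x | f x != 0].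

Lemma near_supp0 f x : ~ supp f x -> \near x, f x = 0.
Proof.
move=> fx; have : open (~` supp f) by apply: closed_openC; exact: closed_closure.
rewrite openE => /(_ x fx); apply: filterS => y fy.
by apply/eqP/negP => /negP fy0; apply: fy; exact: subset_closure.
Qed.

Lemma notin_supp f x : ~ supp f x -> f x = 0.
Proof. by move/near_supp0/nbhs_singleton. Qed.

Lemma partial_notin_supp f i x : ~ supp f x ->
  derivable f x (delta_mx 0 i) /\ partial i f x = 0.
Proof.
move=> /near_supp0 f0; have f0' : \near x, cst 0 x = f x by apply: filterS f0.
have [d1 d2] := near_eq_is_derive f0' (is_derive_cst (0 : R) x (delta_mx 0 i)).
by split.
Qed.

Lemma le_supp f g : (forall x, f x != 0 -> supp g x) -> supp f `<=` supp g.
Proof.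
move=> fg; have hc : closed (supp g) by exact: closed_closure.
rewrite ((closure_id _).1 hc); exact: closure_subset.
Qed.

Lemma supp_partial f i : supp (partial i f) `<=` supp f.
Proof.
apply: le_supp => x; apply: contraNP => fx.
by have [_ ->] := partial_notin_supp i fx.
Qed.

Lemma bsupp_le f g : supp f `<=` supp g -> bsupp g -> bsupp f.
Proof.
move=> fg [M gM]; exists M => x Mx; apply/eqP/negP => /negP fx0.
have : supp g x by apply: fg; exact: subset_closure.
apply: contraPP => _ gx; move: gx.
have : open [set y : 'rV[R]_n.+1 | M < `|y|].
  rewrite (_ : [set _ | _] = (@Num.norm R 'rV[R]_n.+1) @^-1` [set y | M < y])//.
  by apply: open_comp => [y _|]; [exact: norm_continuous|exact: open_gt].
rewrite openE => /(_ x Mx) Ux /(_ _ Ux)[y [/= gy /gM gy0]].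
by rewrite gy0 eqxx in gy.
Qed.

Lemma C1M f g : C1 f -> C1 g -> C1 (fun x => f x * g x).
Proof.
move=> [cf df] [cg dg]; split=> [x|i]; first exact: (cvgM (cf x) (cg x)).
have [dfi cfi] := df i; have [dgi cgi] := dg i.
split=> [x|]; first exact: derivableM.
have -> : partial i (fun x => f x * g x) = fun x => f x * partial i g x + g x * partial i f x.
  by apply/funext => x; rewrite /partial -[LHS]/('D__ (f * g) x) deriveM.
move=> x; exact: (cvgD (cvgM (cf x) (cgi x)) (cvgM (cg x) (cfi x))).
Qed.

Lemma partialM f g i : C1 f -> C1 g -> forall x,
  partial i (fun x => f x * g x) x = f x * partial i g x + g x * partial i f x.
Proof.
move=> [cf df] [cg dg] x; have [dfi _] := df i; have [dgi _] := dg i.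
by rewrite /partial -[LHS]/('D__ (f * g) x) deriveM.
Qed.

(** A zero of [w] lies outside the closed support of [f], so [f], and with it the quotient, vanishes
    in a neighbourhood. *)
Lemma continuous_div_supp f w : continuous f -> continuous w ->
  supp f `<=` [set x | w x != 0] -> continuous (fun x => f x / w x).
Proof.
move=> cf cw fw x; have [w0|w0] := eqVneq (w x) 0; last first.
  exact: (cvgM (cf x) (cvgV w0 (cw x))).
have fx : ~ supp f x by move=> /fw/=; rewrite w0 eqxx.
suff : (fun y => f y / w y) @ x --> f x / w x by [].
rewrite (notin_supp fx) mul0r; apply: (@cvg_near_cst _ _ _ _ (nbhs x)).
by near=> y; rewrite (near (near_supp0 fx) y)// mul0r.
Unshelve. all: by end_near. Qed.

(** The quotient rule survives at zeros of [w]: there the quotient is locally 0, and so is the value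
    of the formula. *)
Lemma is_derive_div_supp f w i x : C1 f -> C1 w -> supp f `<=` [set x | w x != 0] ->
  is_derive x (delta_mx 0 i) (fun x => f x / w x)
    ((partial i f x * w x - f x * partial i w x) / w x ^+ 2).
Proof.
move=> [cf df] [cw dw] fw; have [dfi _] := df i; have [dwi _] := dw i.
have [w0|w0] := eqVneq (w x) 0; last first.
  have dinv : is_derive (w x) 1 (fun s : R => s^-1) (- (w x ^- 2)).
    apply: is_derive_eq; first exact: is_deriveV.
    by rewrite /= scaleNr [_ *: _]mulr1.
  have dM := is_deriveM (derivableP (dfi x)) (is_derive_chain (derivableP (dwi x)) dinv).
  rewrite (_ : _ / _ = f x *: (- w x ^- 2 * 'D_(delta_mx 0 i) w x) +
    (w x)^-1 *: 'D_(delta_mx 0 i) f x); first exact: dM.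
  by rewrite /partial /GRing.scale/=; field.
have fx : ~ supp f x by move=> /fw/=; rewrite w0 eqxx.
have [_ ->] := partial_notin_supp i fx.
rewrite (notin_supp fx) !mul0r subrr mul0r.
apply: (near_eq_is_derive (f := cst 0)).
by near=> y; rewrite (near (near_supp0 fx) y)// mul0r.
Unshelve. all: by end_near. Qed.

Lemma C1_div_supp f w : C1 f -> C1 w -> supp f `<=` [set x | w x != 0] ->
  C1 (fun x => f x / w x).
Proof.
move=> Cf Cw fw; have [cf df] := Cf; have [cw dw] := Cw.
split=> [|i]; first exact: continuous_div_supp.
have [dfi cfi] := df i; have [dwi cwi] := dw i.
split=> [x|]; first by have [] := is_derive_div_supp i x Cf Cw fw.
have -> : partial i (fun x => f x / w x) =
    fun x => (partial i f x * w x - f x * partial i w x) / w x ^+ 2.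
  by apply/funext => x; have [_] := is_derive_div_supp i x Cf Cw fw.
(* The derivative is again such a quotient: its numerator is supported in the support of [f], and
   its denominator [w ^ 2] has the zeros of [w]. *)
apply: continuous_div_supp => x.
- exact: (cvgB (cvgM (cfi x) (cw x)) (cvgM (cf x) (cwi x))).
- exact: (cvgM (cw x) (cw x)).
rewrite /= sqrf_eq0; suff h : supp (fun x => partial i f x * w x - f x * partial i w x) `<=` supp f.
  by move=> /h; exact: fw.
apply: le_supp => y; apply: contraNP => fy.
have [_ ->] := partial_notin_supp i fy.
by rewrite (notin_supp fy) !mul0r subrr.
Qed.

End support.

(** * Integration by parts on the half-space *)

Section half_space_integral.
Context (R : realType) (m : nat).
Local Notation H := (@half_space R m).
Local Notation mu := (lebesgue_rV R m.+1).
Implicit Types f g phi : 'rV[R]_m.+1 -> R.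

Lemma continuous_last_coord : continuous (@last_coord R m).
Proof. exact: coord_continuous. Qed.

Lemma measurable_half_space : measurable H.
Proof.
by apply: measurable_open_rV; exists (@last_coord R m) => //;
  exact: continuous_last_coord.
Qed.

Lemma Cc_smooth_bsupp phi : Cc_smooth phi -> bsupp phi.
Proof.
move=> [_ /compact_bounded[M [_ hM]] _]; exists (`|M| + 1) => x Mx.
apply/eqP/negP => /negP fx0.
have cx : closure [set x | phi x != 0] x by exact: subset_closure.
have := hM (`|M| + 1); rewrite ltr_pwDr// ?ler_norm// => /(_ isT x cx).
by rewrite /= leNgt Mx.
Qed.

Section integrals.
Variable phi : 'rV[R]_m.+1 -> R.
Hypothesis Cphi : Cc_smooth phi.

Let phiH x : ~ H x -> ~ supp phi x.
Proof. by case: Cphi => _ _ h xH xs; apply: xH; exact: h. Qed.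

Lemma integrable_Cc f : continuous f -> supp f `<=` supp phi ->
  mu.-integrable H (fun x => (f x)%:E).
Proof.
move=> cf fphi.
apply: (@integrableS _ _ _ mu setT) => //; first exact: measurable_half_space.
by apply: integrable_bsupp => //; exact: bsupp_le fphi (Cc_smooth_bsupp Cphi).
Qed.

(** The support is a compact subset of the open half-space, so there is no boundary term and the
    integral equals that over the whole space. *)
Lemma Rintegral_partial0 f i : C1 f -> supp f `<=` supp phi ->
  \int[mu]_(x in H) partial i f x = 0.
Proof.
move=> Cf fphi; rewrite Rintegral_mkcond.
rewrite (_ : _ \_ _ = partial i f); last first.
  apply/funext => x; rewrite patchE; case: ifPn => // /negP; rewrite inE => xH.
  by rewrite [RHS]notin_supp// => /supp_partial/fphi; exact: phiH.
rewrite /Rintegral integral_partial0//.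
exact: bsupp_le fphi (Cc_smooth_bsupp Cphi).
Qed.

(** Only [f] is compactly supported; [g] will also be a derivative of a Gaussian profile. *)
Lemma Rintegral_by_parts f g i : C1 f -> C1 g -> supp f `<=` supp phi ->
  \int[mu]_(x in H) (partial i f x * g x) = - \int[mu]_(x in H) (f x * partial i g x).
Proof.
move=> Cf Cg fphi; have [cf df] := Cf; have [cg dg] := Cg.
have [_ cfi] := df i; have [_ cgi] := dg i.
have sM h h' : supp h `<=` supp phi -> supp (fun x => h x * h' x) `<=` supp phi.
  move=> hphi; apply: le_supp => x; rewrite mulf_eq0 => /norP[hx _].
  by apply: hphi; exact: subset_closure.
apply/eqP; rewrite -addr_eq0 -RintegralD//; last 3 first.
- exact: measurable_half_space.
- apply: integrable_Cc => [x|]; first exact: (cvgM (cfi x) (cg x)).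
  by apply: sM; apply: subset_trans fphi; exact: supp_partial.
- by apply: integrable_Cc => [x|]; [exact: (cvgM (cf x) (cgi x))|exact: sM].
apply/eqP; rewrite -[RHS](@Rintegral_partial0 (fun x => f x * g x) i).
- by apply: eq_Rintegral => x _; rewrite partialM// addrC (mulrC (g x)).
- exact: C1M.
- exact: sM.
Qed.

End integrals.
End half_space_integral.

(** * Derivatives of the Gaussian profiles *)

Section gaussian_calculus.
Context (R : realType) (m : nat).
Local Notation n := (m.+1).
Implicit Types (x : 'rV[R]_n) (i : 'I_n).

Definition gauss (b : R) x : R := expR (- (b * sqnorm x)).

Lemma elem_sqnorm : elem (@sqnorm R n).
Proof.
rewrite /sqnorm; elim: (index_enum _) => [|i s IHs].
  by under eq_fun do rewrite big_nil; exact: elem_cst.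
under eq_fun do rewrite big_cons.
by apply: elemD => //; apply: elemM; exact: elem_coord.
Qed.

Lemma elem_gauss b : elem (gauss b).
Proof.
rewrite /gauss; apply: elem_expR; under eq_fun do rewrite -mulNr.
by apply: elemM; [exact: elem_cst|exact: elem_sqnorm].
Qed.

Lemma elem_gaussian_profile a b : elem (@gaussian_profile R m a b).
Proof.
apply: elemM; last exact: elem_gauss.
by apply: elemM; [exact: elem_cst|exact: elem_coord].
Qed.

Lemma is_derive_sqnorm i x : is_derive x (delta_mx 0 i) (@sqnorm R n) (2 * x 0 i).
Proof.
have h j := is_deriveM (is_derive_coord j x (delta_mx 0 i))
  (is_derive_coord j x (delta_mx 0 i)).
have := is_derive_sum h.
rewrite (_ : \sum_(j < n) _ = @sqnorm R n); last first.
  by apply/funext => y; rewrite fct_sumE /sqnorm; apply: eq_bigr.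
rewrite (_ : \sum_(j < n) _ = 2 * x 0 i)//.
rewrite (bigD1 i)//= big1 ?addr0 => [|j ji].
  by rewrite !mxE !eqxx /GRing.scale/=; ring.
by rewrite !mxE eqxx (negbTE ji) scaler0 addr0.
Qed.

Lemma is_derive_gauss b i x :
  is_derive x (delta_mx 0 i) (gauss b) (- (2 * b * x 0 i) * gauss b x).
Proof.
have h : is_derive x (delta_mx 0 i) (fun y => - (b * sqnorm y)) (- (b * (2 * x 0 i))).
  exact: (is_deriveN (is_deriveZ b (is_derive_sqnorm i x))).
have := is_derive_chain h (is_derive_expR _).
by rewrite (_ : _ * _ = - (2 * b * x 0 i) * gauss b x)// /gauss; ring.
Qed.

Lemma is_derive_last i x :
  is_derive x (delta_mx 0 i) (@last_coord R m) (i == ord_max)%:R.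
Proof.
have := is_derive_coord ord_max x (delta_mx 0 i).
by rewrite mxE eqxx eq_sym.
Qed.

Lemma partialE (f : 'rV[R]_n -> R) i x (df : R) :
  is_derive x (delta_mx 0 i) f df -> partial i f x = df.
Proof. by case. Qed.

Lemma partial_gaussian_profile a b i x : partial i (gaussian_profile a b) x =
  a * ((i == ord_max)%:R - 2 * b * (x 0 i * last_coord x)) * gauss b x.
Proof.
have h := is_deriveM (is_deriveZ a (is_derive_last i x)) (is_derive_gauss b i x).
transitivity (a * last_coord x * (- (2 * b * x 0 i) * gauss b x) +
  gauss b x * (a * (i == ord_max)%:R)); first exact: (partialE h).
ring.
Qed.

Lemma laplacian_gaussian_profile a b x :
  \sum_(i < n) partial i (partial i (gaussian_profile a b)) x =
  (4 * b ^+ 2 * sqnorm x - 2 * b * (n%:R + 2)) * gaussian_profile a b x.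
Proof.
have d2 i : partial i (partial i (gaussian_profile a b)) x =
    gaussian_profile a b x * (4 * b ^+ 2 * x 0 i ^+ 2 - 2 * b) -
    4 * a * b * gauss b x * (x 0 i * (i == ord_max)%:R).
  have -> : partial i (gaussian_profile a b) = fun y =>
      a * ((i == ord_max)%:R - 2 * b * (y 0 i * last_coord y)) * gauss b y.
    by apply/funext => y; exact: partial_gaussian_profile.
  have d1 := is_deriveZ (- (2 * b)) (is_deriveM (is_derive_coord i x (delta_mx 0 i))
    (is_derive_last i x)).
  have d2 := is_deriveZ a (is_deriveD
    (is_derive_cst ((i == ord_max)%:R : R) x (delta_mx 0 i)) d1).
  have d3 := is_deriveM d2 (is_derive_gauss b i x).
  transitivity (a * ((i == ord_max)%:R + - (2 * b) * (x 0 i * last_coord x)) *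
      (- (2 * b * x 0 i) * gauss b x) +
    gauss b x * (a * (0 + - (2 * b) * (x 0 i * (i == ord_max)%:R +
      last_coord x * (delta_mx 0 i : 'rV[R]_n) 0 i)))).
    rewrite -(partialE d3); congr (partial i _ x); apply/funext => y.
    by rewrite -[RHS]/(a * ((i == ord_max)%:R + - (2 * b) * (y 0 i * last_coord y)) *
      gauss b y) mulNr.
  by rewrite mxE !eqxx /= /gaussian_profile -/(gauss b x); ring.
(* Summed over [i], the term [- 2 b] of [d2] gives [- 2 b n], and its last term, nonzero only in the
   last direction, gives the remaining [- 4 b]. *)
under eq_bigr do rewrite d2.
rewrite sumrB -mulr_sumr -mulr_sumr sumrB -mulr_sumr sumr_const card_ord.
have -> : \sum_(i < n) x 0 i * (i == ord_max)%:R = x 0 ord_max.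
  rewrite (bigD1 ord_max)//= big1 ?addr0 ?eqxx ?mulr1// => i ine.
  by rewrite (negbTE ine) mulr0.
rewrite -/(sqnorm x) -mulr_natr /gaussian_profile -/(gauss b x) /last_coord.
ring.
Qed.

End gaussian_calculus.

(** * The ground state identity *)

Section energy_identities.
Context (R : realType) (m : nat).
Local Notation n := (m.+1).
Local Notation H := (@half_space R m).
Local Notation mu := (lebesgue_rV R m.+1).
Local Notation J := (fun f : 'rV[R]_n -> R => \int[mu]_(x in H) f x).
Local Notation ipH := (@ip _ _ R mu H).
Local Notation L2H := (@L2 _ _ R mu H).
Implicit Types f g phi chi : 'rV[R]_n -> R.

Lemma Rintegral_sum d (T : measurableType d) (nu : {measure set T -> \bar R})
    (D : set T) (mD : measurable D) (I : Type) (s : seq I) (F : I -> T -> R) :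
  (forall i, nu.-integrable D (fun x => (F i x)%:E)) ->
  \int[nu]_(x in D) (\sum_(i <- s) F i x) = \sum_(i <- s) \int[nu]_(x in D) F i x.
Proof.
move=> iF; elim: s => [|i s IHs].
  rewrite big_nil; under eq_Rintegral do rewrite big_nil.
  by rewrite Rintegral_cst// mul0r.
rewrite big_cons -IHs -RintegralD//; last 2 first.
- exact: iF.
- apply: (eq_integrable mD (fun x => \sum_(j <- s) (F j x)%:E)%E).
    by move=> x _; rewrite /= sumEFin.
  exact: integrable_sum.
by apply: eq_Rintegral => x _; rewrite big_cons.
Qed.

Lemma continuous_mulf f g : continuous f -> continuous g ->
  continuous (fun x => f x * g x).
Proof. by move=> cf cg x; exact: (cvgM (cf x) (cg x)). Qed.

Lemma continuous_coord j : continuous (fun x : 'rV[R]_n => x 0 j).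
Proof. exact: coord_continuous. Qed.

Lemma continuous_L2 f phi : Cc_smooth phi -> continuous f -> supp f `<=` supp phi ->
  L2H f.
Proof.
move=> Cphi cf fphi; split.
  by apply: measurable_funTS; exact: continuous_measurable_fun_rV.
apply: (integrable_Cc Cphi) => [x|]; first exact: (cvgM (cf x) (cf x)).
apply: le_supp => x; rewrite sqrf_eq0 => fx.
by apply: fphi; exact: subset_closure.
Qed.

Lemma suppMl f g phi : supp f `<=` supp phi -> supp (fun x => f x * g x) `<=` supp phi.
Proof.
move=> fphi; apply: le_supp => x; rewrite mulf_eq0 => /norP[fx _].
by apply: fphi; exact: subset_closure.
Qed.

Lemma suppMr f g phi : supp f `<=` supp phi -> supp (fun x => g x * f x) `<=` supp phi.
Proof. by move=> fphi; under eq_fun do rewrite mulrC; exact: suppMl. Qed.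

Lemma Cc_smooth_C1 phi : Cc_smooth phi -> C1 phi.
Proof. by case=> /smooth_C1. Qed.

Lemma Cc_smooth_continuous phi : Cc_smooth phi -> continuous phi.
Proof. by case/Cc_smooth_C1. Qed.

Lemma Cc_smooth_partial phi i : Cc_smooth phi -> continuous (partial i phi).
Proof. by move=> /Cc_smooth_C1[_ /(_ i)[]]. Qed.

Lemma Cc_smooth_L2 phi : Cc_smooth phi -> L2H phi.
Proof. by move=> Cphi; apply: (continuous_L2 Cphi) => //; exact: Cc_smooth_continuous. Qed.

Lemma Cc_smooth_L2_partial phi i : Cc_smooth phi -> L2H (partial i phi).
Proof.
move=> Cphi; apply: (continuous_L2 Cphi); first exact: Cc_smooth_partial.
exact: supp_partial.
Qed.

Lemma Cc_smooth_L2_moment phi j : Cc_smooth phi -> L2H (fun x => x 0 j * phi x).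
Proof.
move=> Cphi; apply: (continuous_L2 Cphi); last exact: suppMr.
by apply: continuous_mulf; [exact: continuous_coord|exact: Cc_smooth_continuous].
Qed.

Definition energy (v : 'I_n -> 'rV[R]_n -> R) : R := \sum_(i < n) ipH (v i) (v i).

(** In the form of an energy, so that it is a sum of squared L2 norms, handled by the same limit
    lemmas as the gradient. *)
Definition moment f : R := energy (fun j x => x 0 j * f x).

Lemma gaussian_profile_gt0 b x : H x -> 0 < gaussian_profile 1 b x.
Proof. by move=> Hx; rewrite /gaussian_profile mul1r mulr_gt0// expR_gt0. Qed.

(** The eigenvalue equation tested against [f]: [f = phi ^ 2 / w] gives the ground state identity,
    [f = phi] the weak form of the equation. The factor [|x|^2] is split as [x_j] times [x_j] to
    produce inner products of moments. *)
Lemma Rintegral_laplacian_gaussian phi f a b : Cc_smooth phi -> continuous f ->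
    supp f `<=` supp phi ->
  \sum_(i < n) J (fun x => f x * partial i (partial i (gaussian_profile a b)) x) =
  4 * b ^+ 2 * \sum_(j < n) J (fun x => (x 0 j * f x) * (x 0 j * gaussian_profile a b x))
  - 2 * b * (n%:R + 2) * J (fun x => f x * gaussian_profile a b x).
Proof.
move=> Cphi cf fphi; have mH := @measurable_half_space R m.
have sW := elem_smooth (@elem_gaussian_profile R m a b).
have cW : continuous (@gaussian_profile R m a b) by case: (smooth_C1 sW).
have cW2 (i : 'I_n) : continuous (partial i (partial i (@gaussian_profile R m a b))).
  by have [_ /(_ i)[_]] := smooth_C1 (smooth_partial i sW).
have i1 g : continuous g -> mu.-integrable H (fun x => (f x * g x)%:E).
  move=> cg; apply: (integrable_Cc Cphi) => [x|]; first exact: (cvgM (cf x) (cg x)).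
  exact: suppMl.
have i2 j : mu.-integrable H (fun x => (x 0 j * f x * (x 0 j * gaussian_profile a b x))%:E).
  under eq_fun do rewrite (mulrC _ (f _)) -mulrA.
  apply: (i1 (fun x => x 0 j * (x 0 j * gaussian_profile a b x))).
  by do 2 (apply: continuous_mulf; first exact: continuous_coord).
have i3 : mu.-integrable H (fun x : 'rV[R]_n =>
    (\sum_(j < n) x 0 j * f x * (x 0 j * gaussian_profile a b x))%:E).
  apply: (eq_integrable mH (fun x : 'rV[R]_n =>
      \sum_(j < n) (x 0%R j * f x * (x 0%R j * gaussian_profile a b x))%:E)%E).
    by move=> x _; rewrite /= sumEFin.
  by apply: integrable_sum => // j _; exact: i2.
rewrite -!Rintegral_sum//; last by move=> i; exact: i1.
rewrite -!RintegralZl//; last exact: i1.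
rewrite -RintegralB//; last 2 first.
- exact: integrableZl i3.
- exact: integrableZl (i1 _ cW).
apply: eq_Rintegral => x _; rewrite -mulr_sumr laplacian_gaussian_profile.
under [in RHS]eq_bigr do rewrite mulrACA -expr2.
by rewrite -mulr_suml -/(sqnorm x); ring.
Qed.

Lemma energy_identity phi b : Cc_smooth phi ->
  energy (fun i => partial i phi) + 4 * b ^+ 2 * moment phi -
    2 * b * (n%:R + 2) * ipH phi phi =
  energy (fun i x => gaussian_profile 1 b x *
    partial i (fun y => phi y / gaussian_profile 1 b y) x).
Proof.
move=> Cphi; have C1p := Cc_smooth_C1 Cphi; set w := @gaussian_profile R m 1 b.
have sW : smooth w by apply: elem_smooth; exact: elem_gaussian_profile.
have C1w := smooth_C1 sW; have [cw dw] := C1w.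
have cw2 i : continuous (partial i (partial i w)).
  by have [_ /(_ i)[_]] := smooth_C1 (smooth_partial i sW).
have pw : supp phi `<=` [set x | w x != 0].
  case: Cphi => _ _ pH x /pH Hx /=; rewrite gt_eqF//; exact: gaussian_profile_gt0.
pose psi x := phi x / w x.
have C1psi : C1 psi by exact: C1_div_supp.
have [cpsi dpsi] := C1psi; have [cp dp] := C1p.
(* At zeros of [w] both sides are 0, since these points lie outside the support of [phi]. *)
have phiE x : phi x = psi x * w x.
  rewrite /psi; have [w0|w0] := eqVneq (w x) 0; last by rewrite divfK.
  by rewrite w0 mulr0 notin_supp// => /pw /=; rewrite w0 eqxx.
have spsi : supp psi `<=` supp phi by exact: suppMl.
have dphiE i x : partial i phi x = psi x * partial i w x + w x * partial i psi x.
  by rewrite -partialM//; congr (partial i _ x); apply/funext.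
have cdw i : continuous (partial i w) by case: (dw i).
have cdpsi i : continuous (partial i psi) by case: (dpsi i).
have mH := @measurable_half_space R m.
(* With [d = partial i], pointwise [(d phi)^2 = (w d psi)^2 + d (psi phi d w) - psi phi d (d w)],
   and the middle term integrates to 0. Summed over [i], the last term contains the Laplacian of
   [w], and [psi phi w = phi ^ 2]. *)
have step i : ipH (partial i phi) (partial i phi) =
    ipH (fun x => w x * partial i psi x) (fun x => w x * partial i psi x) -
    J (fun x => psi x * phi x * partial i (partial i w) x).
  have C1F : C1 (fun x => psi x * phi x * partial i w x).
    by apply: C1M; [exact: C1M|exact: smooth_C1 (smooth_partial i sW)].
  have sF : supp (fun x => psi x * phi x * partial i w x) `<=` supp phi.
    by apply: suppMl; exact: suppMl.
  have ia : mu.-integrable H (fun x => (w x * partial i psi x * (w x * partial i psi x))%:E).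
    apply: (integrable_Cc Cphi) => [x|].
      exact: (cvgM (cvgM (cw x) (cdpsi i x)) (cvgM (cw x) (cdpsi i x))).
    apply: suppMl; apply: suppMr; apply: subset_trans spsi; exact: supp_partial.
  have ib : mu.-integrable H (fun x =>
      (partial i (fun x => psi x * phi x * partial i w x) x)%:E).
    apply: (integrable_Cc Cphi); first by have [_ /(_ i)[]] := C1F.
    by apply: subset_trans sF; exact: supp_partial.
  have ic : mu.-integrable H (fun x => (psi x * phi x * partial i (partial i w) x)%:E).
    apply: (integrable_Cc Cphi) => [x|]; last by apply: suppMl; exact: suppMl.
    exact: (cvgM (cvgM (cpsi x) (cp x)) (cw2 i x)).
  rewrite -[X in _ = X - _]addr0 -(Rintegral_partial0 Cphi i C1F sF).
  rewrite /ip -RintegralD// -RintegralB//; last exact: (integrableD mH ia ib).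
  apply: eq_Rintegral => x _.
  rewrite partialM; [|exact: C1M|exact: smooth_C1 (smooth_partial i sW)].
  by rewrite partialM// dphiE phiE; ring.
rewrite /energy (eq_bigr _ (fun i _ => step i)) sumrB.
rewrite (@Rintegral_laplacian_gaussian phi (fun x => psi x * phi x) 1 b Cphi); last 2 first.
- by move=> x; exact: (cvgM (cpsi x) (cp x)).
- exact: suppMl.
rewrite -/w.
rewrite (_ : J (fun x => psi x * phi x * w x) = ipH phi phi); last first.
  by apply: eq_Rintegral => x _; rewrite mulrAC -phiE.
rewrite (_ : \sum_(j < n) J (fun x => x 0 j * (psi x * phi x) * (x 0 j * w x)) = moment phi).
  by ring.
apply: eq_bigr => j _; apply: eq_Rintegral => x _.
by rewrite phiE; ring.
Qed.

(** The weak eigenvalue equation of the profile. Letting [phi] tend to the profile itself will show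
    that its deficit is 0. *)
Lemma green_gaussian phi a b : Cc_smooth phi ->
  \sum_(i < n) ipH (partial i phi) (partial i (gaussian_profile a b)) =
  2 * b * (n%:R + 2) * ipH phi (gaussian_profile a b) -
  4 * b ^+ 2 * \sum_(j < n) ipH (fun x => x 0 j * phi x) (fun x => x 0 j * gaussian_profile a b x).
Proof.
move=> Cphi; have C1p := Cc_smooth_C1 Cphi.
have sW := elem_smooth (@elem_gaussian_profile R m a b).
rewrite -opprB -(Rintegral_laplacian_gaussian a b Cphi (Cc_smooth_continuous Cphi))//.
rewrite -sumrN; apply: eq_bigr => i _.
apply: (Rintegral_by_parts Cphi) => //.
exact: smooth_C1 (smooth_partial i sW).
Qed.

Lemma green_Cc phi chi : Cc_smooth phi -> Cc_smooth chi ->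
  \sum_(i < n) ipH (partial i phi) (partial i chi) =
  - \sum_(i < n) ipH phi (partial i (partial i chi)).
Proof.
move=> Cphi [sC _ _]; rewrite -sumrN; apply: eq_bigr => i _.
apply: (Rintegral_by_parts Cphi) => //; first exact: Cc_smooth_C1.
exact: smooth_C1 (smooth_partial i sC).
Qed.

End energy_identities.

(** * Approximation in S and convergence in unweighted L2 *)

Section completion.
Context (R : realType) (m : nat).
Local Notation n := (m.+1).
Local Notation H := (@half_space R m).
Local Notation mu := (lebesgue_rV R m.+1).
Local Notation ipH := (@ip _ _ R mu H).
Local Notation L2H := (@L2 _ _ R mu H).
Implicit Types (u phi : 'rV[R]_n -> R) (v Du : 'rV[R]_n -> 'rV[R]_n).

Lemma cvg0_sqrteD (a b : nat -> \bar R) :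
  (forall k, 0 <= a k)%E -> (forall k, 0 <= b k)%E ->
  (sqrte (a k) + sqrte (b k))%E @[k --> \oo] --> 0%E -> a k @[k --> \oo] --> 0%E.
Proof.
move=> a0 b0 ab0; have sa : sqrte (a k) @[k --> \oo] --> 0%E.
  apply: (squeeze_cvge (f := cst 0%E) (h := fun k => (sqrte (a k) + sqrte (b k))%E)) => //.
    apply: nearW => k; rewrite sqrte_ge0/= -[leLHS]adde0.
    by apply: leeD2l; exact: sqrte_ge0.
  exact: cvg_cst.
rewrite (_ : a = fun k => (sqrte (a k) * sqrte (a k))%E); last first.
  by apply/funext => k; rewrite -[LHS]sqr_sqrte.
rewrite -[X in _ --> X](mule0 (0 : \bar R)%E).
by apply: cvgeM.
Qed.

Lemma ler_sum2 (I : finType) (F G K : I -> R) :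
  (forall i, F i <= 2 * G i + 2 * K i) ->
  \sum_i F i <= 2 * \sum_i G i + 2 * \sum_i K i.
Proof.
by move=> FGK; rewrite !mulr_sumr -big_split; apply: ler_sum => i _; exact: FGK.
Qed.

Lemma cvg_sum (I : Type) (s : seq I) (F : I -> nat -> R) (a : I -> R) :
  (forall i, F i k @[k --> \oo] --> a i) ->
  \sum_(i <- s) F i k @[k --> \oo] --> \sum_(i <- s) a i.
Proof.
move=> Fa; elim: s => [|i s IHs].
  by under eq_fun do rewrite big_nil; rewrite big_nil; exact: cvg_cst.
by under eq_fun do rewrite big_cons; rewrite big_cons; exact: cvgD.
Qed.

Lemma gradient_energyE v : (forall i, measurable_fun H (fun x => v x 0 i)) ->
  gradient_energy v = (\sum_(i < n) \int[mu]_(x in H) (v x 0%R i ^+ 2)%:E)%E.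
Proof.
move=> mv; rewrite /gradient_energy /int_half_space /sqnorm.
under eq_integral do rewrite -sumEFin.
rewrite ge0_integral_sum//.
- exact: measurable_half_space.
- move=> i; apply/measurable_EFinP; apply: measurable_funX.
  exact: mv.
- by move=> i x _; rewrite lee_fin sqr_ge0.
Qed.

Lemma second_momentE u : measurable_fun H u ->
  second_moment u = (\sum_(j < n) \int[mu]_(x in H) ((x 0%R j * u x) ^+ 2)%:E)%E.
Proof.
move=> mfu; rewrite /second_moment /int_half_space /sqnorm.
have -> : (fun x : 'rV[R]_n => ((\sum_(i < n) x 0 i ^+ 2) * `|u x| ^+ 2)%:E) =
    (fun x => \sum_(j < n) ((x 0%R j * u x) ^+ 2)%:E)%E.
  apply/funext => x; rewrite sumEFin mulr_suml; congr EFin.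
  by apply: eq_bigr => j _; rewrite real_normK ?num_real// exprMn.
rewrite ge0_integral_sum//.
- exact: measurable_half_space.
- move=> i; apply/measurable_EFinP; apply: measurable_funX.
  apply: measurable_funM => //; apply: measurable_funTS; exact: measurable_coord.
- by move=> i x _; rewrite lee_fin sqr_ge0.
Qed.

Lemma massE u : mass u = (\int[mu]_(x in H) (u x ^+ 2)%:E)%E.
Proof.
by apply: eq_integral => x _; rewrite real_normK ?num_real.
Qed.

Lemma energy_ge0 (v : 'I_n -> 'rV[R]_n -> R) : 0 <= @energy R m v.
Proof. by apply: sumr_ge0 => i _; exact: ip_ge0. Qed.

Lemma Cc_smoothB f g : @Cc_smooth R m f -> Cc_smooth g -> Cc_smooth (fun x => f x - g x).
Proof.
move=> [sf kf hf] [sg kg hg].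
have sub : supp (fun x => f x - g x) `<=` supp f `|` supp g.
  rewrite /supp -closureU; apply: closure_subset => x /=.
  by have [->|] := eqVneq (f x) 0; [rewrite sub0r oppr_eq0; right|left].
split; first exact: smoothB.
  apply: (subclosed_compact _ (compactU kf kg)) => //; exact: closed_closure.
by move=> x /sub[/hf|/hg].
Qed.

(** The ground state identity at [b = 1/2], where the coefficient of the moment is 1; it even gives
    [n + 2] times the mass. Thus the norm of S controls the L2 norm although its weight vanishes at
    the origin. *)
Lemma mass_le_energy phi : Cc_smooth phi ->
  ipH phi phi <= energy (fun i => partial i phi) + moment phi.
Proof.
move=> Cphi; have := energy_ge0 (fun i x => gaussian_profile 1 2^-1 x *
  partial i (fun y => phi y / gaussian_profile 1 2^-1 y) x).
rewrite -energy_identity//; have := ip_ge0 mu H phi.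
rewrite (_ : 4 * _ ^+ 2 = 1); last by field.
rewrite (_ : 2 * 2^-1 = 1); last by field.
rewrite !mul1r => M0.
have : 0 <= (m.+1%:R + 1 : R) * ipH phi phi by rewrite mulr_ge0.
by rewrite mulrDl mul1r mulrDl; lra.
Qed.

Lemma ip_sqB_le f g h : L2H f -> L2H g -> L2H h ->
  ipH (fun x => f x - g x) (fun x => f x - g x) <=
  2 * ipH (fun x => f x - h x) (fun x => f x - h x) +
  2 * ipH (fun x => g x - h x) (fun x => g x - h x).
Proof.
move=> Lf Lg Lh; have mH := @measurable_half_space R m.
have Lfh := L2B mH Lf Lh; have Lgh := L2B mH Lg Lh.
have := ip_ge0 mu H (fun x => (f x - h x) + (g x - h x)).
have -> : (fun x => f x - g x) = (fun x => (f x - h x) - (g x - h x)).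
  by apply/funext => x; ring.
by rewrite (ip_sqrD mH Lfh Lgh) (ip_sqrB mH Lfh Lgh); lra.
Qed.

(** Convergence to [u] is known only in the weighted norm, which dominates the plain one where
    [|x|^2 >= 1 / N]. Here [psi] is a later term of the sequence that approximates [u]. *)
Lemma ip_restrict_le phi psi u (N : R) : L2H phi -> L2H psi -> measurable_fun H u ->
  (forall j : 'I_n, L2H (fun x => x 0 j * (psi x - u x))) -> 0 < N ->
  (\int[mu]_(x in H `&` [set x | (N^-1 <= sqnorm x)%R]) ((phi x - u x) ^+ 2)%:E <=
   (2 * ipH (fun x => phi x - psi x)%R (fun x => phi x - psi x)%R + 2 * N *
     \sum_(j < n) ipH (fun x => x 0 j * (psi x - u x))%R
                      (fun x => x 0 j * (psi x - u x))%R)%:E)%E.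
Proof.
move=> Lphi Lpsi mfu Lx N0; have mH := @measurable_half_space R m.
have Lpp := L2B mH Lphi Lpsi.
have mpsi : measurable_fun H psi by case: Lpsi.
have mphi : measurable_fun H phi by case: Lphi.
have mE : measurable (H `&` [set x | (N^-1 <= sqnorm x)%R]).
  apply: measurableI => //.
  have ms : measurable_fun [set: 'rV[R]_n] (@sqnorm R n).
    apply: continuous_measurable_fun_rV; exact/elem_continuous/elem_sqnorm.
  rewrite -[X in measurable X]setTI.
  rewrite (_ : [set _ | _] = (@sqnorm R n) @^-1` `[N^-1, +oo[%classic).
    exact: ms.
  by apply/seteqP; split => x /=; rewrite in_itv/= andbT.
pose G x := 2 * ((phi x - psi x) * (phi x - psi x)) +
  \sum_(j < n) (2 * N) * ((x 0 j * (psi x - u x)) * (x 0 j * (psi x - u x))).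
have i1 : mu.-integrable H (fun x => (2 * ((phi x - psi x) * (phi x - psi x)))%:E).
  exact: (integrableZl mH 2 (integrable_mul_L2 mH Lpp Lpp)).
have i2 j : mu.-integrable H (fun x : 'rV[R]_n =>
    ((2 * N) * ((x 0 j * (psi x - u x)) * (x 0 j * (psi x - u x))))%:E).
  exact: (integrableZl mH (2 * N) (integrable_mul_L2 mH (Lx j) (Lx j))).
have i3 : mu.-integrable H (fun x : 'rV[R]_n =>
    (\sum_(j < n) (2 * N) * ((x 0 j * (psi x - u x)) * (x 0 j * (psi x - u x))))%:E).
  apply: (eq_integrable mH (fun x : 'rV[R]_n => \sum_(j < n)
    ((2 * N) * ((x 0 j * (psi x - u x)) * (x 0 j * (psi x - u x))))%:E)%E).
    by move=> x _; rewrite /= sumEFin.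
  by apply: integrable_sum => // j _; exact: i2.
have iG : mu.-integrable H (fun x => (G x)%:E) by exact: (integrableD mH i1 i3).
have G0 x : 0 <= G x.
  apply: addr_ge0; first by rewrite mulr_ge0// -expr2 sqr_ge0.
  apply: sumr_ge0 => j _; apply: mulr_ge0; first by rewrite mulr_ge0 ?(ltW N0).
  by rewrite -expr2 sqr_ge0.
apply: (@le_trans _ _ (\int[mu]_(x in H) (G x)%:E)%E).
  apply: (@le_trans _ _ (\int[mu]_(x in H `&` [set x | (N^-1 <= sqnorm x)%R]) (G x)%:E)%E).
    apply: ge0_le_integral => //.
    - by move=> x _; rewrite lee_fin sqr_ge0.
    - apply/measurable_EFinP; apply: measurable_funX; apply: measurable_funB.
        by apply: measurable_funS mphi => //; exact: subIsetl.
      by apply: measurable_funS mfu => //; exact: subIsetl.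
    - by apply: measurable_funS (measurable_int _ iG) => //; exact: subIsetl.
    move=> x [_ /= Nx]; rewrite lee_fin /G.
    have -> : \sum_(j < n) 2 * N * (x 0 j * (psi x - u x) * (x 0 j * (psi x - u x))) =
        2 * (N * sqnorm x) * (psi x - u x) ^+ 2.
      under eq_bigr do rewrite [X in _ * X]mulrACA -!expr2 mulrA.
      by rewrite -mulr_suml -mulr_sumr -/(sqnorm x); ring.
    have N1 : 1 <= N * sqnorm x by rewrite -ler_pdivrMl// mulr1.
    have h : (psi x - u x) ^+ 2 <= N * sqnorm x * (psi x - u x) ^+ 2.
      by rewrite -[leLHS]mul1r ler_wpM2r// sqr_ge0.
    have := sqr_ge0 ((phi x - psi x) - (psi x - u x)).
    have -> : phi x - u x = (phi x - psi x) + (psi x - u x) by ring.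
    by move: h; set a := phi x - psi x; set b := psi x - u x; nra.
  apply: ge0_subset_integral; [exact: mE|exact: mH|exact: (measurable_int _ iG)| |].
    by move=> x _; rewrite lee_fin.
  exact: subIsetl.
rewrite -[leLHS]fineK; last exact: integrable_fin_num.
rewrite lee_fin -[leLHS]/(\int[mu]_(x in H) G x) RintegralD//.
rewrite Rintegral_sum// RintegralZl//; last exact: integrable_mul_L2.
rewrite lerD2l mulr_sumr; apply: ler_sum => j _.
by rewrite RintegralZl//; exact: integrable_mul_L2.
Qed.

(** The gradients and moments converge by definition of the norm. The unweighted convergence comes
    from [mass_le_energy], which makes the sequence Cauchy in L2, and from identifying its limit
    with [u] away from the origin. *)
Lemma in_S_approx u Du : in_S u Du -> exists phi : nat -> 'rV[R]_n -> R,
  [/\ forall k, Cc_smooth (phi k),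
      forall i, L2H (fun x => Du x 0 i) /\
        ipH (fun x => partial i (phi k) x - Du x 0 i)
            (fun x => partial i (phi k) x - Du x 0 i) @[k --> \oo] --> 0,
      forall j, L2H (fun x => x 0 j * u x) /\
        ipH (fun x => x 0 j * phi k x - x 0 j * u x)
            (fun x => x 0 j * phi k x - x 0 j * u x) @[k --> \oo] --> 0 &
      L2H u /\ ipH (fun x => phi k x - u x) (fun x => phi k x - u x)
        @[k --> \oo] --> 0].
Proof.
move=> [mfu mDu [phi [Cphi cphi]]]; exists phi.
have mH := @measurable_half_space R m.
have mphi k : measurable_fun H (phi k).
  by apply: measurable_funTS; apply: continuous_measurable_fun_rV; exact: Cc_smooth_continuous.
have mphiu k : measurable_fun H (phi k \- u) by exact: measurable_funB.
have mgD k i : measurable_fun H (fun x => (grad (phi k) \- Du) x 0 i).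
  have -> : (fun x => (grad (phi k) \- Du) x 0 i) = (fun x => partial i (phi k) x - Du x 0 i).
    by apply/funext => x; rewrite !mxE.
  apply: measurable_funB; last exact: (measurableT_comp (measurable_coord i) mDu).
  by apply: measurable_funTS; apply: continuous_measurable_fun_rV; exact: Cc_smooth_partial.
have ge0_grad k : (0 <= gradient_energy (grad (phi k) \- Du)%R)%E.
  by apply: integral_ge0 => x _; rewrite lee_fin; apply: sumr_ge0 => i _; exact: sqr_ge0.
have ge0_mom k : (0 <= second_moment (phi k \- u)%R)%E.
  apply: integral_ge0 => x _; rewrite lee_fin mulr_ge0 ?sqr_ge0//.
  by apply: sumr_ge0 => i _; exact: sqr_ge0.
have cgrad := cvg0_sqrteD ge0_grad ge0_mom cphi.
have cmom : second_moment (phi k \- u)%R @[k --> \oo] --> 0%E.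
  apply: (cvg0_sqrteD ge0_mom ge0_grad); apply: cvg_trans cphi.
  by under eq_fun do rewrite addeC.
have hDu i : L2H (fun x => Du x 0 i) /\
        ipH (fun x => partial i (phi k) x - Du x 0 i)
            (fun x => partial i (phi k) x - Du x 0 i) @[k --> \oo] --> 0.
  apply: L2_limit => //; first by move=> k; exact: Cc_smooth_L2_partial.
    exact: (measurableT_comp (measurable_coord i) mDu).
  apply: (squeeze_cvge _ (cvg_cst _) cgrad).
  apply: nearW => k; rewrite integral_ge0/=; last by move=> x _; rewrite lee_fin sqr_ge0.
  rewrite gradient_energyE// (bigD1 i)//= -[leLHS]adde0; apply: leeD.
    rewrite le_eqVlt; apply/orP; left; apply/eqP.
    by apply: eq_integral => x _; rewrite !mxE.
  by apply: sume_ge0 => j _; apply: integral_ge0 => x _; rewrite lee_fin sqr_ge0.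
have hxu j : L2H (fun x => x 0 j * u x) /\
        ipH (fun x => x 0 j * phi k x - x 0 j * u x)
            (fun x => x 0 j * phi k x - x 0 j * u x) @[k --> \oo] --> 0.
  apply: L2_limit => //; first by move=> k; exact: Cc_smooth_L2_moment.
    by apply: measurable_funM => //; apply: measurable_funTS; exact: measurable_coord.
  apply: (squeeze_cvge _ (cvg_cst _) cmom).
  apply: nearW => k; rewrite integral_ge0/=; last by move=> x _; rewrite lee_fin sqr_ge0.
  rewrite second_momentE// (bigD1 j)//= -[leLHS]adde0; apply: leeD.
    rewrite le_eqVlt; apply/orP; left; apply/eqP.
    by apply: eq_integral => x _; rewrite mulrBr.
  by apply: sume_ge0 => i _; apply: integral_ge0 => x _; rewrite lee_fin sqr_ge0.
split => //; apply: L2_limit => //; first by move=> k; exact: Cc_smooth_L2.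
pose a k := \sum_(i < n) ipH (fun x => partial i (phi k) x - Du x 0 i)
            (fun x => partial i (phi k) x - Du x 0 i).
pose b k := \sum_(j < n) ipH (fun x => x 0 j * phi k x - x 0 j * u x)
            (fun x => x 0 j * phi k x - x 0 j * u x).
pose e k := a k + b k.
have ce : e k @[k --> \oo] --> 0.
  rewrite [X in _ --> X](_ : _ = \sum_(i < n) 0 + \sum_(j < n) 0); last first.
    by rewrite !big1_eq addr0.
  by apply: cvgD; apply: cvg_sum => i; [case: (hDu i)|case: (hxu i)].
have e0 k : 0 <= e k by apply: addr_ge0; apply: sumr_ge0 => i _; exact: ip_ge0.
have Mkl k l : ipH (fun x => phi k x - phi l x) (fun x => phi k x - phi l x) <= 2 * e k + 2 * e l.
  apply: le_trans (mass_le_energy (Cc_smoothB (Cphi k) (Cphi l))) _.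
  rewrite [leRHS](_ : _ = (2 * a k + 2 * a l) + (2 * b k + 2 * b l)); last first.
    by rewrite /e !mulrDr addrACA.
  apply: lerD; apply: ler_sum2 => i.
    rewrite (_ : partial i (fun x => phi k x - phi l x) =
      fun x => partial i (phi k) x - partial i (phi l) x); last first.
      apply/funext => x; rewrite /partial deriveB//.
        by have [_ /(_ i)[]] := Cc_smooth_C1 (Cphi k).
      by have [_ /(_ i)[]] := Cc_smooth_C1 (Cphi l).
    by apply: ip_sqB_le; [exact: Cc_smooth_L2_partial|exact: Cc_smooth_L2_partial|case: (hDu i)].
  rewrite (_ : (fun x : 'rV[R]_n => x 0 i * (phi k x - phi l x)) =
    fun x => x 0 i * phi k x - x 0 i * phi l x); last by apply/funext => x; rewrite mulrBr.
  by apply: ip_sqB_le; [exact: Cc_smooth_L2_moment|exact: Cc_smooth_L2_moment|case: (hxu i)].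
(* The estimate is uniform in [N]: for fixed [N] the auxiliary index [l] is sent to infinity, and
   only then the sets [F N] increase to the half-space. *)
have bound k : (\int[mu]_(x in H) ((phi k x - u x) ^+ 2)%:E <= (4 * e k)%:E)%E.
  pose F (N : nat) := H `&` [set x : 'rV[R]_n | (N.+1%:R^-1 <= sqnorm x)%R].
  have Fle N : (\int[mu]_(x in F N) ((phi k x - u x) ^+ 2)%:E <= (4 * e k)%:E)%E.
    apply/lee_addgt0Pr => eps eps0.
    (* The total coefficient of [e l]: twice the 2 in [Mkl], plus [2 * N.+1] from the weighted
       term. *)
    pose c : R := 4 + 2 * N.+1%:R.
    have c0 : 0 < c by rewrite /c addr_gt0// mulr_gt0.
    have [l le] : exists l, c * e l <= eps.
      move/cvgr0Pnorm_le : ce => /(_ (eps / c)); rewrite divr_gt0// => /(_ isT).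
      move=> /filter_ex[l]; rewrite ger0_norm// => h; exists l.
      by rewrite mulrC -ler_pdivlMr.
    have Lx (j : 'I_n) : L2H (fun x : 'rV[R]_n => x 0 j * (phi l x - u x)).
      have [Lj _] := hxu j; have := L2B mH (Cc_smooth_L2_moment j (Cphi l)) Lj.
      by under eq_fun do rewrite -mulrBr.
    have N0 : 0 < N.+1%:R :> R by [].
    apply: le_trans (ip_restrict_le (Cc_smooth_L2 (Cphi k)) (Cc_smooth_L2 (Cphi l)) mfu Lx N0) _.
    rewrite -EFinD lee_fin.
    have h1 := Mkl k l.
    have h2 : \sum_(j < n) ipH (fun x : 'rV[R]_n => x 0 j * (phi l x - u x))
        (fun x => x 0 j * (phi l x - u x)) <= e l.
      rewrite /e -[leLHS]add0r; apply: lerD.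
        by apply: sumr_ge0 => i _; exact: ip_ge0.
      rewrite le_eqVlt; apply/orP; left; apply/eqP; apply: eq_bigr => j _.
      by congr (ipH _ _); apply/funext => x; rewrite mulrBr.
    have h3 : 2 * N.+1%:R * \sum_(j < n) ipH (fun x : 'rV[R]_n => x 0 j * (phi l x - u x))
        (fun x => x 0 j * (phi l x - u x)) <= 2 * N.+1%:R * e l.
      by rewrite ler_wpM2l// mulr_ge0.
    by move: le; rewrite /c mulrDl; lra.
  have mF N : measurable (F N).
    apply: measurableI => //.
    have ms : measurable_fun [set: 'rV[R]_n] (@sqnorm R n).
      apply: continuous_measurable_fun_rV; exact/elem_continuous/elem_sqnorm.
    rewrite -[X in measurable X]setTI.
    rewrite (_ : [set _ | _] = (@sqnorm R n) @^-1` `[N.+1%:R^-1, +oo[%classic).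
      exact: ms.
    by apply/seteqP; split => x /=; rewrite in_itv/= andbT.
  have msq : measurable_fun H (fun x => ((phi k x - u x) ^+ 2)%:E).
    by apply/measurable_EFinP; apply: measurable_funX; exact: mphiu.
  (* The origin is not in the half-space: the last coordinate alone makes [sqnorm x] positive. *)
  have HE : H = \bigcup_N F N.
    apply/seteqP; split => [x Hx|x [N _ []]//].
    have s0 : 0 < sqnorm x.
      rewrite /sqnorm (bigD1 ord_max)//= ltr_wpDr//.
        by apply: sumr_ge0 => i _; exact: sqr_ge0.
      by rewrite exprn_gt0.
    exists (Num.truncn (sqnorm x)^-1) => //; split => //=.
    rewrite invf_ple ?posrE//; exact: ltW (truncnS_gt _).
  have := @ge0_nondecreasing_set_cvg_integral _ _ R F
    (fun x => ((phi k x - u x) ^+ 2)%:E) mu.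
  rewrite -HE => cF.
  have h1 : nondecreasing_seq F.
    move=> N N' NN'; rewrite subsetEset => x [Hx /= h]; split => //=.
    by apply: le_trans h; rewrite lef_pV2 ?posrE// ler_nat.
  have h2 N : measurable_fun (F N) (fun x => ((phi k x - u x) ^+ 2)%:E).
    by apply: measurable_funS msq => //; exact: subIsetl.
  have h3 N x : F N x -> (0 <= ((phi k x - u x) ^+ 2)%:E)%E.
    by move=> _; rewrite lee_fin sqr_ge0.
  by apply: (cvge_to_le (cF h1 mF h2 h3)); apply: nearW; exact: Fle.
apply: (squeeze_cvge _ (cvg_cst _)); last first.
  apply: (@cvg_EFin _ _ _ _ (fun k => (4 * e k)%:E) 0); first exact: nearW.
  rewrite [X in _ --> X](_ : _ = 4 * 0); last by rewrite mulr0.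
  exact: cvgMl_tmp.
apply: nearW => k; rewrite integral_ge0/=; last by move=> x _; rewrite lee_fin sqr_ge0.
exact: bound.
Qed.

End completion.

(** * Gaussian profiles belong to S *)

Section gaussian_integrability.
Context (R : realType).

Lemma integral_gauss1_lty (c : R) : 0 < c ->
  (\int[@lebesgue_measure R]_t (expR (- (c * t ^+ 2)))%:E < +oo)%E.
Proof.
(* The standard deviation with [1 / (2 s^2) = c], so that the integrand is a multiple of a normal
   density, of total mass 1. *)
move=> c0; pose s := Num.sqrt (2 * c)^-1.
have s2 : s ^+ 2 = (2 * c)^-1 by rewrite sqr_sqrtr// invr_ge0 mulr_ge0// ltW.
have s0 : s != 0 by rewrite gt_eqF// sqrtr_gt0 invr_gt0 mulr_gt0.
have p0 : 0 < normal_peak s by exact: normal_peak_gt0.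
have := integral_normal_pdf 0 s.
have -> : (fun x => (normal_pdf 0 s x)%:E) =
    (fun x => (normal_peak s)%:E * (expR (- (c * x ^+ 2)))%:E)%E.
  apply/funext => x; rewrite -EFinM /normal_pdf (negbTE s0).
  rewrite -[LHS]/((normal_peak s * normal_fun 0 s x)%:E) /normal_fun subr0 s2.
  by congr (_ * expR _)%:E; field; rewrite gt_eqF.
have mg : measurable_fun [set: R] (fun x : R => (expR (- (c * x ^+ 2)))%:E).
  apply/measurable_EFinP; apply: measurableT_comp => //.
  by apply: measurableT_comp => //; exact: measurable_funM.
rewrite ge0_integralZl//; last by rewrite lee_fin ltW.
set I := (\int[_]_(_ in _) _)%E.
by case: I => //= [r|]; [rewrite ltry|rewrite gt0_muley// lte_fin].
Qed.

Lemma integral_gauss_lty n (c : R) : 0 < c ->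
  (\int[lebesgue_rV R n]_x (expR (- (c * sqnorm x)))%:E < +oo)%E.
Proof.
move=> c0; have mg k : measurable_fun [set: 'rV[R]_k] (fun x => expR (- (c * sqnorm x))).
  have -> : (fun x : 'rV[R]_k => expR (- (c * sqnorm x))) =
      fun x => expR (- (c * \sum_(i < k) x 0 i * x 0 i)).
    by apply/funext => x; rewrite /sqnorm; do 3 congr (_ _); apply: eq_bigr => i _; rewrite expr2.
  apply: measurableT_comp => //; apply: measurableT_comp => //.
  apply: measurable_funM => //; apply: measurable_sum => i.
  by apply: measurable_funM; exact: measurable_coord.
elim: n => [|n IHn].
  rewrite integral_dirac//; first by rewrite diracE in_setT mul1e ltry.
  by apply/measurable_EFinP; exact: mg.
rewrite integral_snoc; last 2 first.
- by apply/measurable_EFinP; exact: mg.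
- by move=> x; rewrite lee_fin expR_ge0.
have sE (x : 'rV[R]_n) t : sqnorm (snoc_rV (x, t)) = sqnorm x + t ^+ 2.
  rewrite /sqnorm big_ord_recr/=; congr (_ + _).
    apply: eq_bigr => i _; rewrite mxE.
    rewrite (_ : widen_ord _ i = lift ord_max i) ?liftK//.
    by apply: val_inj; rewrite /= /bump leqNgt ltn_ord.
  by rewrite mxE unlift_none.
have [K KE] : exists K : R, (\int[@lebesgue_measure R]_t (expR (- (c * t ^+ 2)))%:E = K%:E)%E.
  have h := integral_gauss1_lty c0.
  exists (fine (\int[@lebesgue_measure R]_t (expR (- (c * t ^+ 2)))%:E)%E).
  by rewrite fineK// ge0_fin_numE//; apply: integral_ge0 => t _; rewrite lee_fin expR_ge0.
have K0 : (0 <= K%:E)%E by rewrite -KE; apply: integral_ge0 => t _; rewrite lee_fin expR_ge0.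
have -> : (fun x : 'rV[R]_n => \int[lebesgue_measure]_t
     (expR (- (c * sqnorm (snoc_rV (x, t)))))%:E)%E =
    (fun x => (expR (- (c * sqnorm x)))%:E * K%:E)%E.
  apply/funext => x; rewrite -KE -ge0_integralZl//.
  - by apply: eq_integral => t _; rewrite sE mulrDr opprD expRD EFinM.
  - apply/measurable_EFinP; apply: measurableT_comp => //.
    by apply: measurableT_comp => //; exact: measurable_funM.
have mgn : measurable_fun [set: 'rV[R]_n] (fun x => (expR (- (c * sqnorm x)))%:E).
  by apply/measurable_EFinP; exact: mg.
rewrite ge0_integralZr// muleC lte_mul_pinfty//.
Qed.

Section half.
Context (m : nat).
Local Notation n := (m.+1).
Local Notation H := (@half_space R m).
Local Notation mu := (lebesgue_rV R m.+1).
Implicit Types f : 'rV[R]_n -> R.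

Lemma integrable_gauss (C c : R) : 0 < c ->
  mu.-integrable H (fun x => (C * gauss c x)%:E).
Proof.
move=> c0; apply: (@integrableS _ _ _ mu setT) => //; first exact: measurable_half_space.
have mg : measurable_fun setT (gauss c : 'rV[R]_n -> R).
  by apply: continuous_measurable_fun_rV; exact/elem_continuous/elem_gauss.
have ig : mu.-integrable setT (fun x : 'rV[R]_n => (gauss c x)%:E); last first.
  exact: (integrableZl measurableT C ig).
apply/integrableP; split; first exact/measurable_EFinP.
under eq_integral do rewrite /= ger0_norm ?expR_ge0//.
exact: integral_gauss_lty.
Qed.

Lemma gauss_dominated_cvg0 (f : nat -> 'rV[R]_n -> R) (C c : R) : 0 < c ->
  (forall k, measurable_fun H (f k)) ->
  (forall k x, H x -> f k x ^+ 2 <= C * gauss c x) ->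
  (forall x, H x -> f k x @[k --> \oo] --> 0) ->
  (\int[mu]_(x in H) (f k x ^+ 2)%:E)%E @[k --> \oo] --> 0%E.
Proof.
move=> c0 mf fC f0; rewrite -(integral0 mu H).
apply: (@dominated_cvg _ _ _ mu H (@measurable_half_space R m) _ _
  (fun x => (C * gauss c x)%:E)) => //.
- by move=> k; apply/measurable_EFinP; exact: measurable_funX.
- move=> x Hx; apply: (@cvg_EFin _ _ _ _ (fun k => (f k x ^+ 2)%:E) 0).
    exact: nearW.
  rewrite [X in _ --> X](_ : _ = 0 * 0); last by rewrite mulr0.
  by apply: cvgM; exact: f0.
- exact: integrable_gauss.
- by move=> k x Hx; rewrite /= lee_fin ger0_norm ?sqr_ge0//; exact: fC.
Qed.

End half.
End gaussian_integrability.

(** * Limits of the cutoff profile at infinity *)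

Section flat_limits.
Context (R : realType).

Lemma flatS k (t : R) : t * flat k.+1 t = flat k t.
Proof.
rewrite /flat; case: ifPn => [t0|]; last by rewrite mulr0.
by rewrite exprS mulrA mulrA mulfV ?gt_eqF// mul1r.
Qed.

Lemma flat_le k (t : R) : flat k t <= k`!%:R.
Proof. by have := flat_bound k 0 t; rewrite addn0 expr0 mulr1. Qed.

Lemma flatS_le k (t : R) : 0 < t -> flat k.+1 t <= k`!%:R * t^-1.
Proof.
by move=> t0; rewrite ler_pdivlMr// mulrC flatS flat_le.
Qed.

Lemma flat0_ge (t : R) : 0 < t -> 1 - t^-1 <= flat 0 t.
Proof.
by move=> t0; rewrite /flat t0 expr0 mul1r; exact: expR_ge1Dx.
Qed.

Lemma flat0_le1 (t : R) : flat 0 t <= 1.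
Proof. by have := flat_le 0 t; rewrite fact0. Qed.

Lemma cvg_affine_inv (p q : R) : 0 < p ->
  (\forall k \near \oo, 0 < p * k.+1%:R - q) /\
  (p * k.+1%:R - q)^-1 @[k --> \oo] --> 0.
Proof.
move=> p0; have pos : \forall k \near \oo, 0 < p * k.+1%:R - q.
  near=> k; rewrite subr_gt0 -ltr_pdivrMl//.
  apply: (@le_lt_trans _ _ k%:R); last by rewrite ltr_nat.
  by near: k; exact: nbhs_infty_ger.
split=> //; apply/gtr0_cvgV0 => //; apply/cvgryPge => M.
near=> k; rewrite lerBrDr -ler_pdivrMl//.
apply: (@le_trans _ _ k%:R); last by rewrite ler_nat.
by near: k; exact: nbhs_infty_ger.
Unshelve. all: by end_near. Qed.

Lemma cvg_flat0 (t : nat -> R) : (\forall k \near \oo, 0 < t k) ->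
  (t k)^-1 @[k --> \oo] --> 0 -> flat 0 (t k) @[k --> \oo] --> (1 : R).
Proof.
move=> t0 ct; apply: (@squeeze_cvgr _ _ _ _ (fun k => 1 - (t k)^-1) (fun=> 1)).
- apply: filterS t0 => k tk; rewrite flat0_ge//= flat0_le1//.
- rewrite [X in _ --> X](_ : _ = 1 - 0); last by rewrite subr0.
  by apply: cvgB => //; exact: cvg_cst.
- exact: cvg_cst.
Qed.

Lemma cvg_flatS j (t : nat -> R) : (\forall k \near \oo, 0 < t k) ->
  (t k)^-1 @[k --> \oo] --> 0 -> flat j.+1 (t k) @[k --> \oo] --> 0.
Proof.
move=> t0 ct.
apply: (@squeeze_cvgr _ _ _ _ (fun=> 0) (fun k => j`!%:R * (t k)^-1)).
- by apply: filterS t0 => k tk; rewrite flat_ge0/= flatS_le.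
- exact: cvg_cst.
- rewrite [X in _ --> X](_ : _ = j`!%:R * 0); last by rewrite mulr0.
  exact: cvgMl_tmp.
Qed.

End flat_limits.

(** * Cutoffs of the Gaussian profiles *)

Section gaussian_in_S.
Context (R : realType) (m : nat) (a b : R).
Hypothesis b0 : 0 < b.
Local Notation n := (m.+1).
Local Notation H := (@half_space R m).
Local Notation mu := (lebesgue_rV R m.+1).
Local Notation W := (@gaussian_profile R m a b).

Lemma sqr_coord_le_exp (c : R) (x : 'rV[R]_n) i : 0 < c ->
  x 0 i ^+ 2 <= c^-1 * expR (c * sqnorm x).
Proof.
move=> c0; rewrite ler_pdivlMl//.
apply: (@le_trans _ _ (c * sqnorm x)).
  rewrite ler_pM2l// /sqnorm (bigD1 i)//= lerDl.
  by apply: sumr_ge0 => j _; exact: sqr_ge0.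
by apply: le_trans (expR_ge1Dx _); rewrite lerDr.
Qed.

Lemma sqnorm_ge0 k (x : 'rV[R]_k) : 0 <= sqnorm x.
Proof. by apply: sumr_ge0 => i _; exact: sqr_ge0. Qed.

(** Squaring produces two Gaussian factors: one absorbs the polynomial, and the other remains as an
    integrable majorant. *)
Lemma gauss_poly_bound (A B y : R) (x : 'rV[R]_n) i j :
  `|y| <= (A + B * `|x 0 i * x 0 j|) * gauss b x ->
  y ^+ 2 <= (2 * A ^+ 2 + 8 * B ^+ 2 / b ^+ 2) * gauss b x.
Proof.
move=> yle; set q := x 0 i * x 0 j in yle *.
have E0 : 0 < gauss b x by exact: expR_gt0.
have h1 : y ^+ 2 <= (A + B * `|q|) ^+ 2 * gauss b x ^+ 2.
  rewrite -exprMn -(real_normK (num_real y)) ler_sqr ?nnegrE//.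
  exact: le_trans yle.
have h2 : (A + B * `|q|) ^+ 2 <= 2 * A ^+ 2 + 2 * B ^+ 2 * q ^+ 2.
  by rewrite -(real_normK (num_real q)); have := sqr_ge0 (A - B * `|q|); nra.
have h3 : q ^+ 2 <= 4 / b ^+ 2 * expR (b * sqnorm x).
  have b2 : 0 < b / 2 by rewrite divr_gt0.
  have -> : 4 / b ^+ 2 * expR (b * sqnorm x) = ((b / 2)^-1 * expR (b / 2 * sqnorm x)) *
      ((b / 2)^-1 * expR (b / 2 * sqnorm x)).
    rewrite mulrACA -expRD -mulrDl -splitr; congr (_ * _); field.
    by rewrite gt_eqF.
  by rewrite exprMn; apply: ler_pM; rewrite ?sqr_ge0// sqr_coord_le_exp.
have h4 : gauss b x ^+ 2 <= gauss b x.
  rewrite expr2 -[leRHS]mulr1 ler_wpM2l ?(ltW E0)// /gauss -[leRHS]expR0 ler_expR oppr_le0.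
  by rewrite mulr_ge0 ?(ltW b0)// sqnorm_ge0.
have h5 : expR (b * sqnorm x) * gauss b x ^+ 2 = gauss b x.
  by rewrite /gauss expr2 mulrA -!expRD; congr expR; ring.
apply: (le_trans h1).
apply: (@le_trans _ _ ((2 * A ^+ 2 + 2 * B ^+ 2 * (4 / b ^+ 2 * expR (b * sqnorm x))) *
    gauss b x ^+ 2)).
  rewrite ler_wpM2r ?sqr_ge0//; apply: le_trans h2 _.
  by rewrite lerD2l ler_wpM2l// mulr_ge0// sqr_ge0.
have -> : (2 * A ^+ 2 + 2 * B ^+ 2 * (4 / b ^+ 2 * expR (b * sqnorm x))) * gauss b x ^+ 2 =
    2 * A ^+ 2 * gauss b x ^+ 2 + 8 * B ^+ 2 / b ^+ 2 * (expR (b * sqnorm x) * gauss b x ^+ 2).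
  by field; rewrite gt_eqF.
by rewrite h5 [leRHS]mulrDl lerD2r ler_wpM2l// mulr_ge0// sqr_ge0.
Qed.

(** A cutoff without plateau: as [flat 0 t] tends to 1 when [t] grows, it tends to 1 at each point
    of the half-space. It vanishes unless [x_n > 1 / (k + 1)] and [|x|^2 < k + 1]. *)
Definition cutoff (k : nat) (x : 'rV[R]_n) : R :=
  flat 0 (k.+1%:R * last_coord x - 1) * flat 0 (k.+1%:R - sqnorm x).

Lemma elem_cutoff k : elem (cutoff k).
Proof.
apply: elemM; apply: elem_flat; apply: elemD.
- by apply: elemM; [exact: elem_cst|exact: elem_coord].
- exact: elem_cst.
- exact: elem_cst.
- under eq_fun do rewrite -mulN1r.
  by apply: elemM; [exact: elem_cst|exact: elem_sqnorm].
Qed.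

Lemma cutoff_ge0 k x : 0 <= cutoff k x.
Proof. by rewrite mulr_ge0// flat_ge0. Qed.

Lemma cutoff_le1 k x : cutoff k x <= 1.
Proof. by rewrite mulr_ile1 ?flat_ge0 ?flat0_le1. Qed.

Lemma Cc_smooth_cutoff k : Cc_smooth (fun x => W x * cutoff k x).
Proof.
pose K := [set x : 'rV[R]_n | k.+1%:R^-1 <= last_coord x] `&` [set x | sqnorm x <= k.+1%:R].
have cK : closed K.
  apply: closedI.
    rewrite (_ : [set _ | _] = @last_coord R m @^-1` [set y | k.+1%:R^-1 <= y])//.
    by apply: closed_comp => [y _|]; [exact: continuous_last_coord|exact: closed_ge].
  rewrite (_ : [set _ | _] = @sqnorm R n @^-1` [set y | y <= k.+1%:R])//.
  apply: closed_comp => [y _|]; last exact: closed_le.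
  exact/elem_continuous/elem_sqnorm.
have sK : closure [set x | W x * cutoff k x != 0] `<=` K.
  rewrite ((closure_id _).1 cK); apply: closure_subset => x /=.
  rewrite !mulf_eq0 !negb_or => /andP[_ /andP[]].
  rewrite /flat; case: ifPn => [s0 _|]; last by rewrite eqxx.
  case: ifPn => [r0 _|]; last by rewrite eqxx.
  split => /=; last by rewrite ltW// -subr_gt0.
  by rewrite -[leLHS]mulr1 ler_pdivrMl// ltW// -subr_gt0.
split.
- apply: elem_smooth; apply: elemM; [exact: elem_gaussian_profile|exact: elem_cutoff].
- apply: bounded_closed_compact; last exact: closed_closure.
  exists k.+1%:R; split; first exact: num_real.
  move=> M kM x /sK[_ /= xk].
  have k1 : 1 <= k.+1%:R :> R by rewrite ler1n.
  apply: (@le_trans _ _ k.+1%:R); last exact: ltW.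
  rewrite [leLHS]/Num.norm/= mx_normrE; apply: bigmax_le => // -[i j] _ /=.
  rewrite (ord1 i); have h : x 0 j ^+ 2 <= k.+1%:R.
    apply: le_trans xk; rewrite /sqnorm (bigD1 j)//= lerDl.
    by apply: sumr_ge0 => l _; exact: sqr_ge0.
  rewrite -(ler_sqr (normr_ge0 _)) ?nnegrE// real_normK ?num_real//.
  by apply: le_trans h _; rewrite expr2 ler_peMl.
move=> x /sK[/= xk _]; rewrite /half_space/=.
by apply: lt_le_trans xk; rewrite invr_gt0.
Qed.

(** Differentiating the first factor of the cutoff produces a dangerous [k + 1], but [W] brings a
    factor [x_n]. With [s = (k + 1) x_n - 1] their product is [s + 1], and
    [(s + 1) flat 2 s = flat 1 s + flat 2 s] is bounded in [k] and tends to 0. *)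
Lemma partial_cutoff k i x :
  partial i (fun x => W x * cutoff k x) x - partial i W x =
  a * gauss b x * (
    ((i == ord_max)%:R - 2 * b * (x 0 i * last_coord x)) * (cutoff k x - 1) +
    (i == ord_max)%:R * (flat 1 (k.+1%:R * last_coord x - 1) +
        flat 2 (k.+1%:R * last_coord x - 1)) * flat 0 (k.+1%:R - sqnorm x) -
    2 * (x 0 i * last_coord x) * flat 0 (k.+1%:R * last_coord x - 1) *
      flat 2 (k.+1%:R - sqnorm x)).
Proof.
set s := k.+1%:R * last_coord x - 1; set r := k.+1%:R - sqnorm x.
have ds : is_derive x (delta_mx 0 i) (fun x => k.+1%:R * last_coord x - 1)
    (k.+1%:R * (i == ord_max)%:R - 0).
  exact: (is_deriveB (is_deriveZ k.+1%:R (is_derive_last i x))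
    (is_derive_cst (1 : R) x (delta_mx 0 i))).
have dr : is_derive x (delta_mx 0 i) (fun x : 'rV[R]_n => k.+1%:R - sqnorm x)
    (0 - 2 * x 0 i).
  exact: (is_deriveB (is_derive_cst (k.+1%:R : R) x (delta_mx 0 i))
    (is_derive_sqnorm i x)).
have dc := is_deriveM (is_derive_chain ds (is_derive_flat 0 s))
  (is_derive_chain dr (is_derive_flat 0 r)).
have sW := elem_smooth (@elem_gaussian_profile R m a b).
have [_ /(_ i)[dW _]] := smooth_C1 sW.
have dWc := is_deriveM (derivableP (dW x)) dc.
transitivity (W x * (flat 0 s * ((flat 2 r - 0%:R * flat 1 r) * (0 - 2 * x 0 i)) +
    flat 0 r * ((flat 2 s - 0%:R * flat 1 s) * (k.+1%:R * (i == ord_max)%:R - 0))) +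
  flat 0 s * flat 0 r * partial i W x - partial i W x).
  by congr (_ - _); exact: (partialE dWc).
rewrite partial_gaussian_profile /cutoff -/s -/r.
have -> : flat 1 s = s * flat 2 s by rewrite flatS.
rewrite /gaussian_profile -/(gauss b x).
move: (flat 0 s) (flat 2 s) (flat 0 r) (flat 2 r) (flat 1 r) => f0s f2s f0r f2r f1r.
by rewrite /s; ring.
Qed.

Lemma cutoff_cvg x : H x ->
  [/\ cutoff k x @[k --> \oo] --> (1 : R),
      flat 1 (k.+1%:R * last_coord x - 1) + flat 2 (k.+1%:R * last_coord x - 1)
        @[k --> \oo] --> (0 : R) &
      flat 2 (k.+1%:R - sqnorm x) @[k --> \oo] --> (0 : R)].
Proof.
move=> Hx; have [s0 sc] := cvg_affine_inv 1 (Hx : 0 < last_coord x).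
have [r0 rc] := cvg_affine_inv (sqnorm x) (ltr01 : 0 < 1 :> R).
have sE : (fun k : nat => last_coord x * k.+1%:R - 1) = (fun k => k.+1%:R * last_coord x - 1).
  by apply/funext => k; rewrite mulrC.
have rE : (fun k : nat => 1 * k.+1%:R - sqnorm x) = (fun k => k.+1%:R - sqnorm x).
  by apply/funext => k; rewrite mul1r.
have s0' : \forall k \near \oo, 0 < k.+1%:R * last_coord x - 1.
  by apply: filterS s0 => k; rewrite mulrC.
have r0' : \forall k \near \oo, 0 < k.+1%:R - sqnorm x.
  by apply: filterS r0 => k; rewrite mul1r.
have sc' : (k.+1%:R * last_coord x - 1)^-1 @[k --> \oo] --> 0.
  by move: sc; under eq_fun do rewrite mulrC.
have rc' : (k.+1%:R - sqnorm x)^-1 @[k --> \oo] --> 0.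
  by move: rc; under eq_fun do rewrite mul1r.
split.
- rewrite -[X in _ --> X](mulr1 1); apply: cvgM; exact: cvg_flat0.
- rewrite -[X in _ --> X](addr0 0); apply: cvgD; exact: cvg_flatS.
- exact: cvg_flatS.
Qed.

(** The bracket of [partial_cutoff], with [q = x_i x_n], [d] the Kronecker symbol, [c] the cutoff,
    and [s], [r] marking the two arguments of [flat]. The upper bounds 1, 1, 2 for [flat 0],
    [flat 1], [flat 2] are the factorials of [flat_le]. *)
Lemma cutoff_bound (q d c f1s f2s f0s f2r f0r : R) :
  0 <= d -> d <= 1 -> 0 <= c -> c <= 1 -> 0 <= f1s -> f1s <= 1 ->
  0 <= f2s -> f2s <= 2 -> 0 <= f0s -> f0s <= 1 -> 0 <= f2r -> f2r <= 2 ->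
  0 <= f0r -> f0r <= 1 ->
  `|(d - 2 * b * q) * (c - 1) + d * (f1s + f2s) * f0r - 2 * q * f0s * f2r| <=
  4 + (2 * b + 4) * `|q|.
Proof.
move=> d0 d1 c0 c1 p0 p1 r0 r1 s0 s1 t0 t1 v0 v1.
have q0 := normr_ge0 q.
have hA : `|(d - 2 * b * q) * (c - 1)| <= 1 + 2 * b * `|q|.
  rewrite normrM -[leRHS]mulr1; apply: ler_pM => //; last first.
    by rewrite ler_norml; apply/andP; split; lra.
  apply: le_trans (ler_normB _ _) _; rewrite (ger0_norm d0) normrM.
  by rewrite (ger0_norm (_ : 0 <= 2 * b)) ?lerD2r// mulr_ge0// ltW.
have hB : `|d * (f1s + f2s) * f0r| <= 3.
  have h0 : 0 <= d * (f1s + f2s) by rewrite mulr_ge0// addr_ge0.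
  have h1 : d * (f1s + f2s) <= f1s + f2s by rewrite ler_piMl// addr_ge0.
  rewrite ger0_norm ?mulr_ge0// ?addr_ge0//.
  have h2 : d * (f1s + f2s) * f0r <= d * (f1s + f2s) by rewrite ler_piMr.
  by lra.
have hC : `|2 * q * f0s * f2r| <= 4 * `|q|.
  rewrite !normrM (ger0_norm s0) (ger0_norm t0) ger0_norm//.
  have h1 : `|q| * f0s <= `|q| by rewrite ler_piMr.
  have h2 : `|q| * f0s * f2r <= `|q| * 2 by apply: ler_pM => //; rewrite mulr_ge0.
  by nra.
apply: le_trans (ler_normB _ _) _.
apply: (@le_trans _ _ ((1 + 2 * b * `|q| + 3) + 4 * `|q|)).
  apply: lerD => //; apply: le_trans (ler_normD _ _) _; exact: lerD.
by rewrite mulrDl; lra.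
Qed.

Lemma cvg0_partial_cutoff i :
  (\int[mu]_(x in H) ((partial i (fun x => W x * cutoff k x) x - partial i W x) ^+ 2)%:E)%E
    @[k --> \oo] --> 0%E.
Proof.
have sW := elem_smooth (@elem_gaussian_profile R m a b).
apply: (gauss_dominated_cvg0 (C := 2 * (`|a| * 4) ^+ 2 + 8 * (`|a| * (2 * b + 4)) ^+ 2 / b ^+ 2)
  b0).
- move=> k; apply: measurable_funTS; apply: measurable_funB;
    apply: continuous_measurable_fun_rV.
    exact: Cc_smooth_partial (Cc_smooth_cutoff k).
  by have [_ /(_ i)[_]] := smooth_C1 sW.
- move=> k x _; apply: (@gauss_poly_bound _ _ _ x i ord_max).
  have E0 : 0 < gauss b x by exact: expR_gt0.
  rewrite partial_cutoff normrM normrM (gtr0_norm E0).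
  rewrite [leRHS](_ : _ = `|a| * gauss b x *
    (4 + (2 * b + 4) * `|x 0 i * last_coord x|)); last by rewrite /last_coord; ring.
  rewrite ler_wpM2l ?mulr_ge0 ?(ltW E0)//.
  apply: cutoff_bound => //; rewrite ?flat_ge0 ?flat0_le1 ?cutoff_ge0 ?cutoff_le1//.
  - by case: (i == _); rewrite ?lexx ?ler01.
  - by have := flat_le 1 (k.+1%:R * last_coord x - 1).
  - by have := flat_le 2 (k.+1%:R * last_coord x - 1).
  - by have := flat_le 2 (k.+1%:R - sqnorm x).
move=> x Hx; have [c1 c2 c3] := cutoff_cvg Hx.
rewrite (_ : (fun k => _) = fun k => a * gauss b x * (
    ((i == ord_max)%:R - 2 * b * (x 0 i * last_coord x)) * (cutoff k x - 1) +
    (i == ord_max)%:R * (flat 1 (k.+1%:R * last_coord x - 1) +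
        flat 2 (k.+1%:R * last_coord x - 1)) * flat 0 (k.+1%:R - sqnorm x) -
    2 * (x 0 i * last_coord x) * flat 0 (k.+1%:R * last_coord x - 1) *
      flat 2 (k.+1%:R - sqnorm x))); last by apply/funext => k; exact: partial_cutoff.
rewrite [X in _ --> X](_ : _ = a * gauss b x * (
    ((i == ord_max)%:R - 2 * b * (x 0 i * last_coord x)) * (1 - 1) +
    (i == ord_max)%:R * 0 * 1 - 2 * (x 0 i * last_coord x) * 1 * 0)); last by ring.
have [r0 rc] := cvg_affine_inv (sqnorm x) (ltr01 : 0 < 1 :> R).
have c4 : flat 0 (k.+1%:R - sqnorm x) @[k --> \oo] --> (1 : R).
  apply: cvg_flat0; first by apply: filterS r0 => k; rewrite mul1r.
  by move: rc; under eq_fun do rewrite mul1r.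
have [s0 sc] := cvg_affine_inv 1 (Hx : 0 < last_coord x).
have c5 : flat 0 (k.+1%:R * last_coord x - 1) @[k --> \oo] --> (1 : R).
  apply: cvg_flat0; first by apply: filterS s0 => k; rewrite mulrC.
  by move: sc; under eq_fun do rewrite mulrC.
apply: cvgMl_tmp; apply: cvgB; last by apply: cvgM => //; exact: cvgMl_tmp.
apply: cvgD; last by apply: cvgM => //; exact: cvgMl_tmp.
by apply: cvgMl_tmp; apply: cvgB => //; exact: cvg_cst.
Qed.

Lemma cvg0_moment_cutoff j :
  (\int[mu]_(x in H) ((x 0 j * (W x * cutoff k x - W x)) ^+ 2)%:E)%E
    @[k --> \oo] --> 0%E.
Proof.
have sW := elem_smooth (@elem_gaussian_profile R m a b).
apply: (gauss_dominated_cvg0 (C := 2 * 0 ^+ 2 + 8 * `|a| ^+ 2 / b ^+ 2) b0).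
- move=> k; apply: measurable_funTS; apply: measurable_funM; first exact: measurable_coord.
  apply: measurable_funB; apply: continuous_measurable_fun_rV.
    exact: Cc_smooth_continuous (Cc_smooth_cutoff k).
  by have [] := smooth_C1 sW.
- move=> k x _; apply: (@gauss_poly_bound _ _ _ x j ord_max).
  have E0 : 0 < gauss b x by exact: expR_gt0.
  rewrite (_ : x 0 j * _ = a * (x 0 j * x 0 ord_max) * gauss b x * (cutoff k x - 1)); last first.
    by rewrite /gaussian_profile -/(gauss b x) /last_coord; ring.
  rewrite normrM normrM normrM (gtr0_norm E0) add0r ler_piMr ?mulr_ge0 ?(ltW E0)//.
  by have := cutoff_ge0 k x; have := cutoff_le1 k x; rewrite ler_norml; lra.
move=> x Hx; have [c1 _ _] := cutoff_cvg Hx.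
rewrite [X in _ --> X](_ : _ = x 0 j * (W x * 1 - W x)); last by ring.
apply: cvgMl_tmp; apply: cvgB; last exact: cvg_cst.
exact: cvgMl_tmp.
Qed.

Lemma cvg_sqrte0 (f : nat -> \bar R) : (forall k, 0 <= f k)%E ->
  f k @[k --> \oo] --> 0%E -> sqrte (f k) @[k --> \oo] --> 0%E.
Proof.
move=> f0 /fine_cvgP[ffin cf]; apply/fine_cvgP; split.
  by apply: filterS ffin => k fk; rewrite sqrte_fin_num.
have : Num.sqrt (fine (f k)) @[k --> \oo] --> Num.sqrt (0 : R).
  by apply: cvg_comp cf _; exact: sqrt_continuous.
rewrite sqrtr0; apply: cvg_trans; apply: near_eq_cvg.
by apply: filterS ffin => k /=; case: (f k).
Qed.

Lemma cvge_sum0 (I : Type) (s : seq I) (f : I -> nat -> \bar R) :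
  (forall i, f i k @[k --> \oo] --> 0%E) ->
  (\sum_(i <- s) f i k)%E @[k --> \oo] --> 0%E.
Proof.
move=> f0; elim: s => [|i s IHs].
  by under eq_fun do rewrite big_nil; exact: cvg_cst.
have h : (f i k + \sum_(j <- s) f j k)%E @[k --> \oo] --> (0 + 0)%E by apply: cvgeD.
by under eq_fun do rewrite big_cons; rewrite adde0 in h.
Qed.

Lemma gaussian_in_S : in_S W (grad W).
Proof.
have sW := elem_smooth (@elem_gaussian_profile R m a b).
have cW i : continuous (partial i W) by have [_ /(_ i)[_]] := smooth_C1 sW.
have mW : measurable_fun H W.
  apply: measurable_funTS; apply: continuous_measurable_fun_rV.
  by have [] := smooth_C1 sW.
split => //.
  apply: measurable_funTS; apply: measurable_fun_coordP => i.
  by under eq_fun do rewrite mxE; exact: continuous_measurable_fun_rV.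
exists (fun k x => W x * cutoff k x); split; first exact: Cc_smooth_cutoff.
rewrite /S_norm -[X in _ --> X](adde0 (0 : \bar R)%E).
have mphi k : measurable_fun H (fun x => W x * cutoff k x).
  apply: measurable_funTS; apply: continuous_measurable_fun_rV.
  exact: Cc_smooth_continuous (Cc_smooth_cutoff k).
have mgr k i : measurable_fun H (fun x => partial i (fun x => W x * cutoff k x) x - partial i W x).
  apply: measurable_funTS; apply: measurable_funB; apply: continuous_measurable_fun_rV => //.
  exact: Cc_smooth_partial (Cc_smooth_cutoff k).
have gE k i : (fun x => (grad (fun x => W x * cutoff k x) \- grad W) x 0 i) =
    (fun x => partial i (fun x => W x * cutoff k x) x - partial i W x).
  by apply/funext => x; rewrite !mxE.
apply: cvgeD => //.
  apply: cvg_sqrte0.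
    move=> k; apply: integral_ge0 => x _; rewrite lee_fin; exact: sqnorm_ge0.
  apply: cvg_trans (cvge_sum0 (index_enum 'I_n) cvg0_partial_cutoff).
  apply: near_eq_cvg; near=> k; rewrite gradient_energyE.
    by apply: eq_bigr => i _; apply: eq_integral => x _; rewrite !mxE.
  by move=> i; rewrite gE.
apply: cvg_sqrte0.
  move=> k; apply: integral_ge0 => x _; rewrite lee_fin mulr_ge0 ?sqr_ge0//.
  exact: sqnorm_ge0.
apply: cvg_trans (cvge_sum0 (index_enum 'I_n) cvg0_moment_cutoff).
apply: near_eq_cvg; near=> k; rewrite second_momentE//.
exact: measurable_funB.
Unshelve. all: by end_near. Qed.

End gaussian_in_S.

(** * The inequality *)

Section consequences.
Context (R : realType) (m : nat).
Local Notation n := (m.+1).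
Local Notation H := (@half_space R m).
Local Notation mu := (lebesgue_rV R m.+1).
Local Notation ipH := (@ip _ _ R mu H).
Local Notation L2H := (@L2 _ _ R mu H).
Implicit Types (u phi : 'rV[R]_n -> R) (Du : 'rV[R]_n -> 'rV[R]_n).
Let mH : measurable H := @measurable_half_space R m.

Definition comp Du : 'I_n -> 'rV[R]_n -> R := fun i x => Du x 0 i.

(** Moves the theorem from the extended reals to the reals, where the quadratic arguments are
    carried out. *)
Lemma in_S_finite u Du : in_S u Du ->
  [/\ gradient_energy Du = (energy (comp Du))%:E,
      second_moment u = (moment u)%:E & mass u = (ipH u u)%:E].
Proof.
move=> uS; have [mfu mDu _] := uS.
have [phi [_ hD hx [Lu _]]] := in_S_approx uS; split.
- rewrite gradient_energyE => [|i].
    rewrite /energy -sumEFin; apply: eq_bigr => i _.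
    by have [Li _] := hD i; rewrite -(ipE mH Li).
  by have [[]] := hD i.
- rewrite second_momentE// /moment /energy -sumEFin; apply: eq_bigr => j _.
  by have [Lj _] := hx j; rewrite -(ipE mH Lj).
- by rewrite massE -(ipE mH Lu).
Qed.

(* For phi in Cc this is the integral of w^2 |grad (phi / w)|^2, where
   w = gaussian_profile 1 b (lemma energy_identity). *)
Definition deficit (b : R) u (v : 'I_n -> 'rV[R]_n -> R) : R :=
  energy v + 4 * b ^+ 2 * moment u - 2 * b * (n%:R + 2) * ipH u u.

Lemma deficit_cvg (phi : nat -> 'rV[R]_n -> R) b u Du :
  (forall k, Cc_smooth (phi k)) ->
  (forall i, L2H (comp Du i) /\ ipH (fun x => partial i (phi k) x - Du x 0 i)
            (fun x => partial i (phi k) x - Du x 0 i) @[k --> \oo] --> 0) ->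
  (forall j, L2H (fun x => x 0 j * u x) /\
        ipH (fun x => x 0 j * phi k x - x 0 j * u x)
            (fun x => x 0 j * phi k x - x 0 j * u x) @[k --> \oo] --> 0) ->
  L2H u /\ ipH (fun x => phi k x - u x) (fun x => phi k x - u x) @[k --> \oo] --> 0 ->
  deficit b (phi k) (fun i => partial i (phi k)) @[k --> \oo] --> deficit b u (comp Du).
Proof.
move=> Cphi hD hx [Lu hu]; apply: cvgB.
  apply: cvgD.
    apply: cvg_sum => i; have [Li ci] := hD i.
    by apply: (ip_cvg mH _ Li ci) => k; exact: Cc_smooth_L2_partial.
  apply: cvgMl_tmp; apply: cvg_sum => j; have [Lj cj] := hx j.
  by apply: (ip_cvg mH _ Lj cj) => k; exact: Cc_smooth_L2_moment.
by apply: cvgMl_tmp; apply: (ip_cvg mH _ Lu hu) => k; exact: Cc_smooth_L2.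
Qed.

(** Valid for either sign of [b], which is what the discriminant argument uses. *)
Lemma deficit_ge0 b u Du : in_S u Du -> 0 <= deficit b u (comp Du).
Proof.
move=> uS; have [phi [Cphi hD hx hu]] := in_S_approx uS.
have c := deficit_cvg (b := b) Cphi hD hx hu; apply: (cvgr_to_ge c).
by apply: nearW => k; rewrite /deficit energy_identity//; exact: energy_ge0.
Qed.

Lemma uncertainty u Du : in_S u Du ->
  (n%:R + 2) ^+ 2 / 4 * ipH u u ^+ 2 <= energy (comp Du) * moment u.
Proof.
move=> uS; rewrite (_ : _ * _ = ((n%:R + 2) / 2 * ipH u u) ^+ 2); last by field.
apply: discriminant_le0 => [|t]; first exact: energy_ge0.
(* At [b = t / 2] the coefficient of the moment is [t ^ 2] and the linear one is [t * (n + 2)]. *)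
have := deficit_ge0 (t / 2) uS; rewrite /deficit.
by congr (0 <= _); field.
Qed.

(* By Green's formula, G is orthogonal to the gradient of every chi k. *)
Lemma closable (chi : nat -> 'rV[R]_n -> R) h (G : 'I_n -> 'rV[R]_n -> R) :
  (forall k, Cc_smooth (chi k)) -> L2H h -> (forall g, L2H g -> ipH h g = 0) ->
  ipH (fun x => chi k x - h x) (fun x => chi k x - h x) @[k --> \oo] --> 0 ->
  (forall i, L2H (G i) /\
    ipH (fun x => partial i (chi k) x - G i x) (fun x => partial i (chi k) x - G i x)
      @[k --> \oo] --> 0) ->
  energy G = 0.
Proof.
move=> Cchi Lh h0 ch hG.
have z k : \sum_(i < n) ipH (G i) (partial i (chi k)) = 0.
  (* Two successive limits: [j] goes to infinity with [k] fixed, so that all derivatives can be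
     moved onto [chi k]; afterwards [k] goes to infinity. *)
  have c1 : \sum_(i < n) ipH (partial i (chi j)) (partial i (chi k)) @[j --> \oo] -->
      \sum_(i < n) ipH (G i) (partial i (chi k)).
    apply: cvg_sum => i; have [Li ci] := hG i.
    by apply: (ip_cvgl mH _ Li _ ci) => [j|]; exact: Cc_smooth_L2_partial.
  have L2k i : L2H (partial i (partial i (chi k))).
    apply: (continuous_L2 (Cchi k)).
      by have [sk _ _] := Cchi k; have [_ /(_ i)[_]] := smooth_C1 (smooth_partial i sk).
    by apply: (@subset_trans _ (supp (partial i (chi k)))); exact: supp_partial.
  have c2 : \sum_(i < n) ipH (partial i (chi j)) (partial i (chi k)) @[j --> \oo] --> - (0 : R).
    rewrite (_ : (fun j => _) = fun j => - \sum_(i < n) ipH (chi j) (partial i (partial i (chi k)))).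
      apply: cvgN; rewrite [X in _ --> X](_ : _ = \sum_(i < n) ipH h (partial i (partial i (chi k)))).
        apply: cvg_sum => i.
        by apply: (ip_cvgl mH _ Lh (L2k i) ch) => j; exact: Cc_smooth_L2.
      by rewrite big1// => i _; rewrite h0.
    by apply/funext => j; exact: (green_Cc (Cchi j) (Cchi k)).
  by rewrite oppr0 in c2; exact: (cvg_unique _ c1 c2).
have c3 : \sum_(i < n) ipH (partial i (chi k)) (G i) @[k --> \oo] --> energy G.
  apply: cvg_sum => i; have [Li ci] := hG i.
  by apply: (ip_cvgl mH _ Li Li ci) => k; exact: Cc_smooth_L2_partial.
have c4 : \sum_(i < n) ipH (partial i (chi k)) (G i) @[k --> \oo] --> (0 : R).
  rewrite (_ : (fun k => _) = fun=> 0); first exact: cvg_cst.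
  by apply/funext => k; rewrite -[RHS](z k); apply: eq_bigr => i _; rewrite ipC.
exact: (cvg_unique _ c3 c4).
Qed.

Lemma ae_eq_ip0 u u' g : {ae mu, forall x, H x -> u x = u' x} ->
  measurable_fun H u -> measurable_fun H u' -> measurable_fun H g ->
  ipH (fun x => u x - u' x) g = 0.
Proof.
move=> uu' mfu mfu' mg; rewrite /ip /Rintegral.
rewrite (ae_eq_integral (cst 0%E))//.
- by rewrite integral0.
- by apply/measurable_EFinP; apply: measurable_funM => //; exact: measurable_funB.
- by apply: filterS uu' => x h Hx; rewrite /= h// subrr mul0r.
Qed.

Lemma ae_eq_ip u u' v v' : {ae mu, forall x, H x -> u x * v x = u' x * v' x} ->
  measurable_fun H (fun x => u x * v x) -> measurable_fun H (fun x => u' x * v' x) ->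
  ipH u v = ipH u' v'.
Proof.
move=> uu' mfu mfu'; rewrite /ip /Rintegral; congr fine; apply: ae_eq_integral => //.
- exact/measurable_EFinP.
- exact/measurable_EFinP.
- by apply: filterS uu' => x h Hx; rewrite /= h.
Qed.

Lemma cvg_sqrB (f g : nat -> 'rV[R]_n -> R) :
  (forall k, L2H (f k)) -> (forall k, L2H (g k)) ->
  ipH (f k) (f k) @[k --> \oo] --> 0 -> ipH (g k) (g k) @[k --> \oo] --> 0 ->
  ipH (fun x => f k x - g k x) (fun x => f k x - g k x) @[k --> \oo] --> 0.
Proof.
move=> Lf Lg cf cg.
apply: (@squeeze_cvgr _ _ _ _ (fun=> 0) (fun k => 2 * ipH (f k) (f k) + 2 * ipH (g k) (g k))).
- apply: nearW => k; rewrite ip_ge0/= (ip_sqrB mH (Lf k) (Lg k)).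
  have := ip_ge0 mu H (fun x => f k x + g k x); rewrite (ip_sqrD mH (Lf k) (Lg k)); lra.
- exact: cvg_cst.
- rewrite [X in _ --> X](_ : _ = 2 * 0 + 2 * 0); last by rewrite !mulr0 addr0.
  by apply: cvgD; exact: cvgMl_tmp.
Qed.

(** In the equality case [Du] is any gradient attached to [u], and [u] is a Gaussian only almost
    everywhere. Closability, applied to the difference of the two approximating sequences,
    identifies the two energies. *)
Lemma energy_unique u Du u' Du' : in_S u Du -> in_S u' Du' ->
  {ae mu, forall x, H x -> u x = u' x} -> energy (comp Du) = energy (comp Du').
Proof.
move=> uS uS' uu'.
have [phi [Cphi hD _ [Lu cu]]] := in_S_approx uS.
have [phi' [Cphi' hD' _ [Lu' cu']]] := in_S_approx uS'.
pose G i x := comp Du i x - comp Du' i x.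
have LG i : L2H (G i) by apply: L2B => //; [case: (hD i)|case: (hD' i)].
have G0 : energy G = 0.
  apply: (@closable (fun k x => phi k x - phi' k x) (fun x => u x - u' x)).
  - by move=> k; exact: Cc_smoothB.
  - exact: L2B.
  - move=> g [mg _]; apply: ae_eq_ip0 => //; [by case: Lu|by case: Lu'].
  - rewrite (_ : (fun k => _) = fun k =>
        ipH (fun x => (phi k x - u x) - (phi' k x - u' x))
            (fun x => (phi k x - u x) - (phi' k x - u' x))).
      apply: cvg_sqrB cu cu' => k; apply: L2B => //; exact: Cc_smooth_L2.
    by apply/funext => k; congr ipH; apply/funext => x; ring.
  - move=> i; split => //; have [Li ci] := hD i; have [Li' ci'] := hD' i.
    rewrite (_ : (fun k => _) = fun k =>
        ipH (fun x => (partial i (phi k) x - Du x 0 i) - (partial i (phi' k) x - Du' x 0 i))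
            (fun x => (partial i (phi k) x - Du x 0 i) - (partial i (phi' k) x - Du' x 0 i))).
      by apply: cvg_sqrB ci ci' => k; apply: L2B => //; exact: Cc_smooth_L2_partial.
    apply/funext => k; congr ipH; apply/funext => x.
      rewrite (_ : partial i (fun x => phi k x - phi' k x) x = partial i (phi k) x - partial i (phi' k) x).
        by rewrite /G /comp; ring.
      rewrite /partial deriveB//.
        by have [_ /(_ i)[]] := Cc_smooth_C1 (Cphi k).
      by have [_ /(_ i)[]] := Cc_smooth_C1 (Cphi' k).
    rewrite (_ : partial i (fun x => phi k x - phi' k x) x = partial i (phi k) x - partial i (phi' k) x).
      by rewrite /G /comp; ring.
    rewrite /partial deriveB//.
      by have [_ /(_ i)[]] := Cc_smooth_C1 (Cphi k).
    by have [_ /(_ i)[]] := Cc_smooth_C1 (Cphi' k).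
have Gi i : ipH (G i) (G i) = 0.
  apply/eqP; have /eqP := G0; rewrite /energy psumr_eq0 => [|j _]; last exact: ip_ge0.
  by move=> /allP/(_ i); rewrite mem_index_enum => /(_ isT).
(* [G i] has zero norm, so by Cauchy-Schwarz the cross term vanishes as well. *)
apply: eq_bigr => i _; have [Li _] := hD i; have [Li' _] := hD' i.
have -> : comp Du i = fun x => comp Du' i x + G i x.
  by apply/funext => x; rewrite /G addrC subrK.
rewrite ip_sqrD// Gi addr0.
have := ip_CauchySchwarz mH Li' (LG i); rewrite Gi mulr0 => h.
have /eqP : ipH (comp Du' i) (G i) ^+ 2 = 0 by apply/eqP; rewrite eq_le h sqr_ge0.
by rewrite sqrf_eq0 => /eqP ->; rewrite mulr0 addr0.
Qed.

(** Two limits of the inner product of the gradients of [phi k] and [W] are compared: the direct one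
    is the energy of [W], the one through [green_gaussian] is the rest of the deficit. *)
Lemma gaussian_deficit a b : 0 < b -> let W := @gaussian_profile R m a b in
  deficit b W (comp (grad W)) = 0.
Proof.
move=> b0 W.
have WS : in_S W (grad W) by exact: gaussian_in_S.
have [phi [Cphi hD hx [Lu cu]]] := in_S_approx WS.
have gE i : comp (grad W) i = partial i W by apply/funext => x; rewrite /comp mxE.
have c1 : \sum_(i < n) ipH (partial i (phi k)) (partial i W) @[k --> \oo] --> energy (comp (grad W)).
  apply: cvg_sum => i; have [Li ci] := hD i; rewrite -gE.
  by apply: (ip_cvgl mH _ Li Li ci) => k; exact: Cc_smooth_L2_partial.
have c2 : \sum_(i < n) ipH (partial i (phi k)) (partial i W) @[k --> \oo] -->
    2 * b * (n%:R + 2) * ipH W W - 4 * b ^+ 2 * moment W.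
  rewrite (_ : (fun k => _) = fun k => 2 * b * (n%:R + 2) * ipH (phi k) W -
    4 * b ^+ 2 * \sum_(j < n) ipH (fun x => x 0 j * phi k x) (fun x => x 0 j * W x)).
    apply: cvgB.
      by apply: cvgMl_tmp; apply: (ip_cvgl mH _ Lu Lu cu) => k; exact: Cc_smooth_L2.
    apply: cvgMl_tmp; apply: cvg_sum => j; have [Lj cj] := hx j.
    by apply: (ip_cvgl mH _ Lj Lj cj) => k; exact: Cc_smooth_L2_moment.
  by apply/funext => k; exact: green_gaussian.
by rewrite /deficit (cvg_unique _ c1 c2) ?subrK ?subrr//; exact: Rhausdorff.
Qed.

(** Zero deficit expresses [A] through [B] and [M], and then [N^2 M^2 / 4 - A B] is the square of
    [2 b B - N M / 2]. The inequality makes this square nonpositive, hence 0. *)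
Lemma gaussian_equality a b : 0 < b -> let W := @gaussian_profile R m a b in
  energy (comp (grad W)) * moment W =
  (n%:R + 2) ^+ 2 / 4 * ipH W W ^+ 2.
Proof.
move=> b0 W; have := gaussian_deficit a b0; rewrite -/W; have := uncertainty (gaussian_in_S m a b0).
rewrite /deficit; set A := energy _; set B := moment _; set M := ipH _ _.
set N := n%:R + 2 => h /eqP; rewrite subr_eq0 => /eqP e.
have eA : A = 2 * b * N * M - 4 * b ^+ 2 * B by rewrite -e; ring.
have /eqP : (2 * b * B - N * M / 2) ^+ 2 = 0.
  apply/eqP; rewrite eq_le sqr_ge0 andbT.
  rewrite (_ : _ ^+ 2 = N ^+ 2 / 4 * M ^+ 2 - A * B); last by rewrite eA; field.
  by rewrite subr_le0.
rewrite sqrf_eq0 subr_eq0 => /eqP e2.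
have -> : A * B = (2 * b * N * M - 2 * b * (2 * b * B)) * (2 * b * B) / (2 * b).
  by rewrite eA; field; rewrite gt_eqF.
by rewrite e2; field; rewrite gt_eqF.
Qed.

End consequences.

(** * Rigidity *)

Section rigidity_box.
Context (R : realType).

Lemma ae_exists d (T : measurableType d) (nu : {measure set T -> \bar R})
    (A : set T) (P : T -> Prop) :
  measurable A -> (0 < nu A)%E -> {ae nu, forall x, P x} -> exists x, A x /\ P x.
Proof.
move=> mA A0 [N [mN N0 PN]]; apply: contrapT => nex.
have AN : A `<=` N by move=> x Ax; apply: PN => Px; apply: nex; exists x.
have : (nu A <= nu N)%E by apply: le_measure => //; exact: mem_set.
by rewrite N0 leNgt A0.
Qed.

Context (n : nat) (B : 'I_n -> set R) (mB : forall i, measurable (B i)).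
Hypothesis Boo : forall i, (lebesgue_measure (B i) < +oo)%E.
Local Notation Q := (box B).
Local Notation mu := (lebesgue_rV R n).
Let V : R := fine (\prod_(i < n) lebesgue_measure (B i))%E.

Let VE : (\prod_(i < n) lebesgue_measure (B i))%E = V%:E.
Proof. by rewrite fineK//; apply: prode_fin_num => i _; rewrite ge0_fin_numE. Qed.

Let V0 : 0 <= V.
Proof. by apply: fine_ge0; apply: prode_ge0. Qed.

Lemma measurable_indic_abs (f : 'rV[R]_n -> R) : measurable_fun setT f ->
  measurable_fun setT (fun x => (\1_Q x * `|f x|)%:E).
Proof.
move=> mf; apply/measurable_EFinP; apply: measurable_funM.
  exact: measurable_indic_box.
exact: measurableT_comp.
Qed.

(** Transfers the vanishing of the oscillation to an L1 limit. The errors at [x] and at [y] are each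
    integrated over the other variable, whence [2 * V]. *)
Lemma oscillation_le (f g : 'rV[R]_n -> R) :
  measurable_fun setT f -> measurable_fun setT g ->
  (oscillation B f <= oscillation B g +
    (2 * V)%:E * \int[mu]_x (\1_Q x * `|g x - f x|)%:E)%E.
Proof.
move=> mf mg; pose a x := \1_Q x * `|g x - f x|.
have ma : measurable_fun setT (fun x => (a x)%:E).
  by apply: measurable_indic_abs; exact: measurable_funB.
have a0 x : 0 <= a x by rewrite mulr_ge0.
have m1 : measurable_fun setT (fun x : 'rV[R]_n => (\1_Q x : R)%:E).
  by apply/measurable_EFinP; exact: measurable_indic_box.
set A := (\int[mu]_x (a x)%:E)%E.
have A0 : (0 <= A)%E by apply: integral_ge0 => x _; rewrite lee_fin.
have mq (k : 'rV[R]_n -> R) x : measurable_fun setT k ->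
    measurable_fun setT (fun y => (\1_Q x * (\1_Q y * `|k x - k y|))%:E).
  move=> mk; apply/measurable_EFinP; apply: measurable_funM => //.
  apply: measurable_funM; first exact: measurable_indic_box.
  by apply: measurableT_comp => //; exact: measurable_funB.
pose I (k : 'rV[R]_n -> R) x := (\int[mu]_y (\1_Q x * (\1_Q y * `|k x - k y|))%:E)%E.
have inner x : (I f x <= I g x + ((a x)%:E * V%:E + (\1_Q x)%:E * A))%E.
  have s1 : (0 <= \int[mu]_y ((a x)%:E * (\1_Q y : R)%:E))%E.
    by apply: integral_ge0 => y _; rewrite lee_fin mulr_ge0.
  apply: (@le_trans _ _ (\int[mu]_y ((\1_Q x * (\1_Q y * `|g x - g y|))%:E +
      ((a x)%:E * (\1_Q y : R)%:E + (\1_Q x)%:E * (a y)%:E)))%E).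
    apply: ge0_le_integral => //.
    - exact: (mq f x mf).
    - apply: emeasurable_funD; first exact: (mq g x mg).
      by apply: emeasurable_funD; exact: measurable_funeM.
    - move=> y _; rewrite -!EFinM -!EFinD lee_fin /a.
      rewrite !indicE; case: (x \in Q); case: (y \in Q); rewrite ?(mul1r,mul0r,mulr0,mulr1,addr0)//=.
      have -> : f x - f y = (g x - g y) + (- (g x - f x) + (g y - f y)) by ring.
      apply: (le_trans (ler_normD _ _)); rewrite lerD2l.
      by apply: (le_trans (ler_normD _ _)); rewrite normrN.
  rewrite ge0_integralD//; last 3 first.
  - exact: (mq g x mg).
  - by move=> y _; rewrite -!EFinM -EFinD lee_fin addr_ge0 ?mulr_ge0.
  - by apply: emeasurable_funD; exact: measurable_funeM.
  apply: leeD => //; rewrite ge0_integralD//; last 4 first.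
  - by move=> y _; rewrite -EFinM lee_fin mulr_ge0.
  - exact: measurable_funeM.
  - by move=> y _; rewrite -EFinM lee_fin mulr_ge0.
  - exact: measurable_funeM.
  rewrite ge0_integralZl//; last by rewrite lee_fin.
  rewrite ge0_integralZl//; last by move=> y _; rewrite lee_fin.
  by rewrite integral_indic_box// VE.
have mI k : measurable_fun setT k -> measurable_fun setT (I k).
  by move=> mk; exact: measurable_osc_inner.
have I0 k x : (0 <= I k x)%E by exact: osc_inner_ge0.
rewrite /oscillation -/(I f) -/(I g).
have t0 x : (0 <= (a x)%:E * V%:E + (\1_Q x)%:E * A)%E.
  by apply: adde_ge0; apply: mule_ge0 => //; rewrite lee_fin.
have mt : measurable_fun setT (fun x => (a x)%:E * V%:E + (\1_Q x : R)%:E * A)%E.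
  by apply: emeasurable_funD; apply: emeasurable_funM => //; exact: measurable_cst.
apply: (@le_trans _ _ (\int[mu]_x (I g x + ((a x)%:E * V%:E + (\1_Q x)%:E * A)))%E).
  apply: ge0_le_integral => //.
  - by move=> x _; exact: I0.
  - exact: mI.
  - by apply: emeasurable_funD => //; exact: mI.
  - by move=> x _; exact: inner.
rewrite ge0_integralD//; last exact: mI.
apply: leeD; first exact: lexx.
rewrite ge0_integralD//; last 4 first.
- by move=> x _; rewrite -EFinM lee_fin mulr_ge0.
- by apply: emeasurable_funM => //; exact: measurable_cst.
- by move=> x _; apply: mule_ge0.
- by apply: emeasurable_funM => //; exact: measurable_cst.
rewrite ge0_integralZr//; [|by move=> x _; rewrite lee_fin].
rewrite ge0_integralZr//.
rewrite integral_indic_box// VE -/A muleC -ge0_muleDl ?lee_fin//.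
by rewrite -EFinD (_ : V + V = 2 * V)//; ring.
Qed.

(** The inner integral vanishes for almost every [x], hence for some [x] in the box, which has
    positive measure; the constant is the value of [f] there. *)
Lemma oscillation0 (f : 'rV[R]_n -> R) : measurable_fun setT f -> 0 < V ->
  oscillation B f = 0%E -> exists c, {ae mu, forall x, Q x -> f x = c}.
Proof.
move=> mf Vp; rewrite /oscillation; set I := (fun x => \int[mu]_y _)%E => o0.
have mI : measurable_fun setT I by exact: measurable_osc_inner.
have I0 x : (0 <= I x)%E by exact: osc_inner_ge0.
have /(ae_eq_integral_abs mu measurableT mI) aI : (\int[mu]_x `|I x| = 0)%E.
  by rewrite -[RHS]o0; apply: eq_integral => x _; rewrite gee0_abs.
have [x [Qx Ix]] : exists x, Q x /\ I x = 0%E.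
  apply: (@ae_exists _ _ mu Q (fun x => I x = 0%E)).
  - exact: measurable_box.
  - by rewrite lebesgue_rV_box// VE lte_fin.
  - by apply: filterS aI => x /(_ Logic.I).
exists (f x).
pose q y := (\1_Q y * `|f x - f y|)%:E.
have mq : measurable_fun setT q.
  apply/measurable_EFinP; apply: measurable_funM; first exact: measurable_indic_box.
  by apply: measurableT_comp => //; exact: measurable_funB.
have /(ae_eq_integral_abs mu measurableT mq) aq : (\int[mu]_y `|q y| = 0)%E.
  rewrite -[RHS]Ix; apply: eq_integral => y _.
  by rewrite gee0_abs ?lee_fin ?mulr_ge0// indicE mem_set// mul1r.
apply: filterS aq => y /(_ Logic.I)/= + Qy.
rewrite /q indicE mem_set// mul1r => -[] /eqP; rewrite normr_eq0 subr_eq0.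
by move=> /eqP.
Qed.

(** L2 smallness of [g k] gives L1 smallness of [f k] on the box, through [|f| <= e + f^2 / e] with
    [e] about the L2 norm of [g k]. The constant [c] will be a lower bound of [w] on the box. *)
Lemma indic_abs_cvg0 (D : set 'rV[R]_n) (c : R) (f g : nat -> 'rV[R]_n -> R) :
  measurable D -> Q `<=` D -> 0 < c ->
  (forall k, measurable_fun setT (f k)) -> (forall k, L2 mu D (g k)) ->
  (forall k x, Q x -> c * `|f k x| <= `|g k x|) ->
  ip mu D (g k) (g k) @[k --> \oo] --> 0 ->
  (\int[mu]_x (\1_Q x * `|f k x|)%:E)%E @[k --> \oo] --> 0%E.
Proof.
move=> mD QD c0 mf Lg fg cg.
have mQ : measurable Q by exact: measurable_box.
(* The harmonic term tends to 0 and keeps [e k] positive, so that it can be divided by. *)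
pose e k := Num.sqrt (ip mu D (g k) (g k)) + harmonic k.
have e0 k : 0 < e k by rewrite ltr_wpDl ?sqrtr_ge0// invr_gt0.
have ce : e k @[k --> \oo] --> (0 : R).
  rewrite -[X in _ --> X]addr0; apply: cvgD; last exact: cvg_harmonic.
  have := cvg_comp _ _ cg (@sqrt_continuous R 0).
  by rewrite sqrtr0.
have bound k : (\int[mu]_x (\1_Q x * `|f k x|)%:E <= (e k * (V + (c ^+ 2)^-1))%:E)%E.
  have s0 : (0 <= ((e k * c ^+ 2)^-1)%:E)%E.
    by rewrite lee_fin invr_ge0 mulr_ge0 ?sqr_ge0// ltW.
  have m2 : measurable_fun D (fun x => (g k x ^+ 2)%:E).
    by apply/measurable_EFinP; apply: measurable_funX; case: (Lg k).
  have m3 : measurable_fun setT (fun x : 'rV[R]_n => ((e k)%:E * (\1_Q x : R)%:E)%E).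
    by apply: measurable_funeM; apply/measurable_EFinP; exact: measurable_indic_box.
  have m4 : measurable_fun setT ((fun x => (g k x ^+ 2)%:E) \_ D).
    exact/(measurable_restrictT _ mD).
  have r0 x : (0 <= ((fun x => (g k x ^+ 2)%:E) \_ D) x)%E.
    by rewrite patchE; case: ifP => // _; rewrite lee_fin sqr_ge0.
  apply: (@le_trans _ _ (\int[mu]_x ((e k)%:E * (\1_Q x : R)%:E +
     ((e k * c ^+ 2)^-1)%:E * ((fun x => (g k x ^+ 2)%:E) \_ D) x))%E).
    apply: ge0_le_integral => //.
    - exact: measurable_indic_abs.
    - by apply: emeasurable_funD => //; exact: measurable_funeM.
    - move=> x _; rewrite indicE.
      have [Qx|nQ] := boolP (x \in Q); last first.
        by rewrite mul0r mule0 add0e mule_ge0.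
      have Qx' := set_mem Qx.
      rewrite patchE mem_set; last exact: QD.
      rewrite !mul1r mule1 -EFinM -EFinD lee_fin.
      have h := fg k x Qx'.
      have h2 : c ^+ 2 * `|f k x| ^+ 2 <= g k x ^+ 2.
        by rewrite -[leRHS]real_normK ?num_real// -exprMn ler_sqr// nnegrE mulr_ge0// ltW.
      apply: (@le_trans _ _ (e k + (e k)^-1 * `|f k x| ^+ 2)).
        rewrite -subr_ge0 (_ : _ - _ =
          (e k)^-1 * ((e k - `|f k x|) ^+ 2 + e k * `|f k x|)); last first.
          by field; rewrite gt_eqF.
        rewrite mulr_ge0 ?invr_ge0 ?(ltW (e0 k))// addr_ge0 ?sqr_ge0//.
        by rewrite mulr_ge0// ltW.
      rewrite lerD2l invfM -mulrA ler_wpM2l ?invr_ge0 ?(ltW (e0 k))//.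
      by rewrite mulrC ler_pdivlMr ?exprn_gt0// mulrC.
  rewrite ge0_integralD//; last 3 first.
  - by move=> x _; rewrite mule_ge0// lee_fin ltW.
  - by move=> x _; rewrite mule_ge0.
  - exact: measurable_funeM.
  rewrite ge0_integralZl//; last 2 first.
  - by apply/measurable_EFinP; exact: measurable_indic_box.
  - by rewrite lee_fin ltW.
  rewrite ge0_integralZl// integral_indic_box// VE.
  rewrite -integral_mkcond (ipE mD (Lg k)) -!EFinM -EFinD lee_fin mulrDr lerD2l.
  have i0 := ip_ge0 mu D (g k); have hk : 0 <= (harmonic k : R) by rewrite ltW// invr_gt0.
  have : ip mu D (g k) (g k) <= e k ^+ 2.
    rewrite -[leLHS]sqr_sqrtr// ler_sqr ?nnegrE ?sqrtr_ge0 ?(ltW (e0 k))//.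
    by rewrite /e lerDl.
  move=> h; rewrite invfM mulrAC ler_wpM2r ?invr_ge0 ?sqr_ge0//.
  by rewrite mulrC ler_pdivrMr// -expr2.
apply: (@squeeze_cvge _ _ _ _ (fun=> 0%E) _ (fun k => (e k * (V + (c ^+ 2)^-1))%:E)).
- by apply: nearW => k; rewrite bound andbT; apply: integral_ge0 => x _; rewrite lee_fin mulr_ge0.
- exact: cvg_cst.
- apply: cvg_EFin; first exact: nearW.
  by rewrite -[X in _ --> X](mul0r (V + (c ^+ 2)^-1)); apply: cvgMl.
Qed.

End rigidity_box.

Section rigidity.
Context (R : realType) (m : nat).
Local Notation n := (m.+1).
Local Notation H := (@half_space R m).
Local Notation mu := (lebesgue_rV R m.+1).
Local Notation ipH := (@ip _ _ R mu H).
Local Notation L2H := (@L2 _ _ R mu H).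
Implicit Types (u phi : 'rV[R]_n -> R) (Du : 'rV[R]_n -> 'rV[R]_n) (N : nat).
Let mH : measurable H := @measurable_half_space R m.

(** With [N + 2] the last side, from [1 / (N + 2)] to [N + 2], is nondegenerate already for
    [N = 0]. *)
Definition grid_lo N (i : 'I_n) : R := if i == ord_max then N.+2%:R^-1 else - N.+2%:R.

Definition grid N (i : 'I_n) : set R := `[grid_lo N i, N.+2%:R]%classic.

Lemma grid_lo_lt N i : grid_lo N i < N.+2%:R.
Proof.
rewrite /grid_lo; case: ifP => _.
  by rewrite (@lt_trans _ _ 1) ?ltr1n// invf_lt1 ?ltr1n// ltr0n.
by rewrite (@lt_trans _ _ 0) ?ltr0n// oppr_lt0 ltr0n.
Qed.

Lemma measurable_grid N i : measurable (grid N i).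
Proof. exact: measurable_itv. Qed.

Lemma measure_grid N i : lebesgue_measure (grid N i) = (N.+2%:R - grid_lo N i)%:E.
Proof. by rewrite lebesgue_measure_itv/= lte_fin grid_lo_lt. Qed.

Lemma measure_grid_lty N i : (lebesgue_measure (grid N i) < +oo)%E.
Proof. by rewrite measure_grid ltry. Qed.

Lemma measure_box_grid N :
  (\prod_(i < n) lebesgue_measure (grid N i))%E = (\prod_(i < n) (N.+2%:R - grid_lo N i))%:E.
Proof. by rewrite -prodEFin; apply: eq_bigr => i _; rewrite measure_grid. Qed.

Lemma prod_grid_gt0 N : 0 < \prod_(i < n) (N.+2%:R - grid_lo N i).
Proof. by apply: prodr_gt0 => i _; rewrite subr_gt0 grid_lo_lt. Qed.

Lemma mu_grid_gt0 N : (0 < mu (box (grid N)))%E.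
Proof.
rewrite lebesgue_rV_box; last exact: measurable_grid.
by rewrite measure_box_grid lte_fin prod_grid_gt0.
Qed.

Lemma grid_half_space N : box (grid N) `<=` H.
Proof.
move=> x /(_ ord_max); rewrite /grid /grid_lo eqxx /= in_itv/= => /andP[h _].
by rewrite /half_space/= /last_coord (lt_le_trans _ h)// invr_gt0 ltr0n.
Qed.

Lemma grid0_sub N : box (grid 0) `<=` box (grid N).
Proof.
move=> x Bx i; have := Bx i; rewrite /grid /grid_lo /= !in_itv/= => /andP[h1 h2].
have le2 : 2 <= N.+2%:R :> R by rewrite ler_nat.
rewrite (le_trans h2)// andbT (le_trans _ h1)//; case: ifP => _.
  by rewrite lef_pV2// posrE ltr0n.
by rewrite lerN2.
Qed.

Lemma grid_cover x : H x -> exists N, box (grid N) x.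
Proof.
move=> Hx; have lx : 0 < x 0 ord_max by exact: Hx.
exists (Num.truncn (`|x| + (x 0 ord_max)^-1)) => i.
set N := Num.truncn _.
have hN : `|x| + (x 0 ord_max)^-1 < N.+2%:R.
  by rewrite (lt_trans (truncnS_gt _))// ltr_nat.
have xi : `|x 0 i| <= N.+2%:R.
  apply: (le_trans (le_coord_norm x i)); apply/ltW; apply: le_lt_trans hN.
  by rewrite lerDl invr_ge0 ltW.
move: xi; rewrite ler_norml /grid /grid_lo /= in_itv/= => /andP[h1 ->]; rewrite andbT.
case: eqP => // ->; rewrite -[leRHS]invrK lef_pV2 ?posrE ?ltr0n ?invr_gt0//.
by apply/ltW; apply: le_lt_trans hN; rewrite lerDr.
Qed.

Lemma gaussian_profile_grid b N : 0 < b ->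
  exists2 c : R, 0 < c & forall x, box (grid N) x -> c <= gaussian_profile 1 b x.
Proof.
move=> b0; exists (N.+2%:R^-1 * expR (- (b * (n%:R * N.+2%:R ^+ 2)))).
  by rewrite mulr_gt0 ?expR_gt0// invr_gt0 ltr0n.
move=> x Bx; have Hx := grid_half_space Bx.
rewrite /gaussian_profile mul1r ler_pM ?invr_ge0 ?expR_ge0 ?ler0n//.
  by have := Bx ord_max; rewrite /grid /grid_lo eqxx /= in_itv/= => /andP[].
rewrite ler_expR lerN2 ler_wpM2l ?(ltW b0)//.
rewrite /sqnorm mulr_natl -[n in leRHS]card_ord -sumr_const ler_sum// => i _.
rewrite -[leLHS]real_normK ?num_real// ler_sqr ?nnegrE ?ler0n//.
have := Bx i; rewrite /grid /= in_itv/= ler_norml => /andP[h ->]; rewrite andbT.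
apply: le_trans h; rewrite /grid_lo; case: ifP => // _.
by apply: (@le_trans _ _ 0); rewrite ?invr_ge0 ?ler0n// oppr_le0 ler0n.
Qed.

Lemma rigidity b u Du : 0 < b -> in_S u Du -> deficit b u (comp Du) = 0 ->
  exists a, {ae mu, forall x, H x -> u x = gaussian_profile a b x}.
Proof.
move=> b0 uS q0; have [mfu _ _] := uS.
have [phi [Cphi hD hx hu]] := in_S_approx uS; have [Lu cu] := hu.
set w := @gaussian_profile R m 1 b.
have sW : smooth w by apply: elem_smooth; exact: elem_gaussian_profile.
have C1w := smooth_C1 sW; have [cw dw] := C1w.
have mw : measurable_fun setT w by exact: continuous_measurable_fun_rV.
pose psi k x := phi k x / w x.
have C1psi k : C1 (psi k).
  apply: C1_div_supp => //; first exact: Cc_smooth_C1.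
  have [_ _ pH] := Cphi k => x /pH Hx /=; rewrite gt_eqF//; exact: gaussian_profile_gt0.
have mpsi k : measurable_fun setT (psi k).
  by have [c _] := C1psi k; exact: continuous_measurable_fun_rV.
have mdpsi k i : measurable_fun setT (partial i (psi k)).
  by have [_ /(_ i)[_ c]] := C1psi k; exact: continuous_measurable_fun_rV.
have ce : energy (fun i x => w x * partial i (psi k) x) @[k --> \oo] --> 0.
  rewrite -q0 (_ : (fun k => _) = fun k => deficit b (phi k) (fun i => partial i (phi k))).
    exact: (deficit_cvg (b := b) Cphi hD hx hu).
  by apply/funext => k; rewrite /deficit energy_identity.
have Lwd k i : L2H (fun x => w x * partial i (psi k) x).
  have [_ /(_ i)[_ c]] := C1psi k.
  apply: (continuous_L2 (Cphi k)); first exact: continuous_mulf.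
  by apply: suppMr; apply: (@subset_trans _ (supp (psi k))); [exact: supp_partial|exact: suppMl].
have ci i : ipH (fun x => w x * partial i (psi k) x) (fun x => w x * partial i (psi k) x)
    @[k --> \oo] --> 0.
  apply: (@squeeze_cvgr _ _ _ _ (fun=> 0)); [|exact: cvg_cst|exact: ce].
  apply: nearW => k; rewrite ip_ge0/= /energy (bigD1 i)//= lerDl.
  by apply: sumr_ge0 => j _; exact: ip_ge0.
(* This is [u / w] on the half-space. Extending [u] by 0 and using a real power of [w] make it
   measurable on the whole space. *)
pose h x := (u \_ H) x * (w x `^ (-1)).
have mh : measurable_fun setT h.
  apply: measurable_funM; first exact/(measurable_restrictT _ mH).
  exact: (measurableT_comp (measurable_powR (-1)) mw).
have hE x : H x -> h x = u x / w x.
  move=> Hx; rewrite /h patchE mem_set// powR_inv1// ltW//.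
  exact: gaussian_profile_gt0.
have step N : exists a, {ae mu, forall x, box (grid N) x -> h x = a}.
  have [c c0 cw0] := gaussian_profile_grid N b0.
  have QH := @grid_half_space N.
  apply: oscillation0 => //; [exact: measurable_grid|exact: measure_grid_lty|..].
    by rewrite measure_box_grid prod_grid_gt0.
  have [C C0 poincare] := poincare_box (@measurable_grid N) (@measure_grid_lty N).
  set K := (2 * fine (\prod_(i < n) lebesgue_measure (grid N i)))%:E.
  (* A bound on the oscillation of [h]: Poincare for [psi k], plus the price of replacing [h] by
     [psi k]. Since [w >= c] on the box, [c |partial i (psi k)|] and [c |psi k - h|] are dominated
     by functions that tend to 0 in L2. *)
  pose bd k := (C%:E * (\sum_(i < n) \int[mu]_x (\1_(box (grid N)) x * `|partial i (psi k) x|)%:E) +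
     K * \int[mu]_x (\1_(box (grid N)) x * `|psi k x - h x|)%:E)%E.
  have cbd : bd k @[k --> \oo] --> 0%E.
    rewrite -[X in _ --> X]adde0; apply: cvgeD => //.
      rewrite -[X in _ --> X](mule0 C%:E); apply: cvgeZl => //; apply: cvge_sum0 => i.
      apply: (indic_abs_cvg0 (c := c) (@measurable_grid N) (@measure_grid_lty N) mH QH c0 _ (Lwd^~ i) _ (ci i)) => //.
      by move=> k x Qx; rewrite normrM ler_wpM2r// (le_trans (cw0 x Qx))// ler_norm.
    rewrite -[X in _ --> X](mule0 K); apply: cvgeZl => //.
    apply: (indic_abs_cvg0 (c := c) (g := fun k x => phi k x - u x)
      (@measurable_grid N) (@measure_grid_lty N) mH QH c0) => //.
    - by move=> k; exact: measurable_funB.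
    - by move=> k; apply: L2B => //; exact: Cc_smooth_L2.
    - move=> k x Qx; have Hx := QH x Qx; rewrite hE// /psi -mulrBl.
      have w0 : 0 < w x by exact: gaussian_profile_gt0.
      rewrite normrM [`|(w x)^-1|]gtr0_norm ?invr_gt0// mulrA ler_pdivrMr//.
      by rewrite mulrC ler_wpM2l// cw0.
  apply/eqP; rewrite eq_le; apply/andP; split; last first.
    by apply: integral_ge0 => x _; exact: osc_inner_ge0.
  apply: (cvge_to_ge cbd); apply: nearW => k.
  apply: (le_trans (oscillation_le (@measurable_grid N) (@measure_grid_lty N) mh (mpsi k))).
  apply: leeD; last exact: lexx.
  apply: (poincare (psi k) (fun i x => (\1_(box (grid N)) x * `|partial i (psi k) x|)%:E)).
  - exact: mpsi.
  - by move=> i; apply: measurable_indic_abs => //; exact: measurable_grid.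
  - by move=> i x; rewrite lee_fin mulr_ge0.
  - apply: upper_gradient_C1 => //; [|exact: measurable_grid].
    by move=> i; exact: interval_is_interval.
have [a0 ha0] := step 0%N.
(* All boxes contain the first one, which has positive measure, so their constants agree. *)
have hN N : {ae mu, forall x, box (grid N) x -> h x = a0}.
  have [aN haN] := step N.
  have [x [Q0x e]] := ae_exists (measurable_box (@measurable_grid 0)) (mu_grid_gt0 0)
    (filterI ha0 haN).
  have <- : aN = a0 by case: e => <-// <-//; exact: grid0_sub.
  exact: haN.
exists a0; apply: filterS (ae_foralln hN) => x hx0 Hx.
have [N QNx] := grid_cover Hx; have := hx0 N QNx; rewrite hE// => <-.
have w0 := gaussian_profile_gt0 b Hx.
have -> : gaussian_profile (u x / w x) b x = u x / w x * w x.
  by rewrite /w /gaussian_profile mul1r mulrA.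
by rewrite divfK// gt_eqF.
Qed.

End rigidity.

Section equality_cases.
Context (R : realType) (m : nat).
Local Notation n := (m.+1).
Local Notation H := (@half_space R m).
Local Notation mu := (lebesgue_rV R m.+1).
Local Notation ipH := (@ip _ _ R mu H).
Local Notation L2H := (@L2 _ _ R mu H).
Implicit Types (u phi : 'rV[R]_n -> R) (Du : 'rV[R]_n -> 'rV[R]_n).
Let mH : measurable H := @measurable_half_space R m.

Lemma ip_eq0_ae f : L2H f -> ipH f f = 0 -> {ae mu, forall x, H x -> f x = 0}.
Proof.
move=> Lf f0; have [mf _] := Lf.
have mf2 : measurable_fun H (fun x => (f x ^+ 2)%:E).
  by apply/measurable_EFinP; exact: measurable_funX.
have /(ae_eq_integral_abs mu mH mf2) af : (\int[mu]_(x in H) `|(f x ^+ 2)%:E| = 0)%E.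
  rewrite -[RHS](congr1 EFin f0) -(ipE mH Lf); apply: eq_integral => x _.
  by rewrite gee0_abs// lee_fin sqr_ge0.
apply: filterS af => x /[apply] -[] /eqP.
by rewrite sqrf_eq0 => /eqP.
Qed.

(** An extremal of positive mass is what sharpness needs: the mass can then be cancelled. *)
Lemma gaussian_mass_gt0 : 0 < ipH (@gaussian_profile R m 1 1) (gaussian_profile 1 1).
Proof.
have [_ [_ _ _ [LW _]]] := in_S_approx (gaussian_in_S m 1 (@ltr01 R)).
rewrite lt_neqAle ip_ge0 andbT eq_sym; apply/eqP => W0.
have [x [Qx Wx]] := ae_exists (measurable_box (@measurable_grid R m 0))
  (mu_grid_gt0 R m 0) (ip_eq0_ae LW W0).
have Hx := grid_half_space Qx.
by have := gaussian_profile_gt0 1 Hx; rewrite Wx// ltxx.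
Qed.

Lemma equality_gaussian u Du : in_S u Du ->
  energy (comp Du) * moment u = (n%:R + 2) ^+ 2 / 4 * ipH u u ^+ 2 ->
  has_gaussian_form u.
Proof.
move=> uS; have [_ [_ _ _ [Lu _]]] := in_S_approx uS.
have [M0 _|M0] := eqVneq (ipH u u) 0.
  (* Zero mass: [u] vanishes almost everywhere and is the profile with [alpha = 0]; any positive
     [beta] would do. *)
  exists 0, 1; split; first exact: ltr01.
  apply: filterS (ip_eq0_ae Lu M0) => x u0 /u0 ->.
  by rewrite /gaussian_profile !mul0r.
have Mp : 0 < ipH u u by rewrite lt_neqAle eq_sym M0 ip_ge0.
have N0 : 0 < (n%:R + 2 : R) by rewrite addr_gt0// ltr0n.
have B0 : 0 <= moment u by exact: energy_ge0.
move=> eAB.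
have Bp : 0 < moment u.
  rewrite lt_neqAle B0 andbT eq_sym; apply/eqP => Bz.
  have : 0 < (n%:R + 2) ^+ 2 / 4 * ipH u u ^+ 2.
    by rewrite mulr_gt0 ?exprn_gt0// mulr_gt0 ?invr_gt0 ?exprn_gt0.
  by rewrite -eAB Bz mulr0 ltxx.
(* The minimizer of the deficit as a quadratic in [b]; equality says that the minimum is 0. *)
pose b := (n%:R + 2) * ipH u u / (4 * moment u).
have bp : 0 < b by rewrite divr_gt0 ?mulr_gt0.
have d0 : deficit b u (comp Du) = 0.
  rewrite /deficit.
  have -> : energy (comp Du) = (n%:R + 2) ^+ 2 / 4 * ipH u u ^+ 2 / moment u.
    by rewrite -eAB mulfK// gt_eqF.
  rewrite /b; move: (ipH u u) (moment u) (n%:R + 2 : R) Bp => M B N Bp.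
  by field; rewrite gt_eqF.
have [a ha] := rigidity bp uS d0.
by exists a, b.
Qed.

Lemma gaussian_form_equality u Du : in_S u Du -> has_gaussian_form u ->
  energy (comp Du) * moment u = (n%:R + 2) ^+ 2 / 4 * ipH u u ^+ 2.
Proof.
move=> uS [a [b [b0 uW]]]; pose W := @gaussian_profile R m a b.
have WS : in_S W (grad W) by exact: gaussian_in_S.
have [phi [_ _ hx [Lu _]]] := in_S_approx uS.
have [phiW [_ _ hxW [LW _]]] := in_S_approx WS.
have mp f g : L2H f -> L2H g -> measurable_fun H (fun x => f x * g x).
  by move=> [mf _] [mg _]; exact: measurable_funM.
rewrite (energy_unique uS WS uW).
have -> : moment u = moment W.
  apply: eq_bigr => j _; have [Lj _] := hx j; have [LWj _] := hxW j.
  by apply: ae_eq_ip; [apply: filterS uW => x h Hx; rewrite h|exact: mp..].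
have -> : ipH u u = ipH W W.
  by apply: ae_eq_ip; [apply: filterS uW => x h Hx; rewrite h|exact: mp..].
exact: gaussian_equality.
Qed.

End equality_cases.

Local Open Scope ereal_scope.

(* The dimension is n = m.+1 >= 1, and the half-space is R^m x R_{>0}. *)
Theorem theorem1p2 (R : realType) (m : nat) :
  let sharp_const : R := ((m.+1%:R + 2) ^+ 2 / 4)%R in
  [/\ (forall (u : 'rV[R]_m.+1 -> R) (Du : 'rV[R]_m.+1 -> 'rV[R]_m.+1),
        in_S u Du ->
        sharp_const%:E * mass u ^+ 2 <= gradient_energy Du * second_moment u),
      (forall C : R,
        (forall (u : 'rV[R]_m.+1 -> R) (Du : 'rV[R]_m.+1 -> 'rV[R]_m.+1),
          in_S u Du ->
          C%:E * mass u ^+ 2 <= gradient_energy Du * second_moment u) ->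
        (C <= sharp_const)%R),
      (forall (u : 'rV[R]_m.+1 -> R) (Du : 'rV[R]_m.+1 -> 'rV[R]_m.+1),
        in_S u Du ->
        (gradient_energy Du * second_moment u = sharp_const%:E * mass u ^+ 2
         <-> has_gaussian_form u)) &
      (forall alpha beta : R, (0 < beta)%R ->
        exists Du : 'rV[R]_m.+1 -> 'rV[R]_m.+1,
          in_S (gaussian_profile alpha beta) Du)].
Proof.
move=> sharp_const; split.
- move=> u Du uS; have [-> -> ->] := in_S_finite uS.
  by rewrite -EFin_expe -!EFinM lee_fin; exact: uncertainty.
(* The profile with [alpha = beta = 1] attains equality, so dividing by its squared mass bounds
   [C]. *)
- move=> C hC; have WS := gaussian_in_S m 1 (@ltr01 R).
  have := hC _ _ WS; have [-> -> ->] := in_S_finite WS.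
  rewrite -EFin_expe -!EFinM lee_fin (gaussian_equality m 1 (@ltr01 R)).
  by rewrite ler_pM2r// exprn_gt0//; exact: gaussian_mass_gt0.
- move=> u Du uS; have [-> -> ->] := in_S_finite uS.
  rewrite -EFin_expe -!EFinM; split.
    by move=> [] e; exact: equality_gaussian uS e.
  by move=> uW; rewrite (gaussian_form_equality uS uW).
- move=> a b b0; exists (grad (gaussian_profile a b)); exact: gaussian_in_S.
Qed.
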